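(* Assume that $\delta_{n,\mathcal N}\ge1$ for every $n\in\mathcal N$. Let $h\in H$, let $a$ be a reduced lift of $h$ with $\mathbf c_a\in\sum_{n\in\mathcal N}[0,1)E_n$, and let $\{\mathfrak v_n\}_{n\in\mathcal N}$ be vectors which are admissible for $(a-k,\kappa=1)$ for every $0\le k\le\delta-2$. Then $$P_h(\mathbf t_{\mathcal N})=\sum_{\widehat{\mathcal N}\subseteq\mathcal I\subseteq\mathcal N}(-1)^{|\mathcal I\setminus\widehat{\mathcal N}|}\sum_{0\le k\le\delta-2}(-1)^k\binom{\delta-2}{k}\sum_{\ell\in\mathrm{gr}_k\mathcal M^-_{a,\mathcal I}}Pol_{(\ell,\,\mathcal N\setminus\mathcal I)}(\mathbf t_{\mathcal N}),$$ where $k=\sum_{n\in\widehat{\mathcal N}}k_nE^*_n$ with $k_n\in\mathbb Z$ (and $k_n:=0$ for $n\in\mathcal N\setminus\widehat{\mathcal N}$), $0\le k\le\delta-2$ means $0\le k_n\le\delta_{n,\mathcal N}-2$ for all $n\in\widehat{\mathcal N}$, and $(-1)^k\binom{\delta-2}{k}:=\prod_{n\in\widehat{\mathcal N}}(-1)^{k_n}\binom{\delta_{n,\mathcal N}-2}{k_n}$.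
   Context: **Graph and lattices.** $\Gamma$ is a connected negative definite plumbing tree with vertex set $\mathcal V$, all genera $0$, integer decorations $b_v$, which is the dual graph of the minimal good resolution of a normal surface singularity (so $b_v\le -2$ whenever the valency $\delta_v\le 2$); $M$ is its plumbed 3-manifold (a rational homology sphere). $L=\bigoplus_{v\in\mathcal V}\mathbb Z E_v$ has the negative definite form $(E_v,E_v)=b_v$, $(E_v,E_w)=1$ if $v\neq w$ are adjacent, $0$ otherwise. $L'=\{l'\in L\otimes\mathbb Q:(l',L)\subset\mathbb Z\}\supset L$ is freely generated by $E_v^*$, where $(E_v^*,E_w)=-1$ if $v=w$ and $0$ otherwise. $H=L'/L\simeq H_1(M,\mathbb Z)$, $[l']$ is the class of $l'$. **Nodes and Seifert invariants.** $\mathcal N=\{n:\delta_n\ge 3\}$ is the set of nodes (assumed nonempty), $\mathcal E=\{u:\delta_u=1\}$ the set of ends. For $n\in\mathcal N$, $\mathcal N_n$ is the set of nodes $n'\ne n$ such that the path from $n$ to $n'$ has no node in its interior $(n,n')$ (neighbouring nodes); $\mathcal E_n$ is the set of ends $u$ such that the path $(n,u]$ ($n$ excluded) contains no node. $\delta_{n,\mathcal N}=|\mathcal N_n|$, $\widehat{\mathcal N}=\{n\in\mathcal N:\delta_{n,\mathcal N}\ge 2\}$. For a full subgraph, $\det$ denotes the determinant of the negative of its intersection matrix ($1$ for the empty graph). For $u\in\mathcal E_n$: $\alpha_u=\det_{(n,u]}$ and $\omega_u$ is the determinant of $(n,u]$ with the vertex adjacent to $n$ deleted. For $n'\in\mathcal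 N_n$: $\alpha_{n,n'}=\alpha_{n',n}=\det_{(n,n')}$ and $\omega_{n,n'}$ is the determinant of $(n,n')$ with the vertex adjacent to $n$ deleted; if $(n,n')=\emptyset$ put $\alpha_{n,n'}=1$, $\omega_{n,n'}=0$. **Reduced lifts.** For each pair of neighbouring nodes fix an order $n<n'$ or $n'<n$; sums over $n'>n$ or $n'<n$ run over neighbouring nodes $n'\in\mathcal N_n$, and ''$n<n'$'' always refers to neighbouring nodes. For $n<n'$, $n_{n'}$ is the vertex adjacent to $n$ on the path from $n$ to $n'$ ($n_{n'}=n'$ if $(n,n')=\emptyset$). A reduced lift of $h\in H$ is an element $a=\sum_{n\in\mathcal N}a_nE_n^*+\sum_{u\in\mathcal E}a_uE_u^*+\sum_{n<n'}a_{n_{n'}}E^*_{n_{n'}}\in L'$, given with its integer coefficients (coefficient $a_{n_{n'}}$ is kept separate from $a_{n'}$ if $(n,n')=\emptyset$), such that $[a]=h$. For $k=\sum_{n\in\mathcal N} k_nE_n^*$, $a-k$ is the reduced lift with $a_n$ replaced by $a_n-k_n$. $\pi_{\mathcal N}:\mathbb R\langle E_v\rangle_{v\in\mathcal V}\to\mathbb R\langle E_n\rangle_{n\in\mathcal N}$ is the coordinate projection and $\mathbf c_a:=\pi_{\mathcal N}(a)$. **Poincaré series.** $\mathbf t^{l'}=\prod_v t_v^{l_v}$ for $l'=\sum_v l_vE_v$. Let $Z_H(\mathbf t)=\sum_{l'}p_{l'}[l']\mathbf t^{l'}$ be the Taylor expansion at the origin of $f_H(\mathbf t)=\prod_{v\in\mathcal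 V}(1-[E_v^*]\mathbf t^{E_v^*})^{\delta_v-2}$ (coefficients in $\mathbb Z[H]$), $Z_h(\mathbf t)=\sum_{[l']=h}p_{l'}\mathbf t^{l'}$, and $Z_h(\mathbf t_{\mathcal N})=Z_h(\mathbf t)|_{t_v=1,\,v\notin\mathcal N}$; this is the expansion of a rational function (with rational exponents). **Sets attached to a reduced lift $a$.** $\mathbb Z^{\mathcal N}(a)=\{\ell=\sum_{n\in\mathcal N}\ell_nE_n:\ \ell_n\in\mathbb Z,\ \ell_n+\omega_{n',n}\ell_{n'}\equiv a_{n_{n'}}\ (\mathrm{mod}\ \alpha_{n,n'})\ \forall\, n<n'\}$. For $n\in\mathcal N$, $$N_a(\ell,n)=a_n+\sum_{n'>n}\frac{\omega_{n,n'}}{\alpha_{n,n'}}a_{n_{n'}}+\sum_{n'<n}\frac{1}{\alpha_{n,n'}}a_{n'_n}-\Big(b_n+\sum_{n'\in\mathcal N_n}\frac{\omega_{n,n'}}{\alpha_{n,n'}}\Big)\ell_n-\sum_{n'\in\mathcal N_n}\frac{\ell_{n'}}{\alpha_{n,n'}}+\sum_{u\in\mathcal E_n}\Big\lfloor\frac{a_u-\omega_u\ell_n}{\alpha_u}\Big\rfloor,$$ $\overline N_a(\ell,n)=N_a(\ell,n)+\sum_{u\in\mathcal E_n}\{(a_u-\omega_u\ell_n)/\alpha_u\}$ ($\{\cdot\}$ is the fractional part). $\mathcal M_a=\{\ell\in\mathbb Z^{\mathcal N}(a):N_a(\ell,n)\ge 0\ \forall n\in\mathcal N\}$, $\overline{\mathcal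 M}_a=\{\ell\in\mathbb Z^{\mathcal N}(a):\overline N_a(\ell,n)\ge 0\ \forall n\in\mathcal N\}$. $\mathcal C^{orb}=\pi_{\mathcal N}(\mathcal S'_{\mathbb R})$, where $\mathcal S'_{\mathbb R}=\{l\in L\otimes\mathbb R:(l,E_v)\le 0\ \forall v\in\mathcal V\}$. **Admissible vectors and holes.** A family $\{\mathfrak v_n\}_{n\in\mathcal N}\subset\mathcal M_0$ is called admissible for $(a,\kappa)$, with $a$ a reduced lift and $\kappa\ge 0$, if $\mathbb R_{\ge0}\langle\mathfrak v_n\rangle_{n\in\mathcal N}=\mathcal C^{orb}$ and for all $\ell\in\overline{\mathcal M}_a$, $n\in\mathcal N$: $N_a(\ell+\mathfrak v_n,n')=N_a(\ell,n')$ for all nodes $n'\ne n$, and $N_a(\ell+\mathfrak v_n,n)\ge\kappa$. $\Box=\sum_{n\in\mathcal N}[0,1)\mathfrak v_n$. For $\widehat{\mathcal N}\subseteq\mathcal I\subseteq\mathcal N$, $$\mathrm{gr}_k\mathcal M^-_{a,\mathcal I}=\{\ell\in(\Box-\mathbf c_{a-k})\cap\mathbb Z^{\mathcal N}(a):\ N_a(\ell,n)<0\ \forall n\in\mathcal I\setminus\widehat{\mathcal N},\ N_a(\ell,n)=k_n\ \forall n\in\widehat{\mathcal N}\}.$$ **Polynomials attached to $(\ell,\mathcal I)$.** Let $\ell\in\overline{\mathcal M}_a\subset\mathbb Z^{\mathcal N}$ and $\mathcal I\subseteq\mathcal N$, and consider $\mathcal H_{(\ell,\mathcal I)}(\mathbf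 t_{\mathcal N})=\mathbf t^{\ell}/\prod_{\widetilde n\in\mathcal I}(1-\mathbf t^{\mathfrak v_{\widetilde n}})$. $\pi_n$, $\pi_{n,n'}$ are the coordinate projections to $\mathbb R E_n$, $\mathbb R\langle E_n,E_{n'}\rangle$. (1) For $n\in\mathcal N$, $Pol^n_{(\ell,\mathcal I)}$ is the polynomial part of $\mathcal H_{(\ell,\mathcal I)}$ with respect to $t_n$, given by division with remainder with respect to $t_n$ (the other variables being considered as coefficients), i.e. by the unique decomposition $\mathbf t^\ell=Pol^n_{(\ell,\mathcal I)}\prod_{\widetilde n\in\mathcal I}(1-\mathbf t^{\mathfrak v_{\widetilde n}})+R^n$ such that $R^n$ is supported on $\sum_{\widetilde n\in\mathcal I}[0,1)\pi_n(\mathfrak v_{\widetilde n})$ as a one-variable polynomial in $t_n$. (2) For neighbouring nodes $n,n'$, let $\Gamma_n\ni n$, $\Gamma_{n'}\ni n'$ be the two subgraphs obtained from $\Gamma$ by removing the chain $(n,n')$ (the connecting edge if the chain is empty), with node sets $\mathcal N(\Gamma_n)$, $\mathcal N(\Gamma_{n'})$; put $\mathcal I_n=\mathcal I\cap\mathcal N(\Gamma_n)$, $\mathcal I_{n'}=\mathcal I\cap\mathcal N(\Gamma_{n'})$. $Pol^{nn'}_{(\ell,\mathcal I)}$ is the polynomial part of $\mathcal H_{(\ell,\mathcal I)}$ associated with the chain $(n,n')$, given by the unique decomposition $$\mathbf t^\ell=Pol^{nn'}_{(\ell,\mathcal I)}\prod_{\widetilde n\in\mathcal I}(1-\mathbf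 t^{\mathfrak v_{\widetilde n}})+R_1\prod_{\widetilde n\in\mathcal I_{n'}}(1-\mathbf t^{\mathfrak v_{\widetilde n}})+R_2\prod_{\widetilde n\in\mathcal I_n}(1-\mathbf t^{\mathfrak v_{\widetilde n}})+R,$$ where, as two-variable polynomials in $t_n,t_{n'}$: (i) $Pol^{nn'}_{(\ell,\mathcal I)}$ is supported on $\mathbb Z^2\setminus\mathbb Z_{<0}\langle E_n,E_{n'}\rangle$; (ii) $R_1$ is supported on $\mathbb Z^2\cap\big(\mathbb Z_{\le0}\langle E_n\rangle+\sum_{\widetilde n\in\mathcal I_n}[0,1)\pi_{n,n'}(\mathfrak v_{\widetilde n})\big)$; (iii) $R_2$ is supported on $\mathbb Z^2\cap\big(\mathbb Z_{\le0}\langle E_{n'}\rangle+\sum_{\widetilde n\in\mathcal I_{n'}}[0,1)\pi_{n,n'}(\mathfrak v_{\widetilde n})\big)$; (iv) $R$ is supported on $\mathbb Z^2\cap\big(\sum_{\widetilde n\in\mathcal I}[0,1)\pi_{n,n'}(\mathfrak v_{\widetilde n})\big)$. (3) $Pol_{(\ell,\mathcal I)}:=\sum_{n<n'}Pol^{nn'}_{(\ell,\mathcal I)}-\sum_{n\in\mathcal N}(\delta_{n,\mathcal N}-1)Pol^n_{(\ell,\mathcal I)}$. **Polynomial part $P_h$ of $Z_h(\mathbf t_{\mathcal N})$ (László–Szilágyi).** Here exponents are rational and ''Laurent polynomial'' allows rational exponents. Let $\mathcal I=\mathcal N\setminus\widehat{\mathcal N}$. $P_h^n$ is the unique Laurent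 polynomial with only nonnegative $t_n$-exponents such that $Z_h(\mathbf t_{\mathcal N})-P_h^n=R^n/\prod_{\widetilde n\in\mathcal I}(1-\mathbf t^{\mathfrak v_{\widetilde n}})$, where the $t_n$-exponents of $R^n$ lie in $\sum_{\widetilde n\in\mathcal I}[0,1)\pi_n(\mathfrak v_{\widetilde n})$. For neighbouring nodes $n,n'$, $P_h^{nn'}$ is the unique Laurent polynomial none of whose $(t_n,t_{n'})$-exponents has both coordinates negative, such that $$Z_h(\mathbf t_{\mathcal N})-P_h^{nn'}=\frac{R_1}{\prod_{\widetilde n\in\mathcal I_n}(1-\mathbf t^{\mathfrak v_{\widetilde n}})}+\frac{R_2}{\prod_{\widetilde n\in\mathcal I_{n'}}(1-\mathbf t^{\mathfrak v_{\widetilde n}})}+\frac{R}{\prod_{\widetilde n\in\mathcal I}(1-\mathbf t^{\mathfrak v_{\widetilde n}})},$$ where the $(t_n,t_{n'})$-exponents of $R_1$, $R_2$, $R$ lie in $\mathbb R_{\le0}E_n+\sum_{\widetilde n\in\mathcal I_n}[0,1)\pi_{n,n'}(\mathfrak v_{\widetilde n})$, $\mathbb R_{\le0}E_{n'}+\sum_{\widetilde n\in\mathcal I_{n'}}[0,1)\pi_{n,n'}(\mathfrak v_{\widetilde n})$ and $\sum_{\widetilde n\in\mathcal I}[0,1)\pi_{n,n'}(\mathfrak v_{\widetilde n})$ respectively. Finally $P_h(\mathbf t_{\mathcal N})=\sum_{n<n'}P_h^{nn'}-\sum_{n\in\mathcal N}(\delta_{n,\mathcal N}-1)P_h^n$.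
   Formalization: The right side is multiplied by t^{c_a}; in Pol^{nn'} the supports of R_1, R_2 use real multiples R_{≤0} and allow a shift by a vector of [0,1)^N; half-open sums over an empty index set are read as empty. As printed the identity fails for c_a≠0 and Pol^{nn'} may not exist. *)

(* Defs.v *)
(* The real numbers are an arbitrary R : realType. *)
From mathcomp Require Import all_boot all_order all_algebra.
From mathcomp Require Import boolp classical_sets functions cardinality fsbigop.
From mathcomp Require Import reals.

Set Implicit Arguments.
Unset Strict Implicit.
Unset Printing Implicit Defensive.

Import Order.TTheory GRing.Theory Num.Theory.
Local Open Scope ring_scope.

(* A graph with integer vertex decorations; all genera are 0. *)
Record plumbing := Plumbing {
  vert :> finType;
  adj : rel vert;
  dec : vert -> int }.

Definition valency (G : plumbing) (v : G) : nat := #|[pred w : G | adj v w]|.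

Definition is_tree (G : plumbing) : Prop :=
  [/\ symmetric (@adj G), irreflexive (@adj G),
      forall v w : G, connect (@adj G) v w
    & forall s : seq G, ucycle (@adj G) s -> (size s <= 2)%N].

Definition inter (G : plumbing) (v w : G) : int :=
  if v == w then dec v else (adj v w : nat)%:Z.

Definition pairing (F : pzRingType) (G : plumbing) (x y : {ffun G -> F}) : F :=
  \sum_(v : G) \sum_(w : G) x v * y w * (inter v w)%:~R.

Definition negative_definite (G : plumbing) : Prop :=
  forall x : {ffun G -> int}, x != 0 -> pairing x x < 0.

(* A connected negative definite tree is always the dual graph of a good
   resolution of a normal surface singularity; this resolution is the minimal
   good one exactly when no vertex of valency at most 2 has decoration -1,
   i.e., given negative definiteness, when the last condition holds. *)
Definition minimal_good_graph (G : plumbing) : Prop :=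
  [/\ is_tree G, negative_definite G
    & forall v : G, (valency v <= 2)%N -> dec v <= - 2%:Z].

Section Lattice.
Variable G : plumbing.

Definition E_ (F : pzRingType) (v : G) : {ffun G -> F} := [ffun w => (w == v)%:R].

Definition inL (x : {ffun G -> rat}) : Prop := forall v, x v \is a Num.int.

Definition inL' (x : {ffun G -> rat}) : Prop :=
  forall y, inL y -> pairing x y \is a Num.int.

(* [x] = [y] in H = L'/L, for x and y in L'. *)
Definition same_class (x y : {ffun G -> rat}) : Prop := inL (x - y).

Definition Estar (v : G) : {ffun G -> rat} :=
  xget 0 [set x : {ffun G -> rat} |
          forall w, pairing x (E_ rat w) = - (v == w)%:R]%classic.

End Lattice.

Notation node G := {v : vert G | (2 < valency v)%N}.
Notation endv G := {v : vert G | valency v == 1}.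

Section Seifert.
Variable G : plumbing.
Implicit Types (v w : G) (n m : node G) (u : endv G).

(* The vertices of the path from v to w in the tree G, without v, listed from
   v to w. *)
Definition tpath v w : seq G :=
  xget [::] [set p : seq G |
    [/\ path (@adj G) v p, last v p = w & uniq (v :: p)]]%classic.

Definition chain v w : seq G := take (size (tpath v w)).-1 (tpath v w).

Definition toward v w : G := head w (tpath v w).

Definition detneg (s : seq G) : int :=
  \det (\matrix_(i < size s, j < size s)
          - inter (tnth (in_tuple s) i) (tnth (in_tuple s) j)).

Definition no_node (s : seq G) : bool := all (fun v => (valency v <= 2)%N) s.

Definition nbr n m : bool := (m != n) && no_node (chain (val n) (val m)).

Definition leg n u : bool := no_node (tpath (val n) (val u)).

Definition degN n : nat := #|[pred m | nbr n m]|.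

Definition hatN : {set node G} := [set n | (2 <= degN n)%N]%SET.

Definition alphaE n u : int := detneg (tpath (val n) (val u)).
Definition omegaE n u : int := detneg (behead (tpath (val n) (val u))).

Definition alpha n m : int := detneg (chain (val n) (val m)).
Definition omega n m : int :=
  if chain (val n) (val m) is _ :: s then detneg s else 0.

(* One of n < m, m < n is chosen for each pair of neighbouring nodes; no
   transitivity is required. *)
Definition orientation (ord : rel (node G)) : Prop :=
  forall n m, nbr n m -> ord n m (+) ord m n.

Definition below (ord : rel (node G)) n m : bool := nbr n m && ord n m.

(* The node set of the component containing n after removing the chain between
   n and m, or the edge n - m when this chain is empty. *)
Definition cut n m : rel G := fun v w =>
  [&& adj v w, v \notin chain (val n) (val m), w \notin chain (val n) (val m),
      (v, w) != (val n, val m) & (v, w) != (val m, val n)].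

Definition side n m : {set node G} :=
  [set n' | connect (cut n m) (val n) (val n')]%SET.

End Seifert.

(* The coefficients of a reduced lift; only the values cC a n m with n < m are
   used, and cC a n m is the coefficient of E^*_{n_m}. *)
Record redlift (G : plumbing) := RedLift {
  cN : {ffun node G -> int};
  cE : {ffun endv G -> int};
  cC : node G -> node G -> int }.

Section Lifts.
Variables (G : plumbing) (ord : rel (node G)).
Implicit Types (n m : node G) (u : endv G) (a : redlift G).
Implicit Types (l : {ffun node G -> int}) (k : {ffun node G -> nat}).

Definition lift_elt a : {ffun G -> rat} :=
  \sum_n Estar (val n) *~ cN a n + \sum_u Estar (val u) *~ cE a u
  + \sum_n \sum_(m | below ord n m) Estar (toward (val n) (val m)) *~ cC a n m.

Definition lift_sub a k : redlift G :=
  RedLift [ffun n => cN a n - (k n)%:Z] (cE a) (cC a).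

Definition redlift0 : redlift G := RedLift 0 0 (fun _ _ => 0).

Definition cvec a : {ffun node G -> rat} := [ffun n => lift_elt a (val n)].

Definition ZN a l : Prop :=
  forall n m, below ord n m ->
    (l n + omega m n * l m = cC a n m %[mod alpha n m])%Z.

Definition legquot a l n u : rat :=
  (cE a u - omegaE n u * l n)%:Q / (alphaE n u)%:Q.

Definition Nval a l n : rat :=
  (cN a n)%:Q
  + \sum_(m | below ord n m) (omega n m)%:Q / (alpha n m)%:Q * (cC a n m)%:Q
  + \sum_(m | below ord m n) 1 / (alpha n m)%:Q * (cC a m n)%:Q
  - ((dec (val n))%:Q + \sum_(m | nbr n m) (omega n m)%:Q / (alpha n m)%:Q)
    * (l n)%:Q
  - \sum_(m | nbr n m) (l m)%:Q / (alpha n m)%:Q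
  + \sum_(u | leg n u) (Num.floor (legquot a l n u))%:Q.

Definition Nbar a l n : rat :=
  Nval a l n
  + \sum_(u | leg n u) (legquot a l n u - (Num.floor (legquot a l n u))%:Q).

Definition inM a l : Prop := ZN a l /\ forall n, 0 <= Nval a l n.

Definition inMbar a l : Prop := ZN a l /\ forall n, 0 <= Nbar a l n.

End Lifts.

Section Vectors.
Variables (R : realType) (G : plumbing) (ord : rel (node G)).
Variable v : node G -> {ffun node G -> int}.
Implicit Types (n m : node G) (I J : {set node G}) (a : redlift G).
Implicit Types (l : {ffun node G -> int}) (k : {ffun node G -> nat}).

Definition Corb : set {ffun node G -> R} :=
  [set y | exists2 x : {ffun G -> R},
     (forall w, pairing x (E_ R w) <= 0) & y = [ffun n => x (val n)]]%classic.

Definition cone : set {ffun node G -> R} :=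
  [set y | exists2 c : {ffun node G -> R},
     (forall n, 0 <= c n)
     & forall m, y m = \sum_n c n * (v n m)%:~R]%classic.

Definition admissible a (kappa : rat) : Prop :=
  [/\ forall n, inM ord (redlift0 G) (v n),
      cone = Corb
    & forall l n, inMbar ord a l ->
        (forall m, m != n -> Nval ord a (l + v n) m = Nval ord a l m)
        /\ kappa <= Nval ord a (l + v n) n].

(* The coordinates in J of x are those of a point of sum_(n in I) [0,1) v_n.
   For I empty the sum is taken to be empty, not {0}: it stands for the
   exponents of remainders of a division by prod_(n in I) (1 - t^{v_n}), and the
   remainder of a division by 1 is 0. *)
Definition hbox I J (x : {ffun node G -> R}) : Prop :=
  (exists n, n \in I) /\
  exists2 c : {ffun node G -> R},
    (forall n, n \in I -> 0 <= c n < 1)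
    & forall m, m \in J -> x m = \sum_(n in I) c n * (v n m)%:~R.

(* (x_n, x_m) lies in RR_{<=0} E_n + sum_(n' in I) [0,1) pi_{n,m}(v_n'). *)
Definition hstrip I n m (x : {ffun node G -> R}) : Prop :=
  exists2 r : R, 0 <= r
    & hbox I [set n; m]%SET [ffun p => x p + r * (p == n)%:R].

Definition toR (e : {ffun node G -> rat}) : {ffun node G -> R} :=
  [ffun n => ratr (e n)].

Definition ofint l : {ffun node G -> rat} := [ffun n => (l n)%:Q].

Definition gr a k I : set {ffun node G -> int} :=
  [set l | [/\ hbox [set: node G]%SET [set: node G]%SET
                 (toR (ofint l + cvec ord (lift_sub a k))),
               ZN ord a l,
               forall n, n \in (I :\: hatN G)%SET -> Nval ord a l n < 0
             & forall n, n \in hatN G -> Nval ord a l n = (k n)%:R]]%classic.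

End Vectors.

(* Formal sums sum_e f(e) t^e with rational exponents in the variables t_n. *)
Notation series G := ({ffun node G -> rat} -> int).

Section Series.
Variable G : plumbing.
Implicit Types (f : series G) (e : {ffun node G -> rat}).

Definition laurent f : Prop := finite_set [set e | f e != 0]%classic.

Definition supp_in (S : {ffun node G -> rat} -> Prop) f : Prop :=
  forall e, f e != 0 -> S e.

Definition integral_exp e : Prop := forall n, e n \is a Num.int.

Definition mono (e0 : {ffun node G -> rat}) : series G := fun e => (e == e0)%:R.

(* t^{e0} * f *)
Definition tmul (e0 : {ffun node G -> rat}) f : series G := fun e => f (e - e0).

(* f * prod_(n in I) (1 - t^{v_n}) *)
Definition mulden (v : node G -> {ffun node G -> int}) (I : {set node G}) f :
    series G :=
  foldr (fun n g => g - tmul (ofint (v n)) g) f (enum I).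

(* The coefficient of z^j in the Taylor expansion of (1 - z)^d at 0. *)
Definition binser (d : int) (j : nat) : int :=
  match d with
  | Posz r => (-1) ^+ j * ('C(r, j))%:Z
  | Negz r => ('C(r + j, j))%:Z
  end.

(* The coefficient of [x] t^x in Z_H.  The index set has at most one element,
   as the E^*_w form a basis. *)
Definition pcoef (x : {ffun G -> rat}) : int :=
  \sum_(j \in [set j : {ffun G -> nat} | \sum_w Estar w *+ j w = x]%classic)
    \prod_w binser ((valency w)%:Z - 2) (j w).

(* Z_h(t_N), where h in L'/L is given by a representative.  Only finitely many
   summands are nonzero, as all the coordinates of the E^*_w are positive. *)
Definition Zh (h : {ffun G -> rat}) : series G := fun e =>
  \sum_(x \in [set x : {ffun G -> rat} |
                 same_class x h /\ [ffun n : node G => x (val n)] = e]%classic)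
    pcoef x.

End Series.

(* An identity between rational functions whose denominators are products of
   factors 1 - t^{v_n} is stated after multiplication by all of these factors;
   as the v_n have positive coordinates this multiplication is injective on
   expansions at the origin. *)
Section PolynomialParts.
Variables (R : realType) (G : plumbing) (ord : rel (node G)).
Variable v : node G -> {ffun node G -> int}.
Implicit Types (n m : node G) (I : {set node G}) (l : {ffun node G -> int}).
Implicit Types (f P : series G) (h : {ffun G -> rat}).

Definition is_Ph_node h n P : Prop :=
  exists Rn : series G,
    let I := (~: hatN G)%SET in
    [/\ laurent P /\ supp_in (fun e => 0 <= e n) P,
        laurent Rn /\ supp_in (fun e => hbox v I [set n]%SET (toR R e)) Rn
      & mulden v I (Zh h - P) = Rn].

Definition is_Ph_chain h n m P : Prop :=
  exists R1 R2 R0 : series G,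
    let I := (~: hatN G)%SET in
    let In := (I :&: side n m)%SET in
    let Im := (I :&: side m n)%SET in
    [/\ laurent P /\ supp_in (fun e => ~ (e n < 0 /\ e m < 0)) P,
        laurent R1 /\ supp_in (fun e => hstrip v In n m (toR R e)) R1,
        laurent R2 /\ supp_in (fun e => hstrip v Im m n (toR R e)) R2,
        laurent R0 /\ supp_in (fun e => hbox v I [set n; m]%SET (toR R e)) R0
      & mulden v I (Zh h - P) = mulden v Im R1 + mulden v In R2 + R0].

Definition Ph_node h n : series G := xget 0 [set P | is_Ph_node h n P]%classic.

Definition Ph_chain h n m : series G :=
  xget 0 [set P | is_Ph_chain h n m P]%classic.

Definition Ph h : series G :=
  \sum_n \sum_(m | below ord n m) Ph_chain h n m
  - \sum_n Ph_node h n *~ ((degN n)%:Z - 1).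

Definition laurentZ f : Prop := laurent f /\ supp_in (@integral_exp G) f.

Definition is_Pol_node l I n P : Prop :=
  exists Rn : series G,
    [/\ laurentZ P,
        laurentZ Rn /\ supp_in (fun e => hbox v I [set n]%SET (toR R e)) Rn
      & mono (ofint l) = mulden v I P + Rn].

(* The supports of the remainders R1, R2 are the integral points of the strips
   of hstrip up to a shift by a vector of [0,1)^N.  The decomposition is applied
   to vectors l for which only l + c lies in Corb, for some c in [0,1)^N; without
   the shift it need not exist when l itself is slightly outside of this cone.
   P remains unique: if (x, y) is a (t_n, t_m)-exponent of R1 then the coordinates
   y, x are integers with 0 <= y < S and x < q (y + 1), where (S q, S) is the sum
   of the pi_{n,m}(v_n'), n' in In, which lie on one ray; hence all the exponents
   in the expansion at infinity of R1 / prod_(n' in In) (1 - t^{v_n'}) have both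
   coordinates negative, and the same holds for R2 and R0. *)
Definition hstripZ I n m (e : {ffun node G -> rat}) : Prop :=
  exists2 s : {ffun node G -> R},
    (forall p, 0 <= s p < 1) & hstrip v I n m (toR R e + s).

Definition is_Pol_chain l I n m P : Prop :=
  exists R1 R2 R0 : series G,
    let In := (I :&: side n m)%SET in
    let Im := (I :&: side m n)%SET in
    [/\ laurentZ P /\ supp_in (fun e => ~ (e n < 0 /\ e m < 0)) P,
        laurentZ R1 /\ supp_in (hstripZ In n m) R1,
        laurentZ R2 /\ supp_in (hstripZ Im m n) R2,
        laurentZ R0 /\ supp_in (fun e => hbox v I [set n; m]%SET (toR R e)) R0
      & mono (ofint l)
        = mulden v I P + mulden v Im R1 + mulden v In R2 + R0].

Definition Pol_node l I n : series G :=
  xget 0 [set P | is_Pol_node l I n P]%classic.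

Definition Pol_chain l I n m : series G :=
  xget 0 [set P | is_Pol_chain l I n m P]%classic.

(* The exponents of Pol l I are integral, while those of Zh h and Ph h lie in
   c + ZZ^N, where c is the vector of the coordinates at the nodes of any
   representative of h. *)
Definition Pol l I : series G :=
  \sum_n \sum_(m | below ord n m) Pol_chain l I n m
  - \sum_n Pol_node l I n *~ ((degN n)%:Z - 1).

End PolynomialParts.

(* 0 <= k <= delta - 2 *)
Definition krange (G : plumbing) : set {ffun node G -> nat} :=
  [set k : {ffun node G -> nat} | forall n : node G,
     (n \in hatN G -> (k n <= degN n - 2)%N)
     /\ (n \notin hatN G -> k n = 0%N)]%classic.

Arguments krange G : clear implicits.

Definition kcoef (G : plumbing) (k : {ffun node G -> nat}) : int :=
  \prod_(n in hatN G) ((-1) ^+ k n * ('C(degN n - 2, k n))%:Z).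

(* Main.v *)
Require Import Defs.
From mathcomp Require Import all_boot all_order all_algebra.
From mathcomp Require Import boolp classical_sets functions cardinality fsbigop.
From mathcomp Require Import reals.
From mathcomp Require Import ring lra zify.

(** The proof computes the reduced series explicitly, writes it as a finite signed
    sum of fractions [t^{l + c} / prod_(n in J) (1 - t^{v_n})], where [c] is the vector
    [cvec ord a], and shows that taking polynomial parts commutes with this sum.

    Eliminating the chains and the legs turns the intersection form into the matrix
    [orb] of the orbifold graph. It is inverse to the matrix of the coordinates of the
    [E_n^*] at the nodes ([orb_expansion]), and [Nbar_a(l)] is the image of [l + c]
    ([Nbar_orb]). The vectors of the class of [h] that occur in the full series are
    orthogonal to the vertices of valency 2; integrality along the chains and legs
    becomes the congruences of [ZN] ([lattice_necessary], [lattice_sufficient]), and the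
    vectors over [l + c] correspond to multiplicities at the ends. Summing over these
    multiplies the factor of a node by one geometric series for each of its legs.
    Hence the coefficient of the reduced series at [l + c] is the product over the nodes
    of the coefficients of [z^{N_a(l,n)}] in [(1 - z)^{degN n - 2}] ([Zh_on], [Zh_off]).

    For a node outside of [hatN] this factor is [1 - [N < 0]]. Expanding the product of
    these, the series becomes a signed sum of indicator functions of cells, given by
    [Nbar_{a-k} >= 0], [N = k] on [hatN] and [N < 0] on [I] without [hatN] ([Zh_cells]).
    Admissibility forces [v_n] to lie on the ray of [E_n^*] ([orb_v_off]) and lets the
    translations by [v_n], [n] outside of [I], act on the cell. So multiplication by
    [prod_(n notin I) (1 - t^{v_n})] leaves those points of the cell whose coordinates
    along the [v_n] are less than 1 ([md_indic]), and this is the finite set [gr]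
    ([cell_box_gr]).

    For the polynomial part along the chain between [n] and [m] only the coordinates
    at [n] and [m] matter. The projections of the [v_x] lie on two rays, according to
    the side of the chain that contains [x] ([Estar_ratio]), and [t^{l + c}], which is
    in the cone that the rays span, is decomposed by divisions with remainder along the
    rays ([chain_dec_cone]). The decomposition of [t^l] that defines [Pol_chain] differs
    from it, because [l] itself can be slightly outside of the cone; it is obtained by
    [chain_dec_quadrant]. Both have the same polynomial part: comparing leading terms,
    bounds on the degrees of the remainders determine it ([chain_dec_unique]). Finally,
    multiplying the remainders by further factors keeps them in the required supports
    ([exact_mulden]), and remainders with given supports form a group. So the signed sum
    of the polynomial parts has the properties that characterize the polynomial part of
    the series ([Ph_chainE]). The polynomial part at a single node is treated in the
    same way, with only one division ([Ph_nodeE]). *)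

Set Implicit Arguments.
Unset Strict Implicit.
Unset Printing Implicit Defensive.

Import Order.TTheory GRing.Theory Num.Theory.
Local Open Scope ring_scope.

(** * Paths, chains and legs of a tree *)

Section Tree.
Variable G : plumbing.
Hypothesis treeG : is_tree G.
Implicit Types (v w x y z : G) (p q s : seq G).

Lemma adj_sym v w : adj v w = adj w v.
Proof. by case: treeG => sG _ _ _; rewrite sG. Qed.

Lemma adj_irr v : adj v v = false.
Proof. by case: treeG => _ iG _ _; rewrite iG. Qed.

Lemma adj_neq v w : adj v w -> v != w.
Proof. by apply: contraTneq => ->; rewrite adj_irr. Qed.

(** At the first step where two simple paths with the same ends differ they
    enclose a simple cycle, up to the first point where they meet again. *)
Lemma uniq_spath p q v :
  path (@adj G) v p -> path (@adj G) v q -> uniq (v :: p) -> uniq (v :: q) ->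
  last v p = last v q -> p = q.
Proof.
elim: p q v => [|x p IH] [|y q] v //=.
- by move=> _ _ _ /andP[vq _] ev; move: vq; rewrite ev mem_last.
- by move=> _ _ /andP[vp _] _ ev; move: vp; rewrite -ev mem_last.
move=> /andP[vx px] /andP[vy py] /andP[vxp up] /andP[vyq uq] elast.
have [exy|nxy] := eqVneq x y.
  by move: py uq elast; rewrite -exy => py uq elast; rewrite (IH q x).
exfalso.
have [tG iG cG cyc] := treeG.
have hasq : has (mem (y :: q)) (x :: p).
  by apply/hasP; exists (last x p); rewrite ?mem_last //= elast mem_last.
move: {1 3}(x :: p) (erefl (x :: p)) hasq => xp exp hasq; case/split_find: hasq exp => z p1 p2 zq Np1; rewrite cat_rcons => /esym ep.
move: zq => /= zq; case/splitPr eq1: {-}(y :: q) / (zq) => [q1 q2].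
have pz : path (@adj G) v (rcons p1 z).
  have : path (@adj G) v (x :: p) by rewrite /= vx px.
  by rewrite ep -cat_rcons cat_path => /andP[].
have qz : path (@adj G) v (rcons q1 z).
  have : path (@adj G) v (y :: q) by rewrite /= vy py.
  by rewrite eq1 -cat_rcons cat_path => /andP[].
have up1 : uniq (v :: rcons p1 z).
  have : uniq (v :: (x :: p)) by rewrite /= vxp up.
  by rewrite ep -cat_rcons -cat_cons cat_uniq => /andP[].
have uq1 : uniq (v :: rcons q1 z).
  have : uniq (v :: (y :: q)) by rewrite /= vyq uq.
  by rewrite eq1 -cat_rcons -cat_cons cat_uniq => /andP[].
have disj : ~~ has (mem q1) p1.
  apply/hasPn => t tp1; apply/negP => tq1; case/negP: Np1.
  by apply/hasP; exists t => //=; rewrite eq1 mem_cat; apply/orP; left.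
(* Both paths, up to their first common vertex, together form a cycle. *)
have ucy : ucycle (@adj G) (v :: rcons p1 z ++ rev q1).
  apply/andP; split.
    rewrite /= rcons_cat cat_path pz last_rcons /= -rev_cons.
    have := rev_path (@adj G) v (rcons q1 z); rewrite last_rcons belast_rcons => ->.
    by rewrite (eq_path (e' := @adj G)) // => s t; rewrite sG.
  rewrite -cat_cons cat_uniq up1 rev_uniq /=.
  move: uq1; rewrite /= rcons_uniq mem_rcons inE => /andP[/norP[_ vq1] /andP[zq1 ->]].
  rewrite andbT has_rev; apply/hasPn => t tq1; rewrite inE mem_rcons inE !negb_or.
  apply/and3P; split; [by apply: contraNneq vq1 => <-|by apply: contraNneq zq1 => <-|].
  by apply/negP => tp1; case/hasP: disj; exists t.
have := cyc _ ucy; rewrite /= size_cat size_rcons size_rev.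
case: p1 q1 {pz qz up1 uq1 disj Np1 ucy} ep eq1 => [|? ?] [|? ?] //=.
by move=> [<- _] [/esym]; move/eqP: nxy.
Qed.

Lemma spath_exists v w :
  exists p, [/\ path (@adj G) v p, last v p = w & uniq (v :: p)].
Proof.
have [_ _ cG _] := treeG; have /connectP[p pp ->] := cG v w.
by case/shortenP: pp => p' pp' up' _; exists p'.
Qed.

Lemma tpathP v w :
  [/\ path (@adj G) v (tpath v w), last v (tpath v w) = w & uniq (v :: tpath v w)].
Proof.
rewrite /tpath; have := @xgetPex _ [::] [set p : seq G |
    [/\ path (@adj G) v p, last v p = w & uniq (v :: p)]]%classic.
by apply; have [p] := spath_exists v w; exists p.
Qed.

Lemma tpath_eq v w p :
  path (@adj G) v p -> last v p = w -> uniq (v :: p) -> tpath v w = p.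
Proof.
move=> pp lp up; have [tp lt ut] := tpathP v w.
by apply: (uniq_spath tp pp ut up); rewrite lp.
Qed.

Lemma tpath_rcons v w : v != w -> tpath v w = rcons (chain v w) w.
Proof.
have [_ + _] := tpathP v w; rewrite /chain.
case/lastP: (tpath v w) => [/= -> /eqP//|s x]; rewrite last_rcons => -> _.
by rewrite size_rcons /= -[X in take _ X]cats1 take_size_cat.
Qed.

Lemma tpath_chain v w c :
  path (@adj G) v (rcons c w) -> uniq (v :: rcons c w) ->
  (tpath v w = rcons c w) * (chain v w = c).
Proof.
move=> pc uc; have et := tpath_eq pc (last_rcons _ _ _) uc.
by rewrite /chain et size_rcons /= -cats1 take_size_cat.
Qed.

Lemma chainP v w : v != w ->
  path (@adj G) v (rcons (chain v w) w) /\ uniq (v :: rcons (chain v w) w).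
Proof. by move=> vw; rewrite -tpath_rcons //; have [] := tpathP v w. Qed.

Lemma rev_spath v c w : path (@adj G) v (rcons c w) -> uniq (v :: rcons c w) ->
  path (@adj G) w (rcons (rev c) v) /\ uniq (w :: rcons (rev c) v).
Proof.
move=> pc uc; split.
  rewrite -rev_cons.
  have := rev_path (@adj G) v (rcons c w); rewrite last_rcons belast_rcons => ->.
  by rewrite (eq_path (e' := @adj G)) // => s t; rewrite adj_sym.
have -> : w :: rcons (rev c) v = rev (v :: rcons c w) by rewrite rev_cons rev_rcons.
by rewrite rev_uniq.
Qed.

Lemma chain_rev v w : chain w v = rev (chain v w).
Proof.
have [->|vw] := eqVneq v w.
  by rewrite /chain (tpath_eq (p := [::])).
have [pc uc] := chainP vw; have [pr ur] := rev_spath pc uc.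
by rewrite (tpath_chain pr ur).
Qed.

Lemma toward_head v w : v != w -> toward v w = head w (chain v w).
Proof. by move=> vw; rewrite /toward tpath_rcons //; case: (chain v w). Qed.

Lemma adj_toward v w : v != w -> adj v (toward v w).
Proof.
move=> vw; rewrite toward_head //; have [+ _] := chainP vw.
by case: (chain v w) => [|x c] /= /andP[].
Qed.

Lemma valency_ge v s : uniq s -> {subset s <= adj v} -> (size s <= valency v)%N.
Proof.
move=> us sv; rewrite /valency cardE; apply: uniq_leq_size => // x /sv xv.
by rewrite mem_enum.
Qed.

Lemma nbr_valency2 x v y y' : valency x = 2%N -> adj x v -> adj x y -> adj x y' ->
  y != v -> y' != v -> y = y'.
Proof.
move=> vx xv xy xy' yv y'v; apply/eqP; apply: contraT => yy'.
have := @valency_ge x [:: v; y; y']; rewrite vx; apply.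
  by rewrite /= !inE !negb_or (eq_sym v) yv (eq_sym v) y'v yy'.
by move=> t; rewrite !inE => /or3P[] /eqP->.
Qed.

Lemma sum_valency2 (V : nmodType) x y z (F : G -> V) :
  valency x = 2%N -> adj x y -> adj x z -> y != z ->
  \sum_(w | adj x w) F w = F y + F z.
Proof.
move=> vx xy xz yz; rewrite (bigD1 y) //= (bigD1 z) /=; last by rewrite xz eq_sym.
rewrite big1 ?addr0 // => w /andP[/andP[xw wy]] /eqP[].
by apply: (nbr_valency2 vx xy) => //; rewrite eq_sym.
Qed.

Lemma sum_valency1 (V : nmodType) x y (F : G -> V) :
  valency x = 1%N -> adj x y -> \sum_(w | adj x w) F w = F y.
Proof.
move=> vx xy; rewrite (bigD1 y) //= big1 ?addr0 // => w /andP[xw wy].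
suff: (2 <= 1)%N by [].
rewrite -[X in (_ <= X)%N]vx; apply: (@valency_ge x [:: w; y]); first by rewrite /= inE wy.
by move=> t; rewrite !inE => /orP[] /eqP->.
Qed.

(** A maximal chain or leg at [v], without assuming that [v] is a node: [c]
    consists of vertices of valency 2 and stops before the first other vertex [z]. *)
Definition branch v c z :=
  [/\ path (@adj G) v (rcons c z), uniq (v :: rcons c z),
      all (fun w => valency w == 2) c & valency z != 2].

(** A vertex of valency 2 leaves no choice for the next vertex of a path. *)
Lemma branch_inj v c z c' z' : branch v c z -> branch v c' z' ->
  head z c = head z' c' -> c = c' /\ z = z'.
Proof.
elim: c c' v => [|x c IH] [|x' c'] v [pc uc ac vz] [pc' uc' ac' vz'] //= eh.
- by move: vz; rewrite eh; case/andP: ac' => ->.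
- by move: vz'; rewrite -eh; case/andP: ac => ->.
move: pc uc ac pc' uc' ac'; rewrite -{}eh /=.
move=> /andP[vx pc] /andP[vxc uc] /andP[/eqP x2 ac] /andP[_ pc'] /andP[vxc' uc'] /andP[_ ac'].
suff hh : head z c = head z' c'.
  by have [] := IH c' x (And4 pc uc ac vz) (And4 pc' uc' ac' vz') hh => -> ->.
apply: (@nbr_valency2 x v) => //; first by rewrite adj_sym.
- by case: (c) pc => [|? ?] /= /andP[].
- by case: (c') pc' => [|? ?] /= /andP[].
- by apply: contraNneq vxc => <-; case: (c) => [|? ?]; rewrite /= !inE eqxx ?orbT.
- by apply: contraNneq vxc' => <-; case: (c') => [|? ?]; rewrite /= !inE eqxx ?orbT.
Qed.

Lemma extend_uniq v c y y' : path (@adj G) v (rcons c y) -> uniq (v :: rcons c y) ->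
  adj y y' -> y' != last v c -> y' \notin v :: rcons c y.
Proof.
move=> pc uc yy' y'l; rewrite -rcons_cons mem_rcons inE eq_sym (negPf (adj_neq yy')) /=.
apply/negP => /splitPl ey; case: ey pc uc y'l => p1 p2 e1 pc uc y'l.
have: rcons p2 y = [:: y].
  apply: (@uniq_spath _ _ y').
  - by move: pc; rewrite rcons_cat cat_path e1 => /andP[].
  - by rewrite /= adj_sym yy'.
  - move: uc; rewrite rcons_cat -cat_cons lastI cat_rcons e1 cat_uniq => /and3P[_ _ //].
  - by rewrite /= inE eq_sym (adj_neq yy').
  - by rewrite last_rcons.
by case: p2 {pc uc} y'l => [|? [|]] //=; rewrite cats0 e1 eqxx.
Qed.

(** As the graph is finite and has no cycles, a path through vertices of
    valency 2 can be continued until it meets a vertex of another valency. *)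
Lemma branch_extend v c y : path (@adj G) v (rcons c y) -> uniq (v :: rcons c y) ->
  all (fun w => valency w == 2) c ->
  exists c' z t, branch v c' z /\ rcons c' z = rcons c y ++ t.
Proof.
have [k] := ubnP (#|G| - size c)%N; elim: k c y => // k IH c y lek pc uc ac.
have [y2|y2] := eqVneq (valency y) 2%N; last by exists c, y, [::]; rewrite cats0.
have: exists2 y', adj y y' & y' != last v c.
  apply/exists_inP; apply: contraT => /exists_inPn h.
  have : (valency y <= 1)%N.
    rewrite /valency -(card1 (last v c)); apply/subset_leq_card/fintype.subsetP => t.
    by rewrite inE => /h; rewrite negbK.
  by rewrite y2.
case=> y' yy' /(extend_uniq pc uc yy') ny'.
have us : uniq (v :: rcons (rcons c y) y').
  by rewrite -rcons_cons rcons_uniq ny'.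
have [||||c' [z [t [bz hz]]]] := IH (rcons c y) y'.
- have := max_card (mem (v :: rcons (rcons c y) y')); rewrite (card_uniqP us) /= !size_rcons => h.
  by rewrite subnS prednK // subn_gt0 ltnW // ltnW.
- by rewrite rcons_path pc last_rcons.
- by [].
- by rewrite all_rcons y2 eqxx.
by exists c', z, (y' :: t); rewrite hz cat_rcons.
Qed.

Lemma branch_exists v w : adj v w -> exists c z, branch v c z /\ head z c = w.
Proof.
move=> vw; have [|||c [z [t [bz e]]]] := @branch_extend v [::] w => //=.
- by rewrite vw.
- by rewrite inE (adj_neq vw).
by exists c, z; split=> //; case: (c) e => [|? ?] [].
Qed.

Lemma interior_adj v c1 x c2 z : path (@adj G) v (rcons (c1 ++ x :: c2) z) ->
  uniq (v :: rcons (c1 ++ x :: c2) z) ->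
  [/\ adj x (last v c1), adj x (head z c2) & last v c1 != head z c2].
Proof.
move=> + uc; have {}uc : uniq ((v :: c1) ++ x :: rcons c2 z) by move: uc; rewrite rcons_cat.
rewrite rcons_cat cat_path /= => /and3P[_ px pc]; split.
- by rewrite adj_sym.
- by case: (c2) pc => [|? ?] /= /andP[].
move: uc; rewrite lastI cat_rcons cat_uniq => /and3P[_ _].
by case: (c2) => [|? ?] /=; rewrite !inE !negb_or => /andP[/andP[_]]; do ?[case/andP]; move=> //.
Qed.

Lemma interior_valency2 v c z : path (@adj G) v (rcons c z) ->
  uniq (v :: rcons c z) -> no_node c -> all (fun w => valency w == 2) c.
Proof.
move=> pc uc nc; apply/allP => x xc.
case/splitPr: xc pc uc nc => c1 c2 pc uc; rewrite /no_node all_cat /= => /and3P[_ x2 _].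
have [xl xh lh] := interior_adj pc uc.
rewrite eqn_leq x2; apply: (@valency_ge x [:: last v c1; head z c2]).
  by rewrite /= inE lh.
by move=> t; rewrite !inE => /orP[] /eqP->.
Qed.

Lemma interior_adj_eq v c1 x c2 z y : path (@adj G) v (rcons (c1 ++ x :: c2) z) ->
  uniq (v :: rcons (c1 ++ x :: c2) z) -> valency x = 2%N -> adj x y ->
  y = last v c1 \/ y = head z c2.
Proof.
move=> pc uc x2 xy; have [xl xh lh] := interior_adj pc uc.
have [->|yl] := eqVneq y (last v c1); first by left.
by right; apply: (nbr_valency2 x2 xl xy xh) => //; rewrite eq_sym.
Qed.

Implicit Types (n m : node G) (u : endv G).

Lemma node_val n : (2 < valency (val n))%N. Proof. exact: (valP n). Qed.
Lemma end_val u : valency (val u) = 1%N. Proof. exact: eqP (valP u). Qed.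

Lemma node_end n u : val n != val u.
Proof. by apply/eqP => e; have := node_val n; rewrite e end_val. Qed.

Lemma nbr_neq n m : nbr n m -> val n != val m.
Proof. by case/andP=> + _; rewrite eq_sym. Qed.

Lemma nbr_branch n m : nbr n m -> branch (val n) (chain (val n) (val m)) (val m).
Proof.
move=> nm; have [pc uc] := chainP (nbr_neq nm); split=> //; last first.
  by rewrite neq_ltn node_val orbT.
by apply: (interior_valency2 pc uc); case/andP: nm.
Qed.

Lemma branch_nbr n c m : branch (val n) c (val m) ->
  nbr n m /\ chain (val n) (val m) = c.
Proof.
case=> pc uc ac _; have [_ ec] := tpath_chain pc uc; split=> //.
rewrite /nbr ec; apply/andP; split.
  by apply: contraTneq uc => -> /=; rewrite mem_rcons inE eqxx.
by apply: sub_all ac => w /eqP->.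
Qed.

Lemma leg_branch n u : leg n u -> branch (val n) (chain (val n) (val u)) (val u).
Proof.
move=> nu; have [pc uc] := chainP (node_end n u); split=> //; last by rewrite end_val.
apply: (interior_valency2 pc uc); move: nu; rewrite /leg tpath_rcons ?node_end //.
by rewrite /no_node all_rcons => /andP[].
Qed.

Lemma branch_leg n c u : branch (val n) c (val u) ->
  leg n u /\ chain (val n) (val u) = c.
Proof.
case=> pc uc ac _; have [et ec] := tpath_chain pc uc; split=> //.
rewrite /leg et /no_node all_rcons end_val /=.
by apply: sub_all ac => w /eqP->.
Qed.

Lemma nbr_sym n m : nbr n m = nbr m n.
Proof. by rewrite /nbr eq_sym chain_rev /no_node all_rev. Qed.

Lemma branch_end v c z : branch v c z -> (0 < valency z)%N.
Proof.
case=> pc _ _ _; apply: (@valency_ge z [:: last v c]) => // t; rewrite inE => /eqP->.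
by move: pc; rewrite rcons_path adj_sym => /andP[].
Qed.

Lemma nbr_toward n m : nbr n m -> toward (val n) (val m) = head (val m) (chain (val n) (val m)).
Proof. by move=> nm; rewrite toward_head // nbr_neq. Qed.

Lemma leg_toward n u : toward (val n) (val u) = head (val u) (chain (val n) (val u)).
Proof. by rewrite toward_head // node_end. Qed.

(** The branch that begins with a given edge at a node ends in a node or in an
    end. *)
Lemma node_adj n w : adj (val n) w ->
  (exists2 m, nbr n m & toward (val n) (val m) = w) \/
  (exists2 u, leg n u & toward (val n) (val u) = w).
Proof.
move=> nw; have [c [z [bz hz]]] := branch_exists nw.
have := branch_end bz; have [z2|z2|] := ltngtP (valency z) 2.
- have z1 : valency z == 1%N by case: (valency z) z2 (branch_end bz) => [|[|]].
  move=> _; right; exists (exist _ z z1 : endv G).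
    by case: (@branch_leg n c (exist _ z z1 : endv G) bz).
  by rewrite leg_toward; case: (@branch_leg n c (exist _ z z1 : endv G) bz) => _ ->.
- move=> _; left; have [nm ec] := @branch_nbr n c (exist _ z z2 : node G) bz.
  by exists (exist _ z z2 : node G); rewrite // nbr_toward // ec.
by case: bz => _ _ _ /eqP.
Qed.

Lemma toward_nbr_inj n m m' : nbr n m -> nbr n m' ->
  toward (val n) (val m) = toward (val n) (val m') -> m = m'.
Proof.
move=> nm nm'; rewrite !nbr_toward // => e; apply: val_inj.
by case: (branch_inj (nbr_branch nm) (nbr_branch nm') e).
Qed.

Lemma toward_leg_inj n u u' : leg n u -> leg n u' ->
  toward (val n) (val u) = toward (val n) (val u') -> u = u'.
Proof.
move=> nu nu'; rewrite !leg_toward // => e; apply: val_inj.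
by case: (branch_inj (leg_branch nu) (leg_branch nu') e).
Qed.

Lemma toward_nbr_leg n m u : nbr n m -> leg n u ->
  toward (val n) (val m) <> toward (val n) (val u).
Proof.
move=> nm nu; rewrite nbr_toward // leg_toward => e.
case: (branch_inj (nbr_branch nm) (leg_branch nu) e) => _ emu.
by have := node_val m; rewrite emu end_val.
Qed.

(** The edges at a node are the first edges of its chains and of its legs. *)
Lemma sum_node (V : nmodType) n (F : G -> V) :
  \sum_(w | adj (val n) w) F w =
  \sum_(m | nbr n m) F (toward (val n) (val m)) +
  \sum_(u | leg n u) F (toward (val n) (val u)).
Proof.
pose A := [set w : G | [exists m, nbr n m && (toward (val n) (val m) == w)]]%SET.
rewrite (bigID (mem A)) /=; congr (_ + _).
- rewrite [RHS](partition_big (fun m => toward (val n) (val m)) (mem A)) /=; last first.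
    by move=> m nm; rewrite inE; apply/existsP; exists m; rewrite nm eqxx.
  apply: eq_big => [w|w /andP[_]].
    rewrite inE; apply: andb_idl => /existsP[m /andP[nm /eqP <-]].
    by rewrite adj_toward // nbr_neq.
  rewrite inE => /existsP[m /andP[nm /eqP e]].
  rewrite (big_pred1 m) ?e // => m'; apply/andP/eqP => [[nm' /eqP e']|->]; last by rewrite nm e.
  by apply: (toward_nbr_inj nm' nm); rewrite e e'.
rewrite [RHS](partition_big (fun u => toward (val n) (val u))
   (fun w => adj (val n) w && (w \notin A))) /=; last first.
  move=> u nu; rewrite adj_toward ?node_end //=; rewrite inE; apply/existsP => -[m /andP[nm /eqP]].
  exact: toward_nbr_leg.
apply: eq_bigr => w /andP[nw]; rewrite inE => wA.
case: (node_adj nw) => [[m nm e]|[u nu e]].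
  by case/existsP: wA; exists m; rewrite nm e eqxx.
rewrite (big_pred1 u) ?e // => u'; apply/andP/eqP => [[nu' /eqP e']|->]; last by rewrite nu e.
by apply: (toward_leg_inj nu' nu); rewrite e e'.
Qed.

Lemma valency_node n : valency (val n) = (degN n + #|[pred u | leg n u]|)%N.
Proof. by rewrite /valency /degN -!sum1_card; apply: (@sum_node nat n (fun _ => 1%N)). Qed.

Lemma nbr_valency1 x y z : valency x = 1%N -> adj x y -> adj x z -> y = z.
Proof.
move=> x1 xy xz; apply/eqP; apply: contraT => yz.
suff: (2 <= 1)%N by [].
rewrite -[X in (_ <= X)%N]x1; apply: (@valency_ge x [:: y; z]); first by rewrite /= inE yz.
by move=> t; rewrite !inE => /orP[] /eqP->.
Qed.

Lemma branch_rev v c z : branch v c z -> valency v != 2%N -> branch z (rev c) v.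
Proof.
case=> pc uc ac _ v2; have [pr ur] := rev_spath pc uc; split=> //.
by rewrite all_rev.
Qed.

(** Every vertex lies on a chain or on a leg, since the first node met on a path
    to a given node can be taken as the origin of a branch. *)
Lemma vertex_branch (n0 : node G) v : (exists n, v = val n) \/
  exists n c z, branch (val n) c z /\ v \in rcons c z.
Proof.
have [v3|v2] := ltnP 2 (valency v); first by left; exists (exist _ v v3 : node G).
right; have [pt lt ut] := tpathP v (val n0).
have ht : has (fun w => (2 < valency w)%N) (tpath v (val n0)).
  apply/hasP; exists (val n0); last exact: node_val.
  have := mem_last v (tpath v (val n0)); rewrite lt inE => /orP[/eqP e|//].
  by move: v2; rewrite -e leqNgt node_val.
case/split_find: ht pt ut {lt} => z c t z3 nc; rewrite cat_path -cat_cons cat_uniq.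
move=> /andP[pc _] /andP[uc _].
have [pr ur] := rev_spath pc uc.
have ac : all (fun w => valency w == 2) c.
  apply: interior_valency2 pc uc _; rewrite /no_node; apply/allP => w wc.
  by rewrite leqNgt; apply: contra nc => w3; apply/hasP; exists w.
have [|c' [z' [t' [b e]]]] := branch_extend pr ur; first by rewrite all_rev.
exists (exist _ z z3 : node G), c', z'; split=> //.
by rewrite e mem_cat mem_rcons inE eqxx.
Qed.

(** No vertex is isolated, the graph being connected and containing a node. *)
Lemma vertex_cases (n0 : node G) v :
  [\/ exists n, v = val n, valency v = 2%N | exists u, v = val u].
Proof.
have [[n ->]|[n [c [z [b]]]]] := vertex_branch n0 v; first by constructor 1; exists n.
rewrite mem_rcons inE => /orP[/eqP ->|vc]; last first.
  by constructor 2; case: b => _ _ /allP/(_ _ vc)/eqP.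
have [z2|z2|z2] := ltngtP (valency z) 2; last by constructor 2.
  have z1 : valency z == 1%N by case: (valency z) z2 (branch_end b) => [|[|]].
  by constructor 3; exists (exist _ z z1 : endv G).
by constructor 1; exists (exist _ z z2 : node G).
Qed.

Lemma end_leg (n0 : node G) u : exists n, leg n u.
Proof.
have [[n e]|[n [c [z [b]]]]] := vertex_branch n0 (val u).
  by have := node_end n u; rewrite e eqxx.
rewrite mem_rcons inE => /orP[/eqP e|uc].
  by exists n; rewrite -e in b; have [] := branch_leg b.
by case: b => _ _ /allP/(_ _ uc); rewrite end_val.
Qed.

(** The leg read from its end is a branch, and an end has only one edge. *)
Lemma leg_inj n n' u : leg n u -> leg n' u -> n = n'.
Proof.
move=> nu nu'; apply: val_inj.
have r k : leg k u -> branch (val u) (rev (chain (val k) (val u))) (val k).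
  move=> ku; apply: branch_rev; first exact: leg_branch.
  by rewrite neq_ltn node_val orbT.
have h k : leg k u -> adj (val u) (head (val k) (rev (chain (val k) (val u)))).
  by case/r; case: (rev _) => [|x c] /= /andP[].
by case: (branch_inj (r _ nu) (r _ nu') (nbr_valency1 (end_val u) (h _ nu) (h _ nu'))).
Qed.

Lemma cut_sym n m v w : cut n m v w = cut n m w v.
Proof.
rewrite /cut adj_sym !xpair_eqE; case: (adj w v) => //=.
case: (v \in _) => //=; rewrite ?andbF //; case: (w \in _) => //=.
by rewrite (andbC (w == sval n)) (andbC (w == sval m)) andbC.
Qed.

Lemma cut_swap n m : cut n m =2 cut m n.
Proof.
by move=> v w; rewrite /cut (chain_rev (val n)) !mem_rev; do 3 congr (_ && _); rewrite andbC.
Qed.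

Lemma side_swap n m (x : node G) : (x \in side m n) = connect (cut n m) (val m) (val x).
Proof. by rewrite inE; apply: eq_connect; apply: cut_swap. Qed.

Lemma cut_conn_sym n m : connect_sym (cut n m).
Proof. by apply: sym_connect_sym => v w; apply: cut_sym. Qed.

Lemma cut_chain n m v : nbr n m -> connect (cut n m) (val n) v ->
  v \notin chain (val n) (val m).
Proof.
move=> nm /connectP[p]; case/lastP: p => [_ ->|p x].
  have [_ + _ _] := nbr_branch nm; rewrite /= mem_rcons inE negb_or => /andP[/andP[]//].
by rewrite rcons_path last_rcons => /andP[_ /and4P[_ _ + _]] ->.
Qed.

(** A path from [n] to [m] in the cut graph would be the unique path of the
    tree, which uses the removed edges. *)
Lemma cut_disconnects n m : nbr n m -> ~~ connect (cut n m) (val n) (val m).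
Proof.
move=> nm; apply/negP => /connectP[p0 pp0]; case/shortenP: pp0 => p pp up _ lp.
have pa : path (@adj G) (val n) p by apply: sub_path pp => v w /and5P[].
have [pc uc _ _] := nbr_branch nm.
have ep : p = rcons (chain (val n) (val m)) (val m).
  by apply: (uniq_spath pa pc up uc); rewrite last_rcons.
move: pp; rewrite {}ep /cut; case: (chain _ _) => [|x c] /=.
  by rewrite eqxx andbF.
by rewrite mem_head /= !andbF.
Qed.

Lemma cut_adj n m v w : adj v w ->
  v \notin chain (val n) (val m) -> w \notin chain (val n) (val m) ->
  [\/ cut n m v w, v = val n /\ w = val m | v = val m /\ w = val n].
Proof.
move=> vw vc wc; rewrite /cut vw vc wc /=; case: eqP => [[-> ->]|_]; first by constructor 2.
by case: eqP => [[-> ->]|_]; [constructor 3|constructor 1].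
Qed.

(** The edge at [n] towards [m] is the only one that leaves the component of [n]
    in the cut graph. *)
Lemma cut_boundary n m v w : nbr n m -> adj v w ->
  connect (cut n m) (val n) v -> ~~ connect (cut n m) (val n) w -> v = val n.
Proof.
move=> nm vw nv nw; have vc := cut_chain nm nv.
have vm : v <> val m by move=> e; move: (cut_disconnects nm); rewrite -e nv.
have [wc|wc] := boolP (w \in chain (val n) (val m)); last first.
  have [cvw|[-> _]//|[]//] := cut_adj vw vc wc.
  by case/negP: nw; apply: connect_trans nv (connect1 cvw).
have [pc uc ac _] := nbr_branch nm; have /eqP w2 := allP ac _ wc.
case/splitPr: wc pc uc vc => c1 c2 pc uc; rewrite mem_cat inE !negb_or => /and3P[vc1 _ vc2].
rewrite adj_sym in vw.
case: (interior_adj_eq pc uc w2 vw) => e.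
  by case: (c1) vc1 e => [|x c] //= + e; rewrite e mem_last.
by case: (c2) vc2 e => [|x c] //= + e; rewrite e inE eqxx.
Qed.

(** The union of the two components with the chain is closed under adjacency,
    hence contains every vertex, and the chain contains no node. *)
Lemma side_cover n m (x : node G) : nbr n m -> (x \in side n m) || (x \in side m n).
Proof.
move=> nm; rewrite (side_swap n m) inE.
pose Q v := [|| connect (cut n m) (val n) v, connect (cut n m) (val m) v | v \in chain (val n) (val m)].
have [pc uc ac _] := nbr_branch nm.
have Qs v w : adj v w -> Q v -> Q w.
  move=> vw; have [vc|vc] := boolP (v \in chain (val n) (val m)).
    move=> _; have /eqP v2 := allP ac _ vc; have [c1 [c2 ec]] : exists c1 c2, chain (val n) (val m) = c1 ++ v :: c2.
      by case/splitPr: vc => c1 c2; exists c1, c2.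
    move: (pc) (uc); rewrite ec => pc' uc'.
    case: (interior_adj_eq pc' uc' v2 vw) => ->; rewrite /Q ec.
      by case: (c1) => [|x' c]; rewrite /= ?connect0 // -cat_cons mem_cat mem_last !orbT.
    by case: (c2) => [|x' c]; rewrite /= ?connect0 ?orbT // mem_cat !inE eqxx !orbT.
  have [wc|wc] := boolP (w \in chain (val n) (val m)); first by rewrite /Q wc !orbT.
  rewrite /Q (negPf vc) (negPf wc) !orbF.
  have [cvw|[_ ->]|[_ ->]] := cut_adj vw vc wc; rewrite ?connect0 ?orbT //.
  by case/orP=> h; rewrite (connect_trans h (connect1 cvw)) ?orbT.
have Qx : Q (val x).
  have [_ _ cG _] := treeG; have /connectP[p pp ->] := cG (val n) (val x).
  have : Q (val n) by rewrite /Q connect0.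
  by elim: p (val n) pp => //= w p IH v /andP[vw pp] Qv; apply: IH => //; apply: Qs Qv.
move: Qx; rewrite /Q; case/or3P => [->|->|xc]; rewrite ?orbT //.
by have := allP ac _ xc; have := node_val x; case: (valency _) => [|[|[]]].
Qed.

Lemma side_disjoint n m (x : node G) : nbr n m -> x \in side n m -> x \notin side m n.
Proof.
move=> nm; rewrite (side_swap n m) inE => nx; apply/negP; rewrite cut_conn_sym => xm.
by case/negP: (cut_disconnects nm); apply: connect_trans nx xm.
Qed.

Lemma side_refl n m : n \in side n m.
Proof. by rewrite inE connect0. Qed.

(** In the tree rooted at [r], the parent of [v] is [toward v r]. *)
Lemma adj_parent r v w : adj v w ->
  (v != r /\ w = toward v r) \/ (w != r /\ v = toward w r).
Proof.
move=> vw; have [pt lt ut] := tpathP v r.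
have [wt|wt] := boolP (w \in tpath v r).
  left; split; first by apply: contraTneq wt => ->; rewrite (tpath_eq (p := [::])).
  rewrite /toward; case/splitPr: wt pt ut {lt} => s1 s2; rewrite -cat_rcons.
  rewrite cat_path -cat_cons cat_uniq => /andP[p1 _] /andP[u1 _].
  have : rcons s1 w = [:: w].
    by apply: (uniq_spath p1 _ u1); rewrite /= ?vw ?inE ?(adj_neq vw) ?last_rcons.
  by case: s1 {p1 u1} => [|? []].
have pw : path (@adj G) w (v :: tpath v r) by rewrite /= adj_sym vw.
have uw : uniq (w :: v :: tpath v r).
  by rewrite cons_uniq ut andbT inE negb_or wt eq_sym (adj_neq vw).
right; split; last by rewrite /toward (tpath_eq pw).
apply: contraTneq uw => e; have := mem_last v (tpath v r); rewrite lt -e => h.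
by rewrite cons_uniq h.
Qed.

Lemma size_tpath_parent r v : v != r ->
  size (tpath v r) = (size (tpath (toward v r) r)).+1.
Proof.
move=> vr; have [+ + +] := tpathP v r; rewrite /toward.
case e: (tpath v r) => [|x s] /=; first by move=> _ e'; rewrite e' eqxx in vr.
by move=> /andP[_ px] lx /andP[_ ux]; rewrite (tpath_eq px).
Qed.

(** A vertex of valency 2 has a neighbour besides its parent. *)
Lemma child_exists r v : v != r -> valency v = 2%N ->
  exists2 c, c != r & adj v c /\ v = toward c r.
Proof.
move=> vr v2; have vp := adj_toward vr.
have: exists2 c, adj v c & c != toward v r.
  apply/exists_inP; apply: contraT => /exists_inPn h.
  have : (valency v <= 1)%N.
    rewrite /valency -(card1 (toward v r)); apply/subset_leq_card/fintype.subsetP => t.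
    by rewrite inE => /h; rewrite negbK.
  by rewrite v2.
case=> c vc cp; exists c; case: (adj_parent r vc) => [[_ e]|[cr e]] //.
  by rewrite e eqxx in cp.
by rewrite e eqxx in cp.
Qed.

End Tree.

(** * The dual basis *)

Section Pairing.
Variable G : plumbing.
Hypothesis treeG : is_tree G.
Hypothesis negG : negative_definite G.
Implicit Types (v w : G) (x y z : {ffun G -> rat}).

Lemma inter_sym v w : inter v w = inter w v.
Proof. by rewrite /inter eq_sym adj_sym //; case: eqP => // ->. Qed.

(** Only the vertex itself and its neighbours contribute. *)
Lemma pairingE (F : comPzRingType) (x : {ffun G -> F}) v :
  pairing x (E_ F v) = (dec v)%:~R * x v + \sum_(w | adj v w) x w.
Proof.
rewrite /pairing (eq_bigr (fun a => x a * (inter v a)%:~R)) => [|a _].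
  rewrite (bigD1 v) //= /inter eqxx mulrC; congr (_ + _).
  rewrite (bigID (adj v)) /= addrC big1 ?add0r => [|w /andP[wv vw]].
    apply: eq_big => [w|w /andP[wv]]; last by rewrite eq_sym (negPf wv) => ->; rewrite mulr1.
    by apply: andb_idl => vw; rewrite eq_sym adj_neq.
  by rewrite eq_sym (negPf wv) (negPf vw) mulr0.
rewrite (bigD1 v) //= big1 ?addr0 => [|b bv]; last first.
  by rewrite ffunE (negPf bv) mulr0 mul0r.
by rewrite ffunE eqxx mulr1 inter_sym.
Qed.

Lemma pairing_sum x y : pairing x y = \sum_w y w * pairing x (E_ rat w).
Proof.
rewrite /pairing exchange_big /=; apply: eq_bigr => w _.
rewrite mulr_sumr; apply: eq_bigr => a _.
rewrite (bigD1 w) //= big1 ?addr0 => [|b bw]; last by rewrite ffunE (negPf bw) mulr0 mul0r.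
by rewrite ffunE eqxx mulr1 mulrCA mulrA.
Qed.

Lemma pairing_sym x y : pairing x y = pairing y x.
Proof.
rewrite /pairing exchange_big; apply: eq_bigr => a _; apply: eq_bigr => b _.
by rewrite inter_sym [x b * _]mulrC.
Qed.

(** The coefficient of [x] at [E_w^*]. *)
Definition dcoef x w : rat := - pairing x (E_ rat w).

Lemma dcoefE x w : dcoef x w = - ((dec w)%:~R * x w + \sum_(t | adj w t) x t).
Proof. by rewrite /dcoef pairingE. Qed.

Lemma dcoef_is_additive w : additive (dcoef ^~ w).
Proof.
move=> x y; rewrite !dcoefE !ffunE (eq_bigr (fun t => x t - y t)) => [|t _]; last by rewrite !ffunE.
by rewrite sumrB; ring.
Qed.

Lemma dcoefB x y w : dcoef (x - y) w = dcoef x w - dcoef y w.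
Proof. exact: dcoef_is_additive. Qed.
Lemma dcoef0 w : dcoef 0 w = 0.
Proof. by rewrite -(subrr (0 : {ffun G -> rat})) dcoefB subrr. Qed.
Lemma dcoefN x w : dcoef (- x) w = - dcoef x w.
Proof. by rewrite -sub0r dcoefB dcoef0 sub0r. Qed.
Lemma dcoefD x y w : dcoef (x + y) w = dcoef x w + dcoef y w.
Proof. by rewrite -[in LHS](opprK y) dcoefB dcoefN opprK. Qed.
Lemma dcoef_sum I (r : seq I) (P : pred I) (F : I -> {ffun G -> rat}) w :
  dcoef (\sum_(i <- r | P i) F i) w = \sum_(i <- r | P i) dcoef (F i) w.
Proof. by elim/big_rec2: _ => [|i a b _ <-]; rewrite ?dcoef0 ?dcoefD. Qed.
Lemma dcoefMn x k w : dcoef (x *+ k) w = dcoef x w *+ k.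
Proof. by elim: k => [|k IH]; rewrite ?mulr0n ?dcoef0 // !mulrS dcoefD IH. Qed.
Lemma dcoefMz x (k : int) w : dcoef (x *~ k) w = dcoef x w *~ k.
Proof. by case: k => k; rewrite /intmul ?dcoefN dcoefMn. Qed.
Lemma dcoef_scale (c : rat) x w : dcoef [ffun t => c * x t] w = c * dcoef x w.
Proof.
rewrite !dcoefE ffunE mulrN mulrDr mulr_sumr; congr (- (_ + _)); first by ring.
by apply: eq_bigr => t _; rewrite ffunE.
Qed.

Lemma pairing_dcoef x y : pairing x y = - \sum_w y w * dcoef x w.
Proof.
by rewrite pairing_sum -sumrN; apply: eq_bigr => w _; rewrite /dcoef mulrN opprK.
Qed.

(** Clearing denominators reduces rational vectors to integral ones. *)
Lemma negdef_rat x : x != 0 -> pairing x x < 0.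
Proof.
move=> x0; pose d : int := \prod_v denq (x v).
have d0 : d != 0 by apply/prodf_neq0 => v _; rewrite denq_neq0.
have dx v : d%:~R * x v \is a Num.int.
  rewrite /d (bigD1 v) //= mulrC rmorphM /= mulrA.
  rewrite -{1}[x v]divq_num_den divfK ?intr_eq0 ?denq_neq0 //.
  by rewrite -rmorphM /= intr_int.
pose y : {ffun G -> int} := [ffun v => Num.floor (d%:~R * x v)].
have yE v : (y v)%:~R = d%:~R * x v.
  by rewrite ffunE; apply/eqP; rewrite -intrEfloor.
have : pairing y y < 0.
  apply: negG; apply: contraNneq x0 => y0; apply/eqP/ffunP => v.
  apply: (@mulfI _ d%:~R); first by rewrite intr_eq0.
  by rewrite -yE y0 !ffunE mulr0.
have : (pairing y y)%:~R = d%:~R ^+ 2 * pairing x x.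
  rewrite /pairing rmorph_sum mulr_sumr; apply: eq_bigr => a _.
  rewrite rmorph_sum mulr_sumr; apply: eq_bigr => b _.
  by rewrite !rmorphM /= !yE; ring.
rewrite -(ltrz0 rat) => ->.
by rewrite pmulr_rlt0 // exprn_even_gt0 //= intr_eq0.
Qed.

Lemma negdef_eq0 x : 0 <= pairing x x -> x = 0.
Proof. by move=> h; apply/eqP; apply: contraTT h => /negdef_rat; rewrite ltNge. Qed.

Lemma dcoef_inj x y : (forall w, dcoef x w = dcoef y w) -> x = y.
Proof.
move=> h; apply/eqP; rewrite -subr_eq0; apply/eqP; apply: negdef_eq0.
by rewrite pairing_dcoef big1 ?oppr0 // => w _; rewrite dcoefB h subrr mulr0.
Qed.

(** The matrix is nonsingular since the form is definite. *)
Lemma dcoef_surj (b : G -> rat) : exists x, forall w, dcoef x w = b w.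
Proof.
pose A : 'M[rat]_#|G| := \matrix_(i, j) - (inter (enum_val i) (enum_val j))%:~R.
pose X (u : 'rV[rat]_#|G|) : {ffun G -> rat} := [ffun v => u 0 (enum_rank v)].
have XE u w : dcoef (X u) w = (u *m A) 0 (enum_rank w).
  rewrite mxE /dcoef /pairing (reindex (@enum_val G predT)) /=; last first.
    by apply: onW_bij; apply: enum_val_bij.
  rewrite -sumrN; apply: eq_bigr => i _; rewrite mxE enum_rankK.
  rewrite (bigD1 w) //= big1 ?addr0 => [|c cw]; last by rewrite !ffunE (negPf cw) mulr0 mul0r.
  by rewrite !ffunE eqxx mulr1 enum_valK mulrN.
have fA : row_free A.
  apply: inj_row_free => u u0; apply/rowP => i.
  have /ffunP/(_ (enum_val i)) : X u = 0.
    by apply: dcoef_inj => w; rewrite XE u0 mxE dcoef0.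
  by rewrite !ffunE enum_valK mxE.
exists (X ((\row_i b (enum_val i)) *m invmx A)) => w.
by rewrite XE mulmxKV -?row_free_unit // mxE enum_rankK.
Qed.

Lemma dcoef_Estar v w : dcoef (Estar v) w = (v == w)%:R.
Proof.
rewrite /dcoef /Estar; set A := [set x | _]%classic.
have /xgetPex -> : exists x, A x; last by rewrite opprK.
by have [x xE] := dcoef_surj (fun w => (v == w)%:R); exists x => t; rewrite -xE opprK.
Qed.

Lemma pairing_Estar v y : pairing (Estar v) y = - y v.
Proof.
rewrite pairing_dcoef (bigD1 v) //= big1 ?addr0 => [|w wv]; rewrite dcoef_Estar.
  by rewrite eqxx mulr1.
by rewrite eq_sym (negPf wv) mulr0.
Qed.

Lemma Estar_sym v w : Estar v w = Estar w v.
Proof. by apply: oppr_inj; rewrite -!pairing_Estar pairing_sym. Qed.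

(** Let [y] be the negative part of [x]. Then [(x, y) <= 0] by assumption,
    while [(x + y, y) >= 0] as the supports of [x + y] and [y] are disjoint and the
    form is nonnegative off the diagonal. So [(y, y) >= 0] and [y = 0]. *)
Lemma dual_nonneg x : (forall w, 0 <= dcoef x w) -> forall v, 0 <= x v.
Proof.
move=> xw; pose y : {ffun G -> rat} := [ffun v => Num.max 0 (- x v)].
have y0 v : 0 <= y v by rewrite ffunE le_max lexx.
have xy0 v : 0 <= x v + y v by rewrite ffunE -lerBlDl sub0r le_max lexx orbT.
have xy v : (x v + y v) * y v = 0 by rewrite ffunE; case: lerP => _; ring.
have : y = 0.
  apply: negdef_eq0.
  have -> : pairing y y = pairing (x + y) y - pairing x y.
    rewrite !pairing_dcoef -opprD addrC; congr (- _); apply/eqP; rewrite -subr_eq0; apply/eqP.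
    rewrite [X in _ - (_ + X)](eq_bigr (fun w => y w * dcoef x w + y w * dcoef y w)); last first.
      by move=> w _; rewrite dcoefD mulrDr.
    by rewrite big_split /=; ring.
  rewrite subr_ge0; apply: (@le_trans _ _ 0).
    by rewrite pairing_dcoef oppr_le0 sumr_ge0 // => w _; rewrite mulr_ge0.
  apply: sumr_ge0 => a _; apply: sumr_ge0 => b _; rewrite /inter ffunE.
  have [<-|ab] := eqVneq a b; first by rewrite xy mul0r.
  by rewrite !mulr_ge0 // ler0z.
by move=> e v; have := xy0 v; rewrite e ffunE addr0.
Qed.

(** Such a vector is nonnegative, and where it vanishes it also vanishes at the
    neighbours. *)
Lemma dual_pos x : (forall w, 0 <= dcoef x w) -> x != 0 -> forall v, 0 < x v.
Proof.
move=> xw x0 v; have x_ge0 := dual_nonneg xw; rewrite lt0r x_ge0 andbT.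
apply: contraNneq x0 => xv; apply/eqP/ffunP => w; rewrite ffunE.
have [_ _ cG _] := treeG; have /connectP[p pp ->] := cG v w.
elim: p v pp xv => //= t p IH v /andP[vt pp] xv; apply: IH => //.
have := xw v; rewrite dcoefE xv mulr0 add0r oppr_ge0 => le0.
have /eqP : \sum_(t | adj v t) x t = 0 by apply: le_anti; rewrite le0 sumr_ge0.
by rewrite psumr_eq0 // => /allP/(_ t (mem_index_enum _)); rewrite vt => /eqP.
Qed.

Lemma Estar_gt0 v w : 0 < Estar v w.
Proof.
apply: dual_pos => [t|]; first by rewrite dcoef_Estar ler0n.
apply/eqP => e; have := dcoef_Estar v v; rewrite e dcoef0 eqxx => /eqP.
by rewrite eq_sym oner_eq0.
Qed.

(** Strict Cauchy-Schwarz inequality for two independent vectors. *)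
Lemma Estar_minor v w : v != w -> Estar v w * Estar w v < Estar v v * Estar w w.
Proof.
move=> vw; pose z : {ffun G -> rat} :=
  [ffun t => Estar w w * Estar v t] - [ffun t => Estar v w * Estar w t].
have zE t : z t = Estar w w * Estar v t - Estar v w * Estar w t by rewrite !ffunE.
have dz t : dcoef z t = Estar w w * (v == t)%:R - Estar v w * (w == t)%:R.
  by rewrite dcoefB !dcoef_scale !dcoef_Estar.
have z0 : z != 0.
  apply/eqP => e; have := dz v; rewrite e dcoef0 eqxx eq_sym (negPf vw) mulr1 mulr0 subr0.
  by move/eqP; rewrite lt_eqF ?Estar_gt0.
have := negdef_rat z0; rewrite pairing_dcoef oppr_lt0.
rewrite (bigD1 v) //= (bigD1 w) /=; last by rewrite eq_sym.
rewrite big1 => [|t /andP[tv tw]]; last first.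
  by rewrite dz !(eq_sym _ t) (negPf tv) (negPf tw) !mulr0 ?subr0 ?mulr0.
have -> : z w = 0 by rewrite zE; ring.
rewrite mul0r !addr0 dz eqxx (eq_sym w) (negPf vw) mulr0 subr0 mulr1.
by rewrite pmulr_lgt0 ?Estar_gt0 // zE subr_gt0 [X in _ < X -> _]mulrC.
Qed.

(** On the component of the cut graph that does not contain [n] the functions
    [E_x^*], [x] on the side of [n], solve the same homogeneous system, so that
    they are determined up to a factor by their value at [n]. *)
Lemma Estar_ratio (n m : node G) (x y : node G) : nbr n m ->
  x \in side n m -> y \in side n m ->
  Estar (val x) (val n) * Estar (val y) (val m) =
  Estar (val y) (val n) * Estar (val x) (val m).
Proof.
move=> nm; rewrite !inE; set Kn := connect _ _ => nx ny.
pose z : {ffun G -> rat} := [ffun t => Estar (val y) (val n) * Estar (val x) t]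
   - [ffun t => Estar (val x) (val n) * Estar (val y) t].
have zE t : z t = Estar (val y) (val n) * Estar (val x) t - Estar (val x) (val n) * Estar (val y) t.
  by rewrite !ffunE.
have dz t : ~~ Kn t -> dcoef z t = 0.
  move=> nt; rewrite dcoefB !dcoef_scale !dcoef_Estar.
  have [e|_] := eqVneq (val x) t; first by rewrite -e nx in nt.
  have [e|_] := eqVneq (val y) t; first by rewrite -e ny in nt.
  by rewrite !mulr0 subr0.
have zn : z (val n) = 0 by rewrite zE; ring.
pose zC : {ffun G -> rat} := [ffun t => if Kn t then 0 else z t].
have dzC t : ~~ Kn t -> dcoef zC t = dcoef z t.
  move=> nt; rewrite !dcoefE ffunE (negPf nt); congr (- (_ + _)).
  apply: eq_bigr => w tw; rewrite ffunE; case: ifP => // nw.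
  by rewrite (cut_boundary treeG nm _ nw nt) ?zn // adj_sym.
have /ffunP/(_ (val m)) : zC = 0.
  apply: negdef_eq0; rewrite pairing_dcoef big1 ?oppr0 // => t _.
  have [nt|nt] := boolP (Kn t); first by rewrite ffunE nt mul0r.
  by rewrite dzC // dz // mulr0.
rewrite [zC _]ffunE [X in _ = X]ffunE /Kn (negPf (cut_disconnects treeG nm)) => /eqP.
by rewrite zE subr_eq0 => /eqP ->.
Qed.

End Pairing.

(** * Determinants of chains *)

Section Continuant.
Variable G : plumbing.
Hypothesis treeG : is_tree G.
Implicit Types (v w : G) (s : seq G).

(** Expansion along the first row and the first column when these have only
    two nonzero entries, as for tridiagonal matrices. *)
Lemma det_corner (R : comPzRingType) p (M : 'M[R]_p.+2) :
  (forall j : 'I_p, M ord0 (lift ord0 (lift ord0 j)) = 0) ->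
  (forall i : 'I_p, M (lift ord0 (lift ord0 i)) ord0 = 0) ->
  \det M = M ord0 ord0 * \det (row' ord0 (col' ord0 M))
    - M ord0 (lift ord0 ord0) * M (lift ord0 ord0) ord0 *
      \det (row' ord0 (col' ord0 (row' ord0 (col' ord0 M)))).
Proof.
move=> Mr Mc; rewrite (expand_det_row _ ord0) !big_ord_recl /= big1 ?addr0 => [|j _]; last first.
  by rewrite Mr mul0r.
congr (_ + _); first by rewrite /cofactor /= expr0 mul1r.
rewrite -mulrA -mulrN; congr (_ * _); rewrite /cofactor /= expr1 mulN1r; congr (- _).
rewrite (expand_det_col _ ord0) big_ord_recl /= big1 ?addr0 => [|i _]; last first.
  rewrite !mxE (_ : lift (lift ord0 ord0) ord0 = ord0) ?Mc ?mul0r //.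
  exact: val_inj.
rewrite !mxE (_ : lift (lift ord0 ord0) ord0 = ord0); last exact: val_inj.
congr (_ * _); rewrite /cofactor /= expr0 mul1r; congr (\det _).
by apply/matrixP => i j; rewrite !mxE; congr (M _ _); apply: val_inj.
Qed.

(** The continuant, which is the determinant of a chain of a tree. *)
Fixpoint cont s : int :=
  match s with
  | [::] => 1
  | x :: s' => - dec x * cont s' - (if s' is _ :: s'' then cont s'' else 0)
  end.

Definition cont' s : int := if s is _ :: s' then cont s' else 0.

Lemma spath_nonadj x y t z : path (@adj G) x (y :: t) -> uniq (x :: y :: t) ->
  z \in t -> adj x z = false.
Proof.
move=> pt ut zt; apply/negP => xz.
case/splitPr: zt pt ut => t1 t2; rewrite -cat_rcons => pt ut.
have: y :: rcons t1 z = [:: z].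
  apply: (uniq_spath treeG (v := x)) => //=.
  - by move: pt; rewrite -cat_cons cat_path => /andP[].
  - by rewrite xz.
  - by move: ut; rewrite -!cat_cons cat_uniq => /andP[].
  - by rewrite inE (adj_neq treeG xz).
  - by rewrite last_rcons.
by case: t1 {pt ut}.
Qed.

(** In a tree the vertices of a path are adjacent only if they are consecutive,
    so that the matrix is tridiagonal. *)
Lemma detneg_cont s : sorted (@adj G) s -> uniq s -> detneg s = cont s.
Proof.
have [k] := ubnP (size s); elim: k s => // k IH [|x [|y t]] sk ps us.
- by rewrite /detneg det_mx00.
- rewrite /detneg /= [\det _]det_mx11 !mxE (tnth_nth x) /= /inter eqxx; ring.
rewrite /detneg det_corner.
- rewrite -[cont _]/(- dec x * cont (y :: t) - cont t).
  rewrite -(IH (y :: t)) //; last 2 first; [exact: path_sorted ps|by case/andP: us|].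
  rewrite -(IH t) //; last 3 first.
  + exact: ltnW.
  + by move: ps => /= /andP[_ /path_sorted].
  + by move: us => /= /and3P[].
  have adjxy : adj x y by move: ps => /= /andP[].
  rewrite !mxE !(tnth_nth x) /= /inter eqxx (negPf (adj_neq treeG adjxy)).
  rewrite eq_sym (negPf (adj_neq treeG adjxy)) (adj_sym treeG y) adjxy.
  rewrite mulN1r opprK mul1r /detneg; congr (_ * _ - _); congr (\det _).
    by apply/matrixP => i j; rewrite !mxE !(tnth_nth x).
  by apply/matrixP => i j; rewrite !mxE !(tnth_nth x).
- move=> j; rewrite !mxE !(tnth_nth x) /= /inter.
  have jt : nth x t j \in t by apply: mem_nth.
  rewrite (spath_nonadj ps us jt); case: eqP => [e|_]; last by rewrite oppr0.
  by move: us; rewrite /= {1}e inE jt orbT.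
move=> j; rewrite !mxE !(tnth_nth x) /= /inter (adj_sym treeG).
have jt : nth x t j \in t by apply: mem_nth.
rewrite (spath_nonadj ps us jt); case: eqP => [e|_]; last by rewrite oppr0.
by move: us; rewrite /= -{1}e inE jt orbT.
Qed.

Implicit Types (x : G -> rat) (yl ye : rat).

Definition hd x s ye : rat := if s is w :: _ then x w else ye.

(** [harm x yl s ye]: continued by [yl] before [s] and by [ye] after it, [x]
    solves the three-term recursion along [s]. *)
Fixpoint harm x yl s ye : Prop :=
  if s is w :: s' then
    yl + (dec w)%:~R * x w + hd x s' ye = 0 /\ harm x (x w) s' ye
  else True.

(** Solving a three-term recursion expresses its value next to one end by the
    boundary values; the coefficients are continuants. *)
Lemma transport x yl s ye : harm x yl s ye ->
  (cont s)%:~R * hd x s ye = (cont' s)%:~R * yl + ye.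
Proof.
elim: s yl => [|w s IH] yl; first by rewrite /= mul1r mul0r add0r.
case=> e /IH {IH}; move: e.
rewrite -[hd x (w :: s) ye]/(x w) -[cont' (w :: s)]/(cont s).
have -> : cont (w :: s) = - dec w * cont s - cont' s by [].
rewrite rmorphB rmorphM rmorphN /=.
move: (x w) (hd x s ye) ((cont s)%:~R : rat) ((cont' s)%:~R : rat) ((dec w)%:~R : rat) => a b A B d e h.
apply/eqP; rewrite -subr_eq0; apply/eqP.
have -> : (- d * A - B) * a - (A * yl + ye) = A * b - (B * a + ye) - A * (yl + d * a + b) by ring.
by rewrite h e; ring.
Qed.

Lemma harm_rcons x yl s w ye : harm x yl (rcons s w) ye <->
  harm x yl s (x w) /\ last yl (map x s) + (dec w)%:~R * x w + ye = 0.
Proof.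
elim: s yl => [|t s IH] yl /=; first by split=> [[]|[]].
rewrite IH /=; case: s {IH} => [|t' s] /=; split; tauto.
Qed.

Lemma harm_rev x yl s ye : harm x yl s ye -> harm x ye (rev s) yl.
Proof.
elim: s yl => [|w s IH] yl //= [e h]; rewrite rev_cons harm_rcons; split; first exact: IH.
rewrite map_rev; move: e {h IH}; case: s => [|t s] /= e; first lra.
by rewrite rev_cons last_rcons; lra.
Qed.

(** By [transport], a positive solution makes every continuant positive. *)
Lemma harm_pos x yl s ye : harm x yl s ye -> 0 < yl -> 0 <= ye ->
  (forall w, w \in s -> 0 < x w) -> 0 < cont s.
Proof.
elim: s yl => [|w s IH] yl // h y0 e0 xs.
have xw : 0 < x w by apply: xs; rewrite mem_head.
have cs : 0 < cont s.
  by case: h => _ h; apply: (IH _ h) => // t ts; apply: xs; rewrite inE ts orbT.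
have := transport h; rewrite -[hd _ _ _]/(x w) -[cont' _]/(cont s) => e.
rewrite -(ltr0z rat) -(pmulr_lgt0 _ xw) e.
by rewrite ltr_pwDl // mulr_gt0 // ltr0z.
Qed.

(** The recursion has leading coefficient 1, so that integrality propagates. *)
Lemma harm_int x yl s ye : harm x yl s ye -> yl \is a Num.int ->
  hd x s ye \is a Num.int ->
  (forall w, w \in s -> x w \is a Num.int) /\ ye \is a Num.int.
Proof.
elim: s yl => [|w s IH] yl //= [e h] yi xi.
have [||xs ys] := IH (x w) h; rewrite //; last first.
  by split=> // t; rewrite inE => /orP[/eqP ->|/xs].
have -> : hd x s ye = - (yl + (dec w)%:~R * x w) by lra.
by rewrite rpredN rpredD // rpredM // intr_int.
Qed.

Lemma harm_path (x : {ffun G -> rat}) v c z :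
  path (@adj G) v (rcons c z) -> uniq (v :: rcons c z) ->
  all (fun w => valency w == 2) c -> (forall w, w \in c -> dcoef x w = 0) ->
  harm x (x v) c (x z).
Proof.
elim: c v => [|w c IH] v //= pc uc /andP[/eqP w2 ac] xc; split; last first.
  apply: IH => //; [by case/andP: pc|by case/andP: uc|].
  by move=> t tc; apply: xc; rewrite inE tc orbT.
have [wv wh vh] := @interior_adj _ treeG v [::] w c z pc uc.
have := xc w (mem_head _ _); rewrite dcoefE // (sum_valency2 x w2 wv wh vh) /=.
by case: (c) => [|? ?] /=; lra.
Qed.

(** The same when the first vertex carries a source [g]. *)
Lemma harm_source (x : {ffun G -> rat}) g v c z :
  path (@adj G) v (rcons c z) -> uniq (v :: rcons c z) ->
  all (fun w => valency w == 2) c ->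
  (forall w, w \in c -> dcoef x w = if w == head z c then g else 0) ->
  harm x (x v + g) c (x z).
Proof.
case: c => [|w c] //= pc uc /andP[/eqP w2 ac] xc; split.
  have [wv wh vh] := @interior_adj _ treeG v [::] w c z pc uc.
  have := xc w (mem_head _ _); rewrite dcoefE // eqxx (sum_valency2 x w2 wv wh vh) /=.
  by case: (c) => [|? ?] /=; lra.
case/andP: pc => _ pc; case/andP: uc => _ uc; apply: harm_path => // t tc.
rewrite xc ?inE ?tc ?orbT //; case: eqP => // e.
by move: uc; rewrite /= -e mem_rcons inE tc orbT.
Qed.

(** A leg, continued by the coefficient at its end. *)
Lemma harm_leg (x : {ffun G -> rat}) v c z :
  path (@adj G) v (rcons c z) -> uniq (v :: rcons c z) ->
  all (fun w => valency w == 2) c -> valency z = 1%N ->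
  (forall w, w \in c -> dcoef x w = 0) ->
  harm x (x v) (rcons c z) (dcoef x z).
Proof.
move=> pc uc ac z1 xc; rewrite harm_rcons; split; first exact: harm_path.
have zl : adj z (last v c) by move: pc; rewrite rcons_path adj_sym // => /andP[].
rewrite dcoefE // (sum_valency1 x z1 zl) last_map; lra.
Qed.

End Continuant.

(** * The orbifold matrix *)

Section Orbifold.
Variables (G : plumbing) (ord : rel (node G)).
Hypothesis treeG : is_tree G.
Hypothesis negG : negative_definite G.
Hypothesis ordG : orientation ord.
Implicit Types (v w : G) (x y z : {ffun G -> rat}) (n m : node G) (u : endv G).
Implicit Types (s : seq G) (a : redlift G) (l : {ffun node G -> int}).

(** The continuants of the tails of [s] solve the recursion along [s], and
    [transport] along the reversed list relates the first of them to the last. *)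
Lemma cont_rev s : uniq s -> cont (rev s) = cont s.
Proof.
(* A solution that vanishes after the end of [s] and is 1 at its last vertex. *)
move=> us; pose x v : rat := (cont (drop (index v s).+1 s))%:~R.
have h t p : s = p ++ t -> harm x (cont t)%:~R t 0.
  elim: t p => [|w t IH] p //= e; have wp : w \notin p.
    by move: us; rewrite e cat_uniq => /and3P[_ + _]; apply: contra => wp; rewrite /= wp.
  have xw : x w = (cont t)%:~R.
    rewrite /x e index_cat (negPf wp) /= eqxx addn0.
    by rewrite -cat_rcons drop_size_cat // size_rcons.
  rewrite xw; split; last by apply: (IH (rcons p w)); rewrite cat_rcons.
  rewrite rmorphB rmorphM rmorphN /=.
  have -> : hd x t 0 = (if t is _ :: t' then cont t' else 0)%:~R; last by ring.
  case: t e {IH xw} => [|w' t] //= e; rewrite /x e.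
  have wp' : w' \notin rcons p w.
    by move: us; rewrite e -cat_rcons cat_uniq => /and3P[_ + _]; apply: contra => h; rewrite /= h.
  rewrite -cat_rcons index_cat (negPf wp') /= eqxx addn0.
  by rewrite -(cat_rcons w') drop_size_cat // size_rcons.
have := transport (harm_rev (h s [::] erefl)); rewrite mulr0 add0r.
case/lastP: s us {h} @x => [|s w] us x //; rewrite rev_rcons /= {1}/x.
have -> : index w (rcons s w) = size s.
  move: us; rewrite rcons_uniq => /andP[ws _].
  by rewrite -cats1 index_cat (negPf ws) /= eqxx addn0.
by rewrite drop_oversize ?size_rcons //= mulr1 => /intr_inj.
Qed.

Lemma chain_sorted v w : v != w ->
  sorted (@adj G) (rcons (chain v w) w) /\ uniq (rcons (chain v w) w).
Proof.
move=> vw; have [pc] := chainP treeG vw; rewrite /= => /andP[_ uc]; split=> //.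
exact: path_sorted pc.
Qed.

Lemma chain_sorted' v w : v != w -> sorted (@adj G) (chain v w) /\ uniq (chain v w).
Proof.
move=> /chain_sorted[sc uc]; move: uc; rewrite rcons_uniq => /andP[_ uc]; split=> //.
by move: sc; case: (chain v w) => //= x s; rewrite rcons_path => /andP[].
Qed.

Lemma alpha_cont n m : nbr n m -> alpha n m = cont (chain (val n) (val m)).
Proof. by move=> /nbr_neq /chain_sorted'[sc uc]; apply: detneg_cont. Qed.

Lemma omega_cont n m : nbr n m -> omega n m = cont' (chain (val n) (val m)).
Proof.
move=> /nbr_neq /chain_sorted'[]; rewrite /omega; case: (chain _ _) => //= w s sc /andP[_ us].
by apply: detneg_cont => //; apply: path_sorted sc.
Qed.

Lemma alphaE_cont n u : alphaE n u = cont (rcons (chain (val n) (val u)) (val u)).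
Proof.
rewrite /alphaE tpath_rcons ?node_end //.
by have [sc uc] := chain_sorted (node_end n u); apply: detneg_cont.
Qed.

Lemma omegaE_cont n u : omegaE n u = cont' (rcons (chain (val n) (val u)) (val u)).
Proof.
rewrite /omegaE tpath_rcons ?node_end //; have [] := chain_sorted (node_end n u).
case: (chain _ _) => [|w s] /= sc; first by rewrite (detneg_cont treeG).
by move=> /andP[_ us]; apply: detneg_cont => //; apply: path_sorted sc.
Qed.

Lemma alpha_sym n m : nbr n m -> alpha n m = alpha m n.
Proof.
move=> nm; rewrite !alpha_cont // 1?nbr_sym // (chain_rev treeG (val n)) cont_rev //.
by case: (chain_sorted' (nbr_neq nm)).
Qed.

Lemma dcoef_Estar_valency2 v w : (2 < valency v)%N -> valency w = 2 -> dcoef (Estar v) w = 0.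
Proof. by move=> v3 w2; rewrite dcoef_Estar //; case: eqP v3 => // ->; rewrite w2. Qed.

(** Positivity of the entries of [E_n^*], which is harmonic along the chain. *)
Lemma alpha_gt0 n m : nbr n m -> 0 < alpha n m.
Proof.
move=> nm; rewrite alpha_cont //; have [pc uc ac _] := nbr_branch treeG nm.
apply: (@harm_pos _ (Estar (val n)) (Estar (val n) (val n)) _ (Estar (val n) (val m))).
- apply: harm_path => // w wc; apply: dcoef_Estar_valency2 => //; first exact: node_val.
  exact/eqP/(allP ac).
- exact: Estar_gt0.
- exact/ltW/Estar_gt0.
by move=> w _; apply: Estar_gt0.
Qed.

Lemma alphaE_gt0 n u : leg n u -> 0 < alphaE n u.
Proof.
move=> nu; rewrite alphaE_cont //; have [pc uc ac _] := leg_branch treeG nu.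
have := @harm_leg _ treeG (Estar (val n)) _ _ _ pc uc ac (end_val u).
rewrite dcoef_Estar // (negPf (node_end n u)) => h.
apply: (harm_pos (h _)); rewrite ?Estar_gt0 //.
  by move=> w wc; apply: dcoef_Estar_valency2 => //; [exact: node_val|exact/eqP/(allP ac)].
by move=> w _; apply: Estar_gt0.
Qed.

Lemma alphaq_neq0 n m : nbr n m -> (alpha n m)%:Q != 0.
Proof. by move=> nm; rewrite intr_eq0 gt_eqF ?alpha_gt0. Qed.
Lemma alphaEq_neq0 n u : leg n u -> (alphaE n u)%:Q != 0.
Proof. by move=> nm; rewrite intr_eq0 gt_eqF ?alphaE_gt0. Qed.

Lemma below_nbr n m : below ord n m -> nbr n m. Proof. by case/andP. Qed.

Lemma below_total n m : nbr n m -> below ord n m (+) below ord m n.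
Proof. by move=> nm; rewrite /below (nbr_sym treeG m) nm; apply: ordG. Qed.

Implicit Type yy : {ffun node G -> rat}.

(** The matrix of the orbifold graph. *)
Definition orb yy n : rat :=
  - ((dec (val n))%:Q + \sum_(m | nbr n m) (omega n m)%:Q / (alpha n m)%:Q
     + \sum_(u | leg n u) (omegaE n u)%:Q / (alphaE n u)%:Q) * yy n
  - \sum_(m | nbr n m) yy m / (alpha n m)%:Q.

Definition resN x : {ffun node G -> rat} := [ffun n => x (val n)].

Lemma orbD (y1 y2 : {ffun node G -> rat}) n : orb (y1 + y2) n = orb y1 n + orb y2 n.
Proof.
rewrite /orb ffunE.
have -> : \sum_(m | nbr n m) (y1 + y2) m / (alpha n m)%:Q =
    \sum_(m | nbr n m) y1 m / (alpha n m)%:Q + \sum_(m | nbr n m) y2 m / (alpha n m)%:Q.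
  by rewrite -big_split; apply: eq_bigr => m _; rewrite ffunE mulrDl.
by ring.
Qed.

Lemma orb_scale c yy n : orb [ffun m => c * yy m] n = c * orb yy n.
Proof.
rewrite /orb ffunE mulrBr mulr_sumr; congr (_ - _); first by ring.
by apply: eq_bigr => m _; rewrite ffunE mulrA.
Qed.

(** The matrix is symmetric because [alpha] is. *)
Lemma orb_sym (y1 y2 : {ffun node G -> rat}) : \sum_n y1 n * orb y2 n = \sum_n y2 n * orb y1 n.
Proof.
rewrite /orb; under eq_bigr do rewrite mulrBr mulr_sumr.
under [RHS]eq_bigr do rewrite mulrBr mulr_sumr.
rewrite !sumrB; congr (_ - _); first by apply: eq_bigr => n _; ring.
rewrite (exchange_big_dep xpredT) //=; apply: eq_bigr => n _.
apply: eq_big => [m|m mn]; first by rewrite nbr_sym.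
by rewrite (alpha_sym mn); ring.
Qed.

(** Eliminating the vertices of the chains and of the legs: [e] collects the
    coefficients at the nodes, [c] those at the first vertices of the chains. *)
Lemma orb_resN (z : {ffun G -> rat}) (e : node G -> rat) (c : node G -> node G -> rat) n :
  (forall n m, below ord n m -> forall w, w \in chain (val n) (val m) ->
     dcoef z w = if w == head (val m) (chain (val n) (val m)) then c n m else 0) ->
  (forall n u, leg n u -> forall w, w \in chain (val n) (val u) -> dcoef z w = 0) ->
  dcoef z (val n) = e n + \sum_(m | below ord m n && (chain (val m) (val n) == [::])) c m n ->
  orb (resN z) n = e n
  + \sum_(m | below ord n m) (omega n m)%:Q / (alpha n m)%:Q * c n m
  + \sum_(m | below ord m n) 1 / (alpha n m)%:Q * c m n
  + \sum_(u | leg n u) dcoef z (val u) / (alphaE n u)%:Q.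
Proof.
move=> zc zl; rewrite dcoefE // (sum_node treeG) => ze.
have up m : below ord n m -> z (toward (val n) (val m)) =
    ((omega n m)%:Q * (z (val n) + c n m) + z (val m)) / (alpha n m)%:Q.
  move=> bnm; have nm := below_nbr bnm; have [pc uc ac _] := nbr_branch treeG nm.
  have := transport (harm_source treeG pc uc ac (zc _ _ bnm)).
  rewrite -alpha_cont // -omega_cont // nbr_toward // => <-.
  by rewrite [RHS]mulrC mulKf ?alphaq_neq0 //; case: (chain _ _).
(* For an empty chain the first vertex after [m] is [n], so that [c m n] is part of
   the coefficient at [n]. *)
have dn m : below ord m n -> z (toward (val n) (val m)) =
    ((omega n m)%:Q * z (val n) + z (val m) +
      (if chain (val m) (val n) == [::] then 0 else c m n)) / (alpha n m)%:Q.
  move=> bmn; have mn := below_nbr bmn; have [pc uc ac _] := nbr_branch treeG mn.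
  have nm : nbr n m by rewrite nbr_sym.
  have := transport (harm_rev (harm_source treeG pc uc ac (zc _ _ bmn))).
  rewrite -(chain_rev treeG) -alpha_cont // -omega_cont // nbr_toward //.
  case: eqP => [e0|]; rewrite (chain_rev treeG (val m)).
    by rewrite e0 /= => _; rewrite alpha_cont // omega_cont // (chain_rev treeG) e0 /= mul0r addr0 add0r divr1.
  rewrite -addrA => e0 <-; rewrite [RHS]mulrC mulKf ?alphaq_neq0 //.
  by case/lastP: (chain _ _) e0 => // s w _; rewrite rev_rcons.
have lg u : leg n u -> z (toward (val n) (val u)) =
    ((omegaE n u)%:Q * z (val n) + dcoef z (val u)) / (alphaE n u)%:Q.
  move=> nu; have [pc uc ac _] := leg_branch treeG nu.
  have := transport (harm_leg treeG pc uc ac (end_val u) (zl _ _ nu)).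
  rewrite -alphaE_cont // -omegaE_cont // leg_toward // => <-.
  by rewrite [RHS]mulrC mulKf ?alphaEq_neq0 //; case: (chain _ _).
pose h m := ((omega n m)%:Q * z (val n) + z (val m)) / (alpha n m)%:Q.
have split_nbr F : \sum_(m | nbr n m) F m =
    \sum_(m | below ord n m) F m + \sum_(m | below ord m n) F m :> rat.
  rewrite (bigID (below ord n)) /=; congr (_ + _); apply: eq_bigl => m.
    by rewrite andb_idl // => /below_nbr.
  apply/andP/idP => [[nm]|bmn].
    by have := below_total nm; case: (below ord n m).
  have nm : nbr n m by rewrite nbr_sym // below_nbr.
  by have := below_total nm; rewrite nm bmn; case: (below ord n m).
have eS : \sum_(m | nbr n m) z (toward (val n) (val m)) =
    \sum_(m | nbr n m) h m
    + \sum_(m | below ord n m) (omega n m)%:Q / (alpha n m)%:Q * c n m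
    + \sum_(m | below ord m n) 1 / (alpha n m)%:Q * c m n
    - \sum_(m | below ord m n && (chain (val m) (val n) == [::])) c m n.
  have e1 : \sum_(m | below ord n m) z (toward (val n) (val m)) =
      \sum_(m | below ord n m) h m
      + \sum_(m | below ord n m) (omega n m)%:Q / (alpha n m)%:Q * c n m.
    by rewrite -big_split; apply: eq_bigr => m b; rewrite up // /h /=; ring.
  have e2 : \sum_(m | below ord m n) z (toward (val n) (val m)) =
      \sum_(m | below ord m n) h m + \sum_(m | below ord m n) 1 / (alpha n m)%:Q * c m n
      - \sum_(m | below ord m n && (chain (val m) (val n) == [::])) c m n.
    apply/eqP; rewrite eq_sym subr_eq eq_sym [X in _ + X == _]big_mkcondr -!big_split /=; apply/eqP.
    apply: eq_bigr => m b; rewrite dn // /h.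
    case: eqP => e0; last by ring.
    have -> : alpha n m = 1.
      by rewrite alpha_cont ?(nbr_sym treeG n) ?below_nbr // (chain_rev treeG) e0.
    by rewrite mulr1z !divr1 addr0 mul1r.
  by rewrite !split_nbr e1 e2; ring.
have eh : \sum_(m | nbr n m) h m = (\sum_(m | nbr n m) (omega n m)%:Q / (alpha n m)%:Q) * z (val n)
   + \sum_(m | nbr n m) z (val m) / (alpha n m)%:Q.
  by rewrite mulr_suml -big_split; apply: eq_bigr => m _; rewrite /h /=; ring.
have el : \sum_(u | leg n u) z (toward (val n) (val u)) =
    (\sum_(u | leg n u) (omegaE n u)%:Q / (alphaE n u)%:Q) * z (val n)
   + \sum_(u | leg n u) dcoef z (val u) / (alphaE n u)%:Q.
  by rewrite mulr_suml -big_split; apply: eq_bigr => u nu; rewrite lg //=; ring.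
have er : \sum_(m | nbr n m) resN z m / (alpha n m)%:Q = \sum_(m | nbr n m) z (val m) / (alpha n m)%:Q.
  by apply: eq_bigr => m _; rewrite ffunE.
rewrite /orb er ffunE.
move: ze; rewrite eS eh el; lra.
Qed.

Lemma detneg_leg_dcoef z n u : leg n u ->
  (forall w, w \in chain (val n) (val u) -> dcoef z w = 0) ->
  (alphaE n u)%:Q * z (toward (val n) (val u)) =
    (omegaE n u)%:Q * z (val n) + dcoef z (val u).
Proof.
move=> nu zl; have [pc uc ac _] := leg_branch treeG nu.
have := transport (harm_leg treeG pc uc ac (end_val u) zl).
by rewrite -alphaE_cont // -omegaE_cont // leg_toward // => <-; case: (chain _ _).
Qed.

Lemma toward_node n m k : nbr n m -> (toward (val n) (val m) == val k) =
  (m == k) && (chain (val n) (val m) == [::]).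
Proof.
move=> nm; rewrite nbr_toward //; have [_ _ ac _] := nbr_branch treeG nm.
case: (chain _ _) ac => [|w c] /=; first by rewrite andbT.
move=> /andP[/eqP w2 _]; rewrite andbF; apply/eqP => e.
by have := node_val k; rewrite /= -e w2.
Qed.

Lemma toward_end n m u : nbr n m -> (toward (val n) (val m) == val u) = false.
Proof.
move=> nm; rewrite nbr_toward //; have [_ _ ac _] := nbr_branch treeG nm.
apply/eqP => e; case: (chain _ _) ac e => [|w c] /=.
  by move=> _ e; have := node_val m; have := end_val u; rewrite /= -e => ->.
by move=> /andP[/eqP w2 _] e; have := end_val u; rewrite /= -e w2.
Qed.

Lemma dcoef_lift a w : dcoef (lift_elt ord a) w =
  \sum_n (cN a n)%:Q * (val n == w)%:R + \sum_u (cE a u)%:Q * (val u == w)%:R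
  + \sum_n \sum_(m | below ord n m) (cC a n m)%:Q * (toward (val n) (val m) == w)%:R.
Proof.
rewrite /lift_elt !dcoefD // !dcoef_sum //; congr (_ + _ + _).
- by apply: eq_bigr => n _; rewrite dcoefMz // dcoef_Estar // -mulrzl.
- by apply: eq_bigr => n _; rewrite dcoefMz // dcoef_Estar // -mulrzl.
apply: eq_bigr => n _; rewrite dcoef_sum //; apply: eq_bigr => m _.
by rewrite dcoefMz // dcoef_Estar // -mulrzl.
Qed.

Lemma dcoef_lift_node a n : dcoef (lift_elt ord a) (val n) =
  (cN a n)%:Q + \sum_(m | below ord m n && (chain (val m) (val n) == [::])) (cC a m n)%:Q.
Proof.
rewrite dcoef_lift [X in X + _ + _](bigD1 n) //= eqxx mulr1 big1 ?addr0 => [|m mn]; last first.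
  by rewrite (inj_eq val_inj) (negPf mn) mulr0.
rewrite big1 ?addr0 => [|u _]; last by rewrite eq_sym (negPf (node_end n u)) mulr0.
congr (_ + _); rewrite [RHS]big_mkcond; apply: eq_bigr => m _.
rewrite big_mkcond (bigD1 n) //= big1 ?addr0 => [|k kn].
  case: ifP => b /=; last by [].
  by rewrite toward_node ?below_nbr // eqxx /=; case: eqP => _; rewrite ?mulr1 ?mulr0.
by case: ifP => // b; rewrite toward_node ?below_nbr // (negPf kn) mulr0.
Qed.

Lemma dcoef_lift_end a u : dcoef (lift_elt ord a) (val u) = (cE a u)%:Q.
Proof.
rewrite dcoef_lift big1 ?add0r => [|n _]; last by rewrite (negPf (node_end n u)) mulr0.
rewrite (bigD1 u) //= eqxx mulr1 big1 ?addr0 => [|t tu]; last first.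
  by rewrite (inj_eq val_inj) (negPf tu) mulr0.
rewrite big1 ?addr0 // => n _; rewrite big1 // => m b.
by rewrite toward_end ?below_nbr // mulr0.
Qed.

(** A vertex of valency 2 on a branch at [n] that is the first vertex of a chain
    from [n'] is at the beginning or at the end of this branch. *)
Lemma branch_toward n c w (z : G) n' m' : branch (val n) c z -> w \in c ->
  nbr n' m' -> toward (val n') (val m') = w ->
  [/\ n' = n, z = val m' & w = head z c] \/
  val n' = z /\ chain (val n') (val m') = rev c.
Proof.
move=> b wc nm' e; have [pc uc ac z2] := b; have /eqP w2 := allP ac _ wc.
have wn' : adj w (val n') by rewrite -e adj_sym // adj_toward // nbr_neq.
have [c1 [c2 ec]] : exists c1 c2, c = c1 ++ w :: c2.
  by case/splitPr: wc => c1 c2; exists c1, c2.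
have n'3 : valency (val n') <> 2 by move=> h; have := node_val n'; rewrite h.
move: (pc) (uc) (ac); rewrite ec => pc' uc'; rewrite all_cat /= => /and3P[ac1 _ ac2].
case: (interior_adj_eq treeG pc' uc' w2 wn') => en'; [left|right].
  case/lastP: c1 ec ac1 en' {pc' uc'} => [|c1 t] ec ac1; last first.
    by rewrite last_rcons => en'; case: n'3; rewrite en'; move: ac1; rewrite all_rcons => /andP[/eqP].
  move=> /= /val_inj en'; rewrite en' in nm' e *.
  have h : head z c = head (val m') (chain (val n) (val m')).
    by rewrite -nbr_toward // e ec.
  by by have [_ ->] := branch_inj treeG b (nbr_branch treeG nm') h.
case: c2 ec ac2 en' {pc' uc'} => [|t c2] ec; last first.
  by move=> /andP[/eqP t2 _] en'; case: n'3; rewrite en'.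
move=> _ /= en'; split=> //.
have br : branch (val n') (rev c) (val n).
  by rewrite /= en'; apply: branch_rev => //; move: (node_val n); case: (valency _) => [|[|[]]].
have h : head (val n) (rev c) = head (val m') (chain (val n') (val m')).
  by rewrite -nbr_toward // e ec rev_cat.
by have [<- _] := branch_inj treeG br (nbr_branch treeG nm') h; rewrite ec.
Qed.

Lemma dcoef_lift2 a w : valency w = 2%N -> dcoef (lift_elt ord a) w =
  \sum_n \sum_(m | below ord n m) (cC a n m)%:Q * (toward (val n) (val m) == w)%:R.
Proof.
move=> w2; rewrite dcoef_lift big1 ?add0r => [|n _]; last first.
  by case: eqP => [e|]; rewrite ?mulr0 //; have := node_val n; rewrite e w2.
rewrite big1 ?add0r // => u _.
by case: eqP => [e|]; rewrite ?mulr0 //; have := end_val u; rewrite e w2.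
Qed.

Lemma dcoef_lift_chain a n m w : below ord n m -> w \in chain (val n) (val m) ->
  dcoef (lift_elt ord a) w =
  if w == head (val m) (chain (val n) (val m)) then (cC a n m)%:Q else 0.
Proof.
move=> b wc; have nm := below_nbr b; have br := nbr_branch treeG nm.
have [_ _ ac _] := br; have /eqP w2 := allP ac _ wc; rewrite dcoef_lift2 //.
have key n' m' : below ord n' m' -> toward (val n') (val m') = w ->
    [/\ n' = n, m' = m & w = head (val m) (chain (val n) (val m))].
  move=> b' e; case: (branch_toward br wc (below_nbr b') e) => [[-> /val_inj -> ->]|[/val_inj en' ec]] //.
  have em : m' = n.
    have mm' : nbr m m' by rewrite -en' (below_nbr b').
    have mn : nbr m n by rewrite nbr_sym.
    have ec' : chain (val m) (val m') = rev (chain (val n) (val m)) by move: ec; rewrite en'.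
    apply: (toward_nbr_inj treeG mm' mn); rewrite !nbr_toward // ec' (chain_rev treeG (val n)).
    by move: wc; case/lastP: (chain _ _) => // s t _; rewrite rev_rcons.
  have := below_total nm; rewrite b; move: b'; rewrite en' em => ->.
  by [].
have [wh|wh] := eqVneq w _; last first.
  rewrite big1 // => n' _; rewrite big1 // => m' b'.
  by case: eqP => [e|]; rewrite ?mulr0 //; case: (key _ _ b' e) => _ _ e'; rewrite -e' eqxx in wh.
rewrite (bigD1 n) //= (bigD1 m) //= nbr_toward // -wh eqxx mulr1.
rewrite big1 ?addr0 => [|m' /andP[b' mm']]; last first.
  by case: eqP => [e|]; rewrite ?mulr0 //; case: (key _ _ b' e) => _ e' _; rewrite e' eqxx in mm'.
rewrite big1 ?addr0 // => n' nn'; rewrite big1 // => m' b'.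
by case: eqP => [e|]; rewrite ?mulr0 //; case: (key _ _ b' e) => e' _ _; rewrite e' eqxx in nn'.
Qed.

Lemma dcoef_lift_leg a n u w : leg n u -> w \in chain (val n) (val u) ->
  dcoef (lift_elt ord a) w = 0.
Proof.
move=> nu wc; have br := leg_branch treeG nu.
have [_ _ ac _] := br; have /eqP w2 := allP ac _ wc; rewrite dcoef_lift2 //.
rewrite big1 // => n' _; rewrite big1 // => m' b'.
case: eqP => [e|]; rewrite ?mulr0 //.
by case: (branch_toward br wc (below_nbr b') e) => [[_ e' _]|[e' _]];
  [have := node_end m' u; rewrite e' eqxx|have := node_end n' u; rewrite e' eqxx].
Qed.

Lemma orb_cvec a n : orb (cvec ord a) n = (cN a n)%:Q
  + \sum_(m | below ord n m) (omega n m)%:Q / (alpha n m)%:Q * (cC a n m)%:Q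
  + \sum_(m | below ord m n) 1 / (alpha n m)%:Q * (cC a m n)%:Q
  + \sum_(u | leg n u) (cE a u)%:Q / (alphaE n u)%:Q.
Proof.
have -> : cvec ord a = resN (lift_elt ord a) by apply/ffunP => k; rewrite !ffunE.
rewrite (@orb_resN _ (fun k => (cN a k)%:Q) (fun k m => (cC a k m)%:Q)).
- by congr (_ + _); apply: eq_bigr => u _; rewrite dcoef_lift_end.
- by move=> k m b w wc; apply: dcoef_lift_chain.
- by move=> k u ku w wc; apply: (dcoef_lift_leg _ ku).
exact: dcoef_lift_node.
Qed.

(** The fractional parts undo the rounding in [N], and what remains is linear. *)
Lemma Nbar_orb a l n : Nbar ord a l n = orb (ofint l + cvec ord a) n.
Proof.
rewrite orbD orb_cvec /Nbar /Nval /orb ffunE.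
have -> : \sum_(m | nbr n m) ofint l m / (alpha n m)%:Q = \sum_(m | nbr n m) (l m)%:Q / (alpha n m)%:Q.
  by apply: eq_bigr => m _; rewrite ffunE.
rewrite sumrB [X in _ + (X - _)](eq_bigr (fun u =>
    (cE a u)%:Q / (alphaE n u)%:Q - (omegaE n u)%:Q / (alphaE n u)%:Q * (l n)%:Q)) => [|u _].
  by rewrite sumrB -mulr_suml; ring.
by rewrite /legquot rmorphB rmorphM /=; ring.
Qed.

(** In the span of the [E_n^*] and the [E_u^*] the chains carry no sources. *)
Lemma orb_nodes_ends x n : (forall w, valency w = 2%N -> dcoef x w = 0) ->
  orb (resN x) n = dcoef x (val n) + \sum_(u | leg n u) dcoef x (val u) / (alphaE n u)%:Q.
Proof.
move=> x2; rewrite (@orb_resN x (fun k => dcoef x (val k)) (fun _ _ => 0)).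
- have z1 (P : pred (node G)) (F : node G -> rat) : \sum_(m | P m) F m * 0 = 0.
    by rewrite big1 // => m _; rewrite mulr0.
  by rewrite !z1 !addr0.
- move=> k m b w wc; rewrite if_same x2 //; apply/eqP.
  by have [_ _ ac _] := nbr_branch treeG (below_nbr b); apply: allP ac _ wc.
- move=> k u ku w wc; rewrite x2 //; apply/eqP.
  by have [_ _ ac _] := leg_branch treeG ku; apply: allP ac _ wc.
by rewrite big1 ?addr0.
Qed.

Lemma orb_Estar n k : orb (resN (Estar (val k))) n = (k == n)%:R.
Proof.
rewrite orb_nodes_ends => [|w w2]; last by apply: dcoef_Estar_valency2 => //; apply: node_val.
rewrite dcoef_Estar // (inj_eq val_inj) big1 ?addr0 // => u _.
by rewrite dcoef_Estar // (negPf (node_end k u)) mul0r.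
Qed.

(** The orbifold matrix is inverse to the matrix of the [E_n^*] on the nodes: it
    is symmetric and maps them to the unit vectors, so that pairing with them recovers
    the coordinates. *)
Lemma orb_expansion yy k : yy k = \sum_n orb yy n * Estar (val n) (val k).
Proof.
have := orb_sym yy (resN (Estar (val k))).
rewrite (bigD1 k) //= orb_Estar eqxx mulr1 big1 ?addr0 => [->|n nk].
  by apply: eq_bigr => n _; rewrite ffunE mulrC Estar_sym.
by rewrite orb_Estar eq_sym (negPf nk) mulr0.
Qed.

Lemma orb_inj (y1 y2 : {ffun node G -> rat}) : (forall n, orb y1 n = orb y2 n) -> y1 = y2.
Proof.
move=> h; apply/ffunP => k; rewrite orb_expansion [RHS]orb_expansion.
by apply: eq_bigr => n _; rewrite h.
Qed.

Lemma dcoef_int z w : inL z -> dcoef z w \is a Num.int.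
Proof.
move=> zi; rewrite dcoefE // rpredN rpredD ?rpredM ?intr_int //.
by apply: rpred_sum => t _; apply: zi.
Qed.

Lemma dcoef_lift_int a w : dcoef (lift_elt ord a) w \is a Num.int.
Proof.
rewrite dcoef_lift; rewrite !rpredD //; apply: rpred_sum => n _.
- by rewrite rpredM ?intr_int ?rpred_nat.
- by rewrite rpredM ?intr_int ?rpred_nat.
by apply: rpred_sum => m _; rewrite rpredM ?intr_int ?rpred_nat.
Qed.

(** * Lattice points with given coordinates at the nodes *)

Section Lattice.
Variables (a : redlift G) (x : {ffun G -> rat}).
Hypothesis x2 : forall w, valency w = 2%N -> dcoef x w = 0.
Let z := x - lift_elt ord a.

(** Elimination along the chain from [m] to [n]; the source [cC a n m] sits at
    the last vertex before [n] and is absorbed in the boundary value at [n]. *)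
Lemma lattice_chain n m : below ord n m ->
  (alpha n m)%:Q * hd z (rev (chain (val n) (val m))) (z (val n) - (cC a n m)%:Q) =
  (omega m n)%:Q * z (val m) + (z (val n) - (cC a n m)%:Q) /\
  harm z (z (val m)) (rev (chain (val n) (val m))) (z (val n) - (cC a n m)%:Q).
Proof.
move=> b; have nm := below_nbr b; have mn : nbr m n by rewrite nbr_sym.
have [pc uc ac _] := nbr_branch treeG nm.
have h : harm z (z (val n) - (cC a n m)%:Q) (chain (val n) (val m)) (z (val m)).
  apply: harm_source => // w wc; rewrite dcoefB // x2; last exact/eqP/(allP ac).
  by rewrite (dcoef_lift_chain a b wc); case: ifP; rewrite sub0r ?oppr0.
have hr := harm_rev h; split=> //.
rewrite (alpha_sym nm) (alpha_cont mn) (omega_cont mn) (chain_rev treeG (val n)).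
exact: transport hr.
Qed.

Lemma lattice_leg n u : leg n u ->
  (alphaE n u)%:Q * z (toward (val n) (val u)) =
    (omegaE n u)%:Q * z (val n) + (dcoef x (val u) - (cE a u)%:Q).
Proof.
move=> nu; rewrite detneg_leg_dcoef //; first by rewrite dcoefB // dcoef_lift_end.
move=> w wc; rewrite dcoefB // (dcoef_lift_leg a nu wc) x2 ?subr0 //.
by have [_ _ ac _] := leg_branch treeG nu; apply/eqP/(allP ac).
Qed.

(** Integrality of the vertex next to a node on a chain or a leg is a
    congruence between the values at the two ends, by elimination. *)
Lemma lattice_necessary : inL z -> exists l : {ffun node G -> int},
  [/\ forall n, z (val n) = (l n)%:Q, ZN ord a l &
      forall n u, leg n u -> exists q : int,
        dcoef x (val u) = (cE a u - omegaE n u * l n + alphaE n u * q)%:Q].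
Proof.
move=> zi; pose l : {ffun node G -> int} := [ffun n => Num.floor (z (val n))].
have lE n : z (val n) = (l n)%:Q by rewrite [l n]ffunE; apply/esym/eqP; rewrite -intrEfloor; apply: zi.
exists l; split=> // [n m b|n u nu].
  have [e _] := lattice_chain b; move: e; rewrite !lE.
  have : hd z (rev (chain (val n) (val m))) (z (val n) - (cC a n m)%:Q) \is a Num.int.
    by case: (rev _) => [|w s] /=; [rewrite rpredB ?intr_int|]; rewrite ?zi //; apply: zi.
  rewrite lE => /intrP[q ->]; rewrite -!(rmorphM, rmorphD, rmorphB) /= => /intr_inj e.
  by apply/eqP; rewrite eqz_mod_dvd; apply/dvdzP; exists q; rewrite [RHS]mulrC e; ring.
have := lattice_leg nu; have /intrP[q ->] := zi (toward (val n) (val u)); rewrite lE => e.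
exists q; rewrite rmorphD rmorphB !rmorphM /= e; ring.
Qed.

(** Conversely, these congruences make the vertices next to the nodes
    integral, and integrality spreads along the chains and legs. *)
Lemma lattice_sufficient (n0 : node G) l : (forall n, z (val n) = (l n)%:Q) -> ZN ord a l ->
  (forall n u, leg n u -> exists q : int,
     dcoef x (val u) = (cE a u - omegaE n u * l n + alphaE n u * q)%:Q) ->
  inL z.
Proof.
move=> zl lZ lu v.
have nodei n : z (val n) \is a Num.int by rewrite zl intr_int.
have chi n m : below ord n m -> forall w, w \in chain (val n) (val m) -> z w \is a Num.int.
  move=> b; have [e h] := lattice_chain b.
  have hi : hd z (rev (chain (val n) (val m))) (z (val n) - (cC a n m)%:Q) \is a Num.int.
    have /eqP := lZ _ _ b; rewrite eqz_mod_dvd => /dvdzP[q eq].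
    rewrite (_ : hd _ _ _ = q%:Q) ?intr_int //.
    apply: (mulfI (alphaq_neq0 (below_nbr b))); rewrite e !zl.
    by rewrite -!(rmorphM, rmorphD, rmorphB) /=; congr (_%:~R); rewrite [RHS]mulrC -eq; ring.
  have [xi _] := harm_int h (nodei m) hi.
  by move=> w wc; apply: xi; rewrite mem_rev.
have [[n ->]//|[n [c [t [b vc]]]]] := vertex_branch treeG n0 v.
have [t2|t2|t2] := ltngtP (valency t) 2; last by case: b => _ _ _; rewrite t2.
- have t1 : valency t == 1%N by case: (valency t) t2 (branch_end treeG b) => [|[|]].
  pose u : endv G := exist _ t t1.
  have [nu ec] := @branch_leg _ treeG n c u b.
  have [pc uc ac _] := leg_branch treeG nu.
  have h : harm z (z (val n)) (rcons (chain (val n) (val u)) (val u)) (dcoef z (val u)).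
    apply: harm_leg => //; first exact: end_val.
    move=> w wc; rewrite dcoefB // (dcoef_lift_leg a nu wc) x2 ?subr0 //.
    exact/eqP/(allP ac).
  have hi : hd z (rcons (chain (val n) (val u)) (val u)) (dcoef z (val u)) \is a Num.int.
    have [q eq] := lu _ _ nu; have := lattice_leg nu; rewrite eq zl => e.
    rewrite (_ : hd _ _ _ = q%:Q) ?intr_int //.
    apply: (mulfI (alphaEq_neq0 nu)).
    have <- : z (toward (val n) (val u)) = hd z (rcons (chain (val n) (val u)) (val u)) (dcoef z (val u)).
      by rewrite leg_toward //; case: (chain _ _).
    by rewrite e rmorphD rmorphB !rmorphM /=; ring.
  by have [xi _] := harm_int h (nodei n) hi; apply: xi; rewrite ec.
pose m : node G := exist _ t t2.
have [nm ec] := @branch_nbr _ treeG n c m b.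
move: vc; rewrite mem_rcons inE => /orP[/eqP -> | vc]; first exact: (nodei m).
have := below_total nm; case bnm: (below ord n m) => /=; first by move=> _; apply: (chi _ _ bnm); rewrite ec.
by move=> bmn; apply: (chi _ _ bmn); rewrite chain_rev // mem_rev ec.
Qed.

End Lattice.

Definition span_elt (kap : node G -> rat) (J : endv G -> rat) : {ffun G -> rat} :=
  [ffun t => \sum_n kap n * Estar (val n) t + \sum_u J u * Estar (val u) t].

Lemma dcoef_span kap J w : dcoef (span_elt kap J) w =
  \sum_n kap n * (val n == w)%:R + \sum_u J u * (val u == w)%:R.
Proof.
rewrite (_ : span_elt _ _ = \sum_n [ffun t => kap n * Estar (val n) t]
    + \sum_u [ffun t => J u * Estar (val u) t]); last first.
  by apply/ffunP => t; rewrite !ffunE !sum_ffunE; congr (_ + _); apply: eq_bigr => i _; rewrite ffunE.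
rewrite dcoefD // !dcoef_sum //; congr (_ + _); apply: eq_bigr => i _.
  by rewrite dcoef_scale // dcoef_Estar.
by rewrite dcoef_scale // dcoef_Estar.
Qed.

Lemma dcoef_span_node kap J n : dcoef (span_elt kap J) (val n) = kap n.
Proof.
rewrite dcoef_span (bigD1 n) //= eqxx mulr1 big1 ?addr0 => [|m mn]; last first.
  by rewrite (inj_eq val_inj) (negPf mn) mulr0.
by rewrite big1 ?addr0 // => u _; rewrite eq_sym (negPf (node_end n u)) mulr0.
Qed.

Lemma dcoef_span_end kap J u : dcoef (span_elt kap J) (val u) = J u.
Proof.
rewrite dcoef_span big1 ?add0r => [|n _]; last by rewrite (negPf (node_end n u)) mulr0.
rewrite (bigD1 u) //= eqxx mulr1 big1 ?addr0 // => t tu.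
by rewrite (inj_eq val_inj) (negPf tu) mulr0.
Qed.

Lemma dcoef_span2 kap J w : valency w = 2%N -> dcoef (span_elt kap J) w = 0.
Proof.
move=> w2; rewrite dcoef_span big1 ?add0r => [|n _]; last first.
  by case: eqP => [e|]; rewrite ?mulr0 //; have := node_val n; rewrite e w2.
rewrite big1 // => u _.
by case: eqP => [e|]; rewrite ?mulr0 //; have := end_val u; rewrite e w2.
Qed.

Lemma dcoef_E_neq w t : t != w -> dcoef (E_ rat w) t = - (adj t w : nat)%:R.
Proof.
move=> tw; rewrite dcoefE // ffunE (negPf tw) mulr0 add0r; congr (- _).
have [wt|wt] := boolP (adj t w).
  rewrite (bigD1 w) //= ffunE eqxx big1 ?addr0 // => s /andP[_ sw].
  by rewrite ffunE (negPf sw).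
rewrite big1 // => s ts; rewrite ffunE; case: eqP => // e.
by rewrite -e ts in wt.
Qed.

(** Every class has a representative orthogonal to the vertices of valency 2:
    rooting the tree at a node, the coefficient at such a vertex is corrected by
    a multiple of a child, which leaves the vertices closer to the root alone. *)
Lemma orthogonal_representative (n0 : node G) a : exists2 g, inL g &
  forall w, valency w = 2%N -> dcoef (lift_elt ord a + g) w = 0.
Proof.
pose r := val n0; pose d w := size (tpath w r).
pose child w := odflt w [pick c | [&& c != r, adj w c & w == toward c r]].
have childP w : valency w = 2%N -> [/\ child w != r, adj w (child w) & w = toward (child w) r].
  move=> w2; have wr : w != r by apply/eqP => e; have := node_val n0; rewrite -/r -e w2.
  have [c cr [wc e]] := child_exists treeG wr w2.
  rewrite /child; case: pickP => [c' /and3P[? ? /eqP ?]|/(_ c)] //.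
  by rewrite cr wc -e eqxx.
suff [g gi gd] : exists2 g, inL g & forall w, valency w = 2%N -> (d w < #|G|.+1)%N ->
    dcoef (lift_elt ord a + g) w = 0.
  exists g => // w w2; apply: gd => //; rewrite ltnS.
  have [_ _ /andP[_ ut]] := tpathP treeG w r.
  by rewrite /d -(card_uniqP ut) max_card.
(* Induction on the distance from the root; the vertices at distance [k] are
   corrected simultaneously. *)
elim: #|G|.+1 => [|k [g gi gd]]; first by exists 0 => // v; rewrite ffunE.
pose q w := dcoef (lift_elt ord a + g) w.
have qi w : q w \is a Num.int by rewrite /q dcoefD // rpredD ?dcoef_lift_int ?dcoef_int.
pose P w := (valency w == 2) && (d w == k).
exists (g + \sum_(w | P w) [ffun t => q w * E_ rat (child w) t]).
  move=> v; rewrite ffunE sum_ffunE rpredD ?gi // rpred_sum // => w _.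
  by rewrite !ffunE rpredM ?qi ?rpred_nat.
move=> t t2 tk; rewrite addrA dcoefD // dcoef_sum //.
have dch w : valency w = 2%N -> d (child w) = (d w).+1.
  by move=> w2; have [cr _ e] := childP w w2; rewrite /d size_tpath_parent // -e.
have ad w : P w -> dcoef (E_ rat (child w)) t = - (t == w)%:R.
  move=> /andP[/eqP w2 /eqP dw]; have [cr wc e] := childP w w2.
  have tc : t != child w by apply/eqP => et; move: tk; rewrite et dch // dw ltnn.
  rewrite dcoef_E_neq //; congr (- _%:R); have [->|tw] := eqVneq t w; first by rewrite wc.
  apply/eqP; rewrite eqb0; apply/negP => atc; case: (adj_parent treeG r atc) => [[tr ec]|[_ et]].
    by move: tk; rewrite /d size_tpath_parent // -ec -/(d _) dch // dw -ltnS ltnS ltnNge leqnSn.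
  by move: tw; rewrite et -e eqxx.
rewrite (eq_bigr (fun w => - (q w * (t == w)%:R))) => [|w Pw]; last by rewrite dcoef_scale // ad // mulrN.
rewrite sumrN -/(q t); have [Pt|Pt] := boolP (P t).
  rewrite (bigD1 t) //= eqxx mulr1 big1 ?addr0 ?subrr // => w /andP[_ wt].
  by rewrite eq_sym (negPf wt) mulr0.
rewrite big1 ?oppr0 ?addr0 => [|w Pw]; last first.
  by case: eqP => [e|]; rewrite ?mulr0 // -e (negPf Pt) in Pw *.
apply: gd => //; move: tk; rewrite ltnS leq_eqVlt => /orP[/eqP e|//].
by move: Pt; rewrite /P t2 e !eqxx.
Qed.

(** The restriction to the nodes of a representative orthogonal to the
    vertices of valency 2. *)
Lemma ZN_nonempty (n0 : node G) a : exists l, ZN ord a l.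
Proof.
have [g gi gd] := orthogonal_representative n0 a.
have gi' : inL (lift_elt ord a + g - lift_elt ord a) by rewrite addrAC subrr add0r.
by have [l [_ lZ _]] := lattice_necessary gd gi'; exists l.
Qed.

(** For [l] in [ZN ord a], the vectors with prescribed restriction to the nodes:
    the coefficients at the ends are free up to multiples of [alphaE]. *)
Section Fiber.
Variables (n0 : node G) (a : redlift G) (l : {ffun node G -> int}).
Hypothesis lZ : ZN ord a l.

Definition endcoef n u (i : int) : rat :=
  (alphaE n u)%:Q * (legquot a l n u - (Num.floor (legquot a l n u))%:Q + i%:Q).

Lemma endcoefE n u i : leg n u -> endcoef n u i =
  (cE a u - omegaE n u * l n + alphaE n u * (i - Num.floor (legquot a l n u)))%:Q.
Proof.
move=> nu; rewrite /endcoef; move: (Num.floor _) => f; rewrite /legquot.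
move: (cE a u - omegaE n u * l n) => c; rewrite [in RHS]rmorphD [in RHS]rmorphM [in RHS]rmorphB /=.
by have h := alphaEq_neq0 nu; field.
Qed.

Definition legsum n (i : endv G -> int) : int := \sum_(u | leg n u) i u.

(** [i] counts the multiples of [alphaE] at the ends. *)
Definition fiber_elt (i : endv G -> int) : {ffun G -> rat} :=
  span_elt (fun n => Nval ord a l n - (legsum n i)%:Q)
           (fun u => \sum_(n | leg n u) endcoef n u (i u)).

Lemma sum_leg n u (F : node G -> rat) : leg n u -> \sum_(k | leg k u) F k = F n.
Proof.
by move=> nu; rewrite (big_pred1 n) // => k; apply/idP/eqP => [ku|->//]; apply: (leg_inj treeG ku nu).
Qed.

Lemma dcoef_fiber_end i n u : leg n u -> dcoef (fiber_elt i) (val u) = endcoef n u (i u).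
Proof. by move=> nu; rewrite dcoef_span_end (sum_leg _ nu). Qed.

(** By injectivity of [orb] it is enough to compare both sides after applying
    it, where the choice of [i] cancels. *)
Lemma resN_fiber i : resN (fiber_elt i) = ofint l + cvec ord a.
Proof.
apply: orb_inj => n; rewrite orb_nodes_ends; last by move=> w w2; rewrite dcoef_span2.
have e : \sum_(u | leg n u) dcoef (fiber_elt i) (val u) / (alphaE n u)%:Q =
    \sum_(u | leg n u) (legquot a l n u - (Num.floor (legquot a l n u))%:Q) + (legsum n i)%:Q.
  rewrite /legsum rmorph_sum -big_split /=; apply: eq_bigr => u nu.
  by rewrite (dcoef_fiber_end _ nu) /endcoef mulrC mulKf ?alphaEq_neq0.
by rewrite e dcoef_span_node -Nbar_orb /Nbar; ring.
Qed.

Lemma fiber_lattice i : inL (fiber_elt i - lift_elt ord a).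
Proof.
apply: (lattice_sufficient _ n0 (l := l)) => //.
- by move=> w w2; rewrite dcoef_span2.
- by move=> n; have /ffunP/(_ n) := resN_fiber i; rewrite !ffunE => ->; rewrite addrK.
move=> n u nu; exists (i u - Num.floor (legquot a l n u)).
by rewrite (dcoef_fiber_end _ nu) endcoefE.
Qed.

Lemma Nval_int n : Nval ord a l n \is a Num.int.
Proof.
have h : dcoef (fiber_elt (fun _ => 0)) (val n) = Nval ord a l n.
  by rewrite dcoef_span_node /legsum big1 // subr0.
rewrite -h -[fiber_elt _](subrK (lift_elt ord a)) dcoefD // rpredD ?dcoef_lift_int //.
by apply: dcoef_int; apply: fiber_lattice.
Qed.

(** The coefficients at the ends are determined up to multiples of [alphaE]
    by the congruences, and are nonnegative exactly when the multiple is; those at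
    the nodes follow from the restriction to the nodes. *)
Lemma fiber_complete x : (forall w, valency w = 2%N -> dcoef x w = 0) ->
  inL (x - lift_elt ord a) -> resN x = ofint l + cvec ord a ->
  (forall u, 0 <= dcoef x (val u)) ->
  exists2 i : endv G -> int, (forall u, 0 <= i u) & x = fiber_elt i.
Proof.
move=> x2 xi xl x0; have [l' [l'E l'Z l'u]] := lattice_necessary x2 xi.
have el : l' = l.
  apply/ffunP => n; apply: (@intr_inj rat); rewrite -l'E.
  by have /ffunP/(_ n) := xl; rewrite !ffunE => ->; rewrite addrK.
have iu u : exists j : int, forall n, leg n u -> 0 <= j /\ dcoef x (val u) = endcoef n u j.
  have [n nu] := end_leg treeG n0 u; have [q e] := l'u n u nu.
  exists (q + Num.floor (legquot a l n u)) => k ku; rewrite (leg_inj treeG ku nu).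
  have e' : dcoef x (val u) = endcoef n u (q + Num.floor (legquot a l n u)).
    by rewrite endcoefE // e el addrK.
  split=> //; have := x0 u; rewrite e' /endcoef pmulr_rge0 ?ltr0z ?alphaE_gt0 // => h.
  have lt : - 1%:~R < (q + Num.floor (legquot a l n u))%:~R :> rat.
    have := floorD1_gt (legquot a l n u); rewrite intrD; lra.
  by rewrite -intrN ltr_int in lt.
exists (fun u => xget 0 [set j : int | forall n, leg n u -> 0 <= j /\ dcoef x (val u) = endcoef n u j]%classic).
  by move=> u; have [n nu] := end_leg treeG n0 u; have [j jP] := iu u; case: xgetP => [k -> kP|_]; [case: (kP n nu)|].
set i := fun u => _.
have iP n u : leg n u -> dcoef x (val u) = endcoef n u (i u).
  move=> nu; rewrite /i; case: xgetP => [k -> kP|]; first by case: (kP n nu).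
  by have [j jP] := iu u; move=> /(_ j).
apply: dcoef_inj => // w.
case: (vertex_cases treeG n0 w) => [[n ->]|w2|[u ->]].
- have := orb_nodes_ends n x2.
  have -> : resN x = resN (fiber_elt i) by rewrite xl resN_fiber.
  rewrite orb_nodes_ends; last by move=> t t2; rewrite dcoef_span2.
  move=> /eqP; rewrite eq_sym.
  rewrite (eq_bigr (fun u => dcoef (fiber_elt i) (val u) / (alphaE n u)%:Q)) => [|u nu].
    by rewrite (inj_eq (addIr _)) => /eqP.
  by rewrite (iP _ _ nu) (dcoef_fiber_end _ nu).
- by rewrite x2 // dcoef_span2.
by have [n nu] := end_leg treeG n0 u; rewrite (iP _ _ nu) (dcoef_fiber_end _ nu).
Qed.

Lemma fiber_inj i j : (forall u, dcoef (fiber_elt i) (val u) = dcoef (fiber_elt j) (val u)) -> i =1 j.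
Proof.
move=> h u; have [n nu] := end_leg treeG n0 u; have := h u.
rewrite !(dcoef_fiber_end _ nu) /endcoef => /(mulfI (alphaEq_neq0 nu)) /addrI /intr_inj //.
Qed.

Lemma endcoef_ge0 n u i : leg n u -> 0 <= i -> 0 <= endcoef n u i.
Proof.
move=> nu i0; apply: mulr_ge0; first by rewrite ler0z ltW // alphaE_gt0.
by rewrite addr_ge0 ?ler0z // subr_ge0 floor_le.
Qed.

End Fiber.

End Orbifold.

(** * The coefficients of the reduced series *)

Section Binomial.

(** [binser d] extended by 0 to negative exponents. *)
Definition zbin (d z : int) : int := if z is Posz k then binser d k else 0.

Lemma binser_pascal d k : binser d k.+1 = binser (d - 1) k.+1 - binser (d - 1) k.
Proof.
case: d => [[|r]|r].
- by rewrite (_ : 0%:Z - 1 = Negz 0) //= bin0n mulr0 !add0n !binn subrr.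
- rewrite (_ : r.+1%:Z - 1 = Posz r); last lia.
  by rewrite /= binS PoszD exprS; ring.
rewrite (_ : Negz r - 1 = Negz r.+1); last lia.
by rewrite /= !addSn !addnS (binS (r + k).+1 k) PoszD addrK.
Qed.

Lemma binser0 d : binser d 0 = 1.
Proof. by case: d => r; rewrite /= ?expr0 ?bin0. Qed.

Lemma zbin_pascal d z : zbin d z = zbin (d - 1) z - zbin (d - 1) (z - 1).
Proof.
case: z => [[|k]|k].
- by rewrite (_ : 0%:Z - 1 = Negz 0) //= !binser0.
- by rewrite (_ : k.+1%:Z - 1 = Posz k); [rewrite /= binser_pascal|lia].
by rewrite (_ : Negz k - 1 = Negz k.+1) //; lia.
Qed.

Lemma zbin_neg d z : z < 0 -> zbin d z = 0. Proof. by case: z. Qed.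

(** Multiplication of [(1 - z)^d] by the geometric series. *)
Lemma sum_zbin d z (B : nat) : z < B%:Z -> \sum_(t < B) zbin d (z - t%:Z) = zbin (d - 1) z.
Proof.
move=> zB; have h : forall k : nat, \sum_(t < k) zbin d (z - t%:Z) = zbin (d - 1) z - zbin (d - 1) (z - k%:Z).
  elim=> [|k IH]; first by rewrite big_ord0 subr0 subrr.
  rewrite big_ord_recr /= IH (zbin_pascal d) (_ : z - k.+1%:Z = z - k%:Z - 1); [ring|lia].
by rewrite h [X in _ - X]zbin_neg ?subr0 // subr_lt0.
Qed.

End Binomial.

Section Legs.
Variables (I J : finType) (own : J -> I).

(** Distributing the geometric series, indexed by [J], over the factors, indexed
    by [I], to which [own] assigns them. *)
Lemma sum_prod_zbin (d N : I -> int) (b : nat) (s : seq J) :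
  (forall n, N n < b.+1%:Z) -> uniq s ->
  \sum_(i : {ffun J -> 'I_b.+1} | [forall u, (u \notin s) ==> (i u == ord0)])
    \prod_n zbin (d n) (N n - \sum_(u | own u == n) (i u)%:Z) =
  \prod_n zbin (d n - (count (fun u => own u == n) s)%:Z) (N n).
Proof.
elim: s N => [|u0 s IH] N Nb.
  move=> _; rewrite (big_pred1 [ffun _ => ord0]) => [|i] /=; last first.
    apply/forallP/eqP => [h|-> u]; last by rewrite ffunE eqxx.
    by apply/ffunP => u; rewrite ffunE; apply/eqP/h.
  apply: eq_bigr => n _; rewrite big1 ?subr0 // => u _; by rewrite ffunE.
move=> /andP[u0s us].
rewrite (partition_big (fun i : {ffun J -> 'I_b.+1} => i u0) predT) //=.
pose N' (t : 'I_b.+1) n := N n - (t * (own u0 == n))%N%:Z.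
have N'b t n : N' t n < b.+1%:Z by rewrite /N'; have := Nb n; lia.
rewrite (eq_bigr (fun t : 'I_b.+1 =>
    \prod_n zbin (d n - (count (fun u => own u == n) s)%:Z) (N' t n))) => [|t _].
  rewrite (eq_bigr (fun t : 'I_b.+1 =>
     zbin (d (own u0) - (count (fun u => own u == own u0) s)%:Z) (N (own u0) - t%:Z) *
     \prod_(n | n != own u0) zbin (d n - (count (fun u => own u == n) s)%:Z) (N n))) => [|t _].
    rewrite -mulr_suml sum_zbin // [RHS](bigD1 (own u0)) //=; congr (_ * _).
      by rewrite eqxx; congr (zbin _ _); lia.
    apply: eq_bigr => n nu; rewrite eq_sym (negPf nu) //.
  rewrite (bigD1 (own u0)) //=; congr (_ * _); first by rewrite /N' eqxx muln1.
  by apply: eq_bigr => n nu; rewrite /N' eq_sym (negPf nu) muln0 subr0.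
rewrite -(IH (N' t)) //.
pose upd (i : {ffun J -> 'I_b.+1}) (k : 'I_b.+1) : {ffun J -> 'I_b.+1} :=
  [ffun u => if u == u0 then k else i u].
rewrite (reindex_onto (fun i => upd i t) (fun i => upd i ord0)) => [|i /andP[_ /eqP it]]; last first.
  by apply/ffunP => u; rewrite !ffunE; case: eqP => // ->.
apply: eq_big => [i|i /andP[/andP[h /eqP e] /eqP e']].
  rewrite ffunE eqxx eqxx andbT; apply/andP/forallP => [[/forallP h /eqP e] u|h].
    apply/implyP => us'; have := h u; rewrite -e !ffunE inE negb_or us' andbT.
    by case: (u == u0).
  split.
    apply/forallP => u; rewrite inE negb_or ffunE; apply/implyP => /andP[/negPf -> us'].
    exact: (implyP (h u)).
  apply/eqP/ffunP => u; rewrite !ffunE; case: eqP => [->|//].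
  by apply/esym/eqP/(implyP (h u0)).
apply: eq_bigr => n _; congr (zbin _ _); rewrite /N' -addrA; congr (_ + _).
have iu0 : i u0 = ord0 by rewrite -e' !ffunE eqxx.
rewrite -opprD; congr (- _).
have [eo|eo] := eqVneq (own u0) n.
  rewrite muln1 (bigD1 u0) ?eo //= !ffunE eqxx; congr (_ + _).
  rewrite [RHS](bigD1 u0) ?eo //= iu0 add0r; apply: eq_bigr => u /andP[_ uu0].
  by rewrite ffunE (negPf uu0).
rewrite muln0 add0r; apply: eq_bigr => u /eqP eu; rewrite ffunE; case: eqP => // uu0.
by rewrite -eu uu0 eqxx in eo.
Qed.

End Legs.

Section Poincare.
Variables (G : plumbing) (ord : rel (node G)).
Hypothesis treeG : is_tree G.
Hypothesis negG : negative_definite G.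
Hypothesis ordG : orientation ord.
Variable n0 : node G.
Implicit Types (v w : G) (x y z : {ffun G -> rat}) (n m : node G) (u : endv G).

(** The [E_w^*] are a basis, so that there is only one expansion. *)
Lemma pcoefE x (j : G -> nat) : (forall w, dcoef x w = (j w)%:R) ->
  pcoef x = \prod_w binser ((valency w)%:Z - 2) (j w).
Proof.
move=> xj; rewrite /pcoef (_ : [set _ | _]%classic = [set [ffun w => j w]]%classic).
  by rewrite fsbig_set1; apply: eq_bigr => w _; rewrite ffunE.
apply/seteqP; split=> [k /= e|_ /= ->].
  apply/ffunP => w; rewrite ffunE; apply: (@mulrIn rat 1) => //; rewrite -xj -e dcoef_sum //.
  rewrite (bigD1 w) //= big1 => [|v vw]; rewrite dcoefMn // dcoef_Estar //.
    by rewrite eqxx addr0.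
  by rewrite (negPf vw) mul0rn.
apply: dcoef_inj => // w; rewrite dcoef_sum // xj (bigD1 w) //= big1 => [|v vw]; rewrite dcoefMn // dcoef_Estar //.
  by rewrite eqxx addr0 ffunE.
by rewrite (negPf vw) mul0rn.
Qed.

(** The factor of a vertex of valency 2 is constant. *)
Lemma pcoef_neq0 x : pcoef x != 0 ->
  exists2 j : G -> nat, (forall w, dcoef x w = (j w)%:R) & (forall w, valency w = 2%N -> j w = 0%N).
Proof.
move=> px; have [j e] : exists j : {ffun G -> nat}, \sum_w Estar w *+ j w = x.
  apply: contrapT => h; move: px; rewrite /pcoef fsbig1 ?eqxx // => j /= e.
  by case: h; exists j.
have xj w : dcoef x w = (j w)%:R.
  rewrite -e dcoef_sum // (bigD1 w) //= big1 => [|v vw]; rewrite dcoefMn // dcoef_Estar //.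
    by rewrite eqxx addr0.
  by rewrite (negPf vw) mul0rn.
exists j => // w w2; move: px; rewrite (pcoefE xj).
apply: contra_neq_eq => jw; rewrite (bigD1 w) //= w2 subrr /=.
by case: (j w) jw => // k _; rewrite bin0n mulr0 mul0r.
Qed.

(** The factor at an end is a geometric series, with coefficients 1. *)
Lemma pcoef_nodes x (N : node G -> int) (J : endv G -> nat) :
  (forall n, dcoef x (val n) = (N n)%:~R) -> (forall u, dcoef x (val u) = (J u)%:R) ->
  (forall w, valency w = 2%N -> dcoef x w = 0) ->
  pcoef x = \prod_n zbin ((valency (val n))%:Z - 2) (N n).
Proof.
move=> xN xJ x2; have [N0|/forallPn[n]] := boolP [forall n, 0 <= N n]; last first.
  rewrite -ltNge => Nn; rewrite [RHS](bigD1 n) //= zbin_neg // mul0r.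
  apply/eqP; apply: contraLR Nn => /pcoef_neq0[j xj _]; rewrite -leNgt.
  by rewrite -(ler0z rat) -xN xj ler0n.
have {}N0 n : 0 <= N n by apply: (forallP N0).
pose jn w : nat := \sum_(n | val n == w) `|N n|%N + \sum_(u | val u == w) J u.
have jnN n : jn (val n) = `|N n|%N.
  rewrite /jn (big_pred1 n) => [|m]; last by rewrite (inj_eq val_inj).
  by rewrite big1 ?addr0 // => u /eqP e; have := node_end n u; rewrite -e eqxx.
have jnJ u : jn (val u) = J u.
  rewrite /jn big1 => [|n /eqP e]; last by have := node_end n u; rewrite -e eqxx.
  by rewrite add0r (big_pred1 u) // => m; rewrite (inj_eq val_inj).
have jn2 w : valency w = 2%N -> jn w = 0%N.
  move=> w2; rewrite /jn !big1 // => [u|n] /eqP e.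
    by have := end_val u; rewrite e w2.
  by have := node_val n; rewrite e w2.
have xj w : dcoef x w = (jn w)%:R.
  case: (vertex_cases treeG n0 w) => [[n ->]|w2|[u ->]].
  - by rewrite xN jnN -[N n in LHS]gez0_abs // pmulrn.
  - by rewrite x2 // jn2.
  by rewrite xJ jnJ.
rewrite (pcoefE xj) (bigID (fun w => (2 < valency w)%N)) /= [X in _ * X]big1 ?mulr1 => [|w w3].
  rewrite (reindex_onto (fun n : node G => val n) (fun w => insubd n0 w)) /= => [|w w3]; last first.
    by rewrite insubdK.
  apply: eq_big => [n|n _]; first by rewrite node_val valKd eqxx.
  by rewrite jnN; have := N0 n; case: (N n).
case: (vertex_cases treeG n0 w) => [[n e]|w2|[u ->]].
- by rewrite e node_val in w3.
- by rewrite jn2 // binser0.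
rewrite end_val (_ : 1%:Z - 2 = Negz 0) //= add0n binn //.
Qed.

Variables (a : redlift G) (h : {ffun G -> rat}).
Hypothesis ah : same_class (lift_elt ord a) h.

Lemma same_class_lift x : same_class x h <-> inL (x - lift_elt ord a).
Proof.
split=> [xh v|xa v].
  have -> : (x - lift_elt ord a) v = (x - h) v - (lift_elt ord a - h) v.
    by rewrite !ffunE; ring.
  by apply: rpredB; [apply: xh|apply: ah].
have -> : (x - h) v = (x - lift_elt ord a) v + (lift_elt ord a - h) v.
  by rewrite !ffunE; ring.
by apply: rpredD; [apply: xa|apply: ah].
Qed.

Definition Nint (l : {ffun node G -> int}) n : int := Num.floor (Nval ord a l n).

Lemma NintE l n : ZN ord a l -> (Nint l n)%:~R = Nval ord a l n.
Proof. by move=> lZ; apply/eqP; rewrite -intrEfloor; apply: (Nval_int treeG negG ordG n0 lZ). Qed.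

(** Vectors with nonzero coefficient are orthogonal to the vertices of valency
    2, so that [lattice_necessary] applies. *)
Lemma Zh_off e : (forall l, ZN ord a l -> e <> ofint l + cvec ord a) -> Zh h e = 0.
Proof.
move=> he; rewrite /Zh fsbig1 // => x [/same_class_lift xh xe].
apply/eqP; apply: contraT => /pcoef_neq0[j xj j2].
have x2 w : valency w = 2%N -> dcoef x w = 0 by move=> w2; rewrite xj j2.
have [l [lE lZ _]] := lattice_necessary treeG negG ordG x2 xh.
case: (he l lZ); rewrite -xe; apply/ffunP => n; rewrite !ffunE.
by rewrite -lE !ffunE subrK.
Qed.

Definition legnode u : node G := xget n0 [set n | leg n u]%classic.

Lemma legnodeP n u : (legnode u == n) = leg n u.
Proof.
have [m mu] := end_leg treeG n0 u.
have hl : leg (legnode u) u by rewrite /legnode; case: xgetP => [k -> //|/(_ m)].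
by apply/eqP/idP => [<- //|nu]; apply: (leg_inj treeG hl nu).
Qed.

(** The coefficients of the reduced series. The fibre over [l] consists of the
    vectors with a multiplicity at every end, whose sum is a product of geometric
    series; each of these lowers an exponent [valency - 2] by one. *)
Lemma Zh_on l : ZN ord a l ->
  Zh h (ofint l + cvec ord a) = \prod_n zbin ((degN n)%:Z - 2) (Nint l n).
Proof.
move=> lZ; pose b := \max_n `|Nint l n|%N.
have Nb n : Nint l n < b.+1%:Z.
  have : (`|Nint l n| <= b)%N by apply: leq_bigmax.
  lia.
pose phi (i : {ffun endv G -> 'I_b.+1}) := fiber_elt ord a l (fun u => (i u)%:Z).
have phi2 i w : valency w = 2%N -> dcoef (phi i) w = 0 by move=> w2; rewrite dcoef_span2.
have phi_end i u : exists k : nat, dcoef (phi i) (val u) = k%:R.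
  have [n nu] := end_leg treeG n0 u.
  have := endcoef_ge0 treeG negG a l nu (isT : 0 <= (i u)%:Z).
  have -> : dcoef (phi i) (val u) = endcoef a l n u (i u) by apply: dcoef_fiber_end.
  rewrite endcoefE // ler0z.
  by case: (_ + _) => // k _; exists k.
have phi_inj : injective phi.
  move=> i j e; apply/ffunP => u; apply: val_inj.
  have hij : (fun t => (i t)%:Z) =1 (fun t => (j t)%:Z).
    by apply: (@fiber_inj G ord treeG negG n0 a l) => t; rewrite -/(phi i) -/(phi j) e.
  by case: (hij u).
have phiA i : [set x : {ffun G -> rat} | same_class x h /\
    [ffun n : node G => x (val n)] = ofint l + cvec ord a]%classic (phi i).
  split; first by apply/same_class_lift; apply: fiber_lattice.
  exact: (resN_fiber treeG negG ordG).
rewrite /Zh (@fsbigE _ _ _ _ _ [seq phi i | i <- enum {ffun endv G -> 'I_b.+1}]).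
- rewrite big_map big_mkcond /= big_enum /=.
  rewrite (eq_bigr (fun i : {ffun endv G -> 'I_b.+1} => \prod_n zbin ((valency (val n))%:Z - 2)
     (Nint l n - \sum_(u | legnode u == n) (i u)%:Z))) => [|i _].
    have := sum_prod_zbin legnode (fun n : node G => (valency (val n))%:Z - 2) Nb (enum_uniq {: endv G}).
    move=> hs; apply: etrans (etrans _ hs) _.
      by apply: eq_bigl => i; apply/esym/forallP => u; rewrite mem_enum.
    apply: eq_bigr => n _; congr (zbin _ _).
    have -> : count (fun u => legnode u == n) (enum {: endv G}) = #|[pred u | leg n u]|.
      rewrite -sum1_count big_enum_cond /= sum1_card; apply: eq_card => u.
      by rewrite !inE -legnodeP.
    by rewrite (valency_node treeG n) PoszD; ring.
  rewrite ifT; last by apply/asboolP; apply: phiA.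
  have phiN n : dcoef (phi i) (val n) = (Nint l n - \sum_(u | legnode u == n) (i u)%:Z)%:~R.
    rewrite dcoef_span_node // rmorphB /= NintE // /legsum.
    by congr (_ - _%:~R); apply: eq_bigl => u; rewrite legnodeP.
  have [J JP] : exists J : endv G -> nat, forall u, dcoef (phi i) (val u) = (J u)%:R.
    by have [J JP] := choice (phi_end i); exists J.
  exact: pcoef_nodes phiN JP (phi2 i).
- by rewrite map_inj_uniq ?enum_uniq.
- by move=> x /= /mapP[i _ ->]; apply: phiA.
move=> x [/same_class_lift xh xe] xr; apply/eqP; apply: contraNT xr => /pcoef_neq0[j xj j2].
have x2 w : valency w = 2%N -> dcoef x w = 0 by move=> w2; rewrite xj j2.
have [|i i0 ei] := fiber_complete treeG negG ordG n0 (l := l) x2 xh xe.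
  by move=> u; rewrite xj ler0n.
(* A larger multiplicity would make the coefficient at the node of the leg
   negative. *)
have ib u : (`|i u| < b.+1)%N.
  have [n nu] := end_leg treeG n0 u; rewrite ltnS.
  have : 0 <= dcoef x (val n) by rewrite xj ler0n.
  rewrite ei dcoef_span_node // -NintE // -rmorphB ler0z subr_ge0 => h1.
  have h2 : i u <= legsum n i by rewrite /legsum (bigD1 u) //= lerDl sumr_ge0.
  have h3 := Nb n.
  have := i0 u; lia.
apply/mapP; exists [ffun u => Ordinal (ib u)]; first by rewrite mem_enum.
rewrite ei; congr (fiber_elt _ _ _ _); apply/funext => u; rewrite ffunE /=.
by rewrite gez0_abs.
Qed.

End Poincare.

(** * Multiplication and division by the factors *)

Section Series.
Variable G : plumbing.
Variable v : node G -> {ffun node G -> int}.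
Implicit Types (f g P Q R : series G) (e : {ffun node G -> rat}) (n : node G).
Implicit Types (s t : seq (node G)).

Notation expo := {ffun node G -> rat}.

Lemma seriesD f g e : (f + g) e = f e + g e. Proof. by []. Qed.
Lemma seriesN f e : (- f) e = - f e. Proof. by []. Qed.
Lemma series0 e : (0 : series G) e = 0. Proof. by []. Qed.
Lemma seriesMz f (c : int) e : (f *~ c) e = f e * c.
Proof.
have h k : (f *+ k) e = f e * k%:Z by elim: k => [|k IH]; rewrite ?mulr0n ?mulr0 // mulrS seriesD IH; lia.
by case: c => k; rewrite /intmul ?seriesN h; lia.
Qed.
Lemma series_sum I (r : seq I) (p : pred I) (F : I -> series G) e :
  (\sum_(i <- r | p i) F i) e = \sum_(i <- r | p i) F i e.
Proof. by elim/big_rec2: _ => [|i a b _ <-]. Qed.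

Lemma tmulD e f g : tmul e (f + g) = tmul e f + tmul e g. Proof. by []. Qed.
Lemma tmulN e f : tmul e (- f) = - tmul e f. Proof. by []. Qed.
Lemma tmul_comp e e' f : tmul e (tmul e' f) = tmul (e + e') f.
Proof. by apply/funext => x; rewrite /tmul opprD addrA. Qed.
Lemma tmul_mono e e' : tmul e (mono e') = mono (e + e').
Proof. by apply/funext => x; rewrite /tmul /mono subr_eq addrC. Qed.
Lemma tmul_0 f : tmul 0 f = f.
Proof. by apply/funext => x; rewrite /tmul subr0. Qed.

(** Multiplication by [1 - t^{v_n}]. *)
Definition den n f : series G := f - tmul (ofint (v n)) f.
Definition md s f : series G := foldr den f s.

Lemma denD n f g : den n (f + g) = den n f + den n g.
Proof. by rewrite /den tmulD opprD addrACA. Qed.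
Lemma denN n f : den n (- f) = - den n f.
Proof. by rewrite /den tmulN opprD. Qed.
Lemma den_tmul n e f : den n (tmul e f) = tmul e (den n f).
Proof. by rewrite /den tmulD tmulN !tmul_comp (addrC e). Qed.
Lemma denC n n' f : den n (den n' f) = den n' (den n f).
Proof. by rewrite [den n' f]/den denD denN den_tmul. Qed.

Lemma mdD s f g : md s (f + g) = md s f + md s g.
Proof. by elim: s => //= n s ->; rewrite denD. Qed.
Lemma mdN s f : md s (- f) = - md s f.
Proof. by elim: s => //= n s ->; rewrite denN. Qed.
Lemma mdB s f g : md s (f - g) = md s f - md s g.
Proof. by rewrite mdD mdN. Qed.
Lemma md0 s : md s 0 = 0.
Proof. by have := mdB s 0 0; rewrite !subrr. Qed.
Lemma mdMz s f (c : int) : md s (f *~ c) = md s f *~ c.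
Proof.
have h k : md s (f *+ k) = md s f *+ k by elim: k => [|k IH]; rewrite ?mulr0n ?md0 // !mulrS mdD IH.
by case: c => k; rewrite /intmul ?mdN h.
Qed.
Lemma md_sum s I (r : seq I) (p : pred I) (F : I -> series G) :
  md s (\sum_(i <- r | p i) F i) = \sum_(i <- r | p i) md s (F i).
Proof. by elim/big_rec2: _ => [|i a b _ <-]; rewrite ?md0 ?mdD. Qed.
Lemma md_tmul s e f : md s (tmul e f) = tmul e (md s f).
Proof. by elim: s => //= n s ->; rewrite den_tmul. Qed.
Lemma md_den s n f : md s (den n f) = den n (md s f).
Proof. by elim: s => //= m s ->; rewrite denC. Qed.
Lemma md_cat s t f : md (s ++ t) f = md s (md t f).
Proof. by rewrite /md foldr_cat. Qed.
Lemma mdC s t f : md s (md t f) = md t (md s f).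
Proof. by elim: s f => //= n s IH f; rewrite IH md_den. Qed.
Lemma md_perm s t f : perm_eq s t -> md s f = md t f.
Proof.
elim: s t => [|n s IH] t; first by rewrite perm_sym => /perm_nilP ->.
move=> pst; have nt : n \in t by rewrite -(perm_mem pst) mem_head.
case/splitPr: nt pst => t1 t2 pst.
have {}pst : perm_eq s (t1 ++ t2).
  by rewrite -(perm_cons n); apply: perm_trans pst _; rewrite -[n :: t2]cat1s perm_catCA.
by rewrite /= (IH _ pst) !md_cat /= md_den.
Qed.
Lemma mulden_md I f : mulden v I f = md (enum I) f. Proof. by []. Qed.
Lemma mulden_split (I J1 J2 : {set node G}) f : J1 :|: J2 = I -> [disjoint J1 & J2] ->
  mulden v I f = mulden v J1 (mulden v J2 f).
Proof.
move=> <- d; rewrite !mulden_md -md_cat; apply: md_perm; apply: uniq_perm.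
- exact: enum_uniq.
- rewrite cat_uniq !enum_uniq andbT /=; apply/hasPn => n; rewrite mem_enum => n2; rewrite /= mem_enum.
  by apply/negP => n1; move/pred0P: d => /(_ n); rewrite /= n1 n2.
by move=> n; rewrite mem_cat !mem_enum finset.in_setU.
Qed.

(** Expanding the product, each term picks a subset of the factors. *)
Lemma md_supp s f e : md s f e != 0 ->
  exists t, subseq t s /\ f (e - \sum_(n <- t) ofint (v n)) != 0.
Proof.
elim: s e => [|n s IH] e /=; first by exists [::]; rewrite big_nil subr0.
rewrite /den seriesD seriesN /tmul; have [e0|/IH[t [ts te]] _] := eqVneq (md s f e) 0.
  rewrite e0 add0r oppr_eq0 => /IH[t [ts te]]; exists (n :: t); split=> /=; first by rewrite eqxx.
  by rewrite big_cons opprD addrA.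
by exists t; split=> //; exact: (subseq_trans ts (subseq_cons s n)).
Qed.

Lemma laurent0 : laurent (0 : series G).
Proof. by rewrite /laurent (_ : [set e | _]%classic = set0) // -subset0 => e /= /eqP[]. Qed.
Lemma laurentD f g : laurent f -> laurent g -> laurent (f + g).
Proof.
move=> lf lg; apply: (@sub_finite_set _ _ ([set e | f e != 0] `|` [set e | g e != 0])%classic); last by rewrite finite_setU.
move=> e /=; rewrite seriesD; have [->|fe] := eqVneq (f e) 0; last by left.
by rewrite add0r; right.
Qed.
Lemma laurentMz f c : laurent f -> laurent (f *~ c).
Proof.
apply: sub_finite_set => e /=; rewrite seriesMz; apply: contra => /eqP ->.
by rewrite mul0r.
Qed.
Lemma laurentN f : laurent f -> laurent (- f).
Proof. by apply: sub_finite_set => e /=; rewrite seriesN oppr_eq0. Qed.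
Lemma laurentB f g : laurent f -> laurent g -> laurent (f - g).
Proof. by move=> lf lg; apply: laurentD => //; apply: laurentN. Qed.
Lemma laurent_mono e : laurent (mono e).
Proof.
rewrite /laurent (_ : [set e | _]%classic = [set e]%classic); first exact: finite_set1.
apply/seteqP; split=> x /=; rewrite /mono; last by move=> ->; rewrite eqxx.
by case: (x =P e).
Qed.
Lemma laurent_tmul e f : laurent f -> laurent (tmul e f).
Proof.
move=> lf; apply: (@sub_finite_set _ _ ((fun x => x + e) @` [set e | f e != 0])%classic).
  by move=> x /= fx; exists (x - e) => //; rewrite subrK.
exact: finite_image.
Qed.
Lemma laurent_md s f : laurent f -> laurent (md s f).
Proof.
by move=> lf; elim: s => //= n s IH; apply: laurentB => //; apply: laurent_tmul.
Qed.

Lemma laurent_ind (C : series G -> Prop) : C 0 ->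
  (forall f g, C f -> C g -> C (f + g)) -> (forall f c, C f -> C (f *~ c)) ->
  forall f, laurent f -> (forall e, f e != 0 -> C (mono e)) -> C f.
Proof.
move=> C0 CD CM f lf Cf.
have /finite_seqP[r er] := lf.
have inr e : (e \in undup r) = (f e != 0).
  rewrite mem_undup; apply/idP/idP => [er'|fe].
    by have : [set` r]%classic e by []; rewrite -er.
  by have : [set e | f e != 0]%classic e by []; rewrite er.
have -> : f = \sum_(e <- undup r) mono e *~ f e.
  apply/funext => x; rewrite series_sum.
  have [fx|fx] := eqVneq (f x) 0.
    rewrite fx big1_seq // => e /andP[_]; rewrite inr => fe.
    rewrite seriesMz /mono; case: (x =P e) => [ex|]; rewrite ?mul0r //.
    by rewrite -ex fx eqxx in fe.
  rewrite (bigD1_seq x) ?undup_uniq ?inr //=.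
  rewrite big1 ?addr0 => [|e ex]; rewrite seriesMz /mono; first by rewrite eqxx mul1r.
  by rewrite eq_sym (negPf ex) mul0r.
apply: big_ind => // e _; have [fe|fe] := eqVneq (f e) 0; first by rewrite fe mulr0z.
by apply: CM; apply: Cf.
Qed.

Lemma supp0 (S : expo -> Prop) : supp_in S 0. Proof. by move=> e; rewrite series0 eqxx. Qed.
Lemma suppD (S : expo -> Prop) f g : supp_in S f -> supp_in S g -> supp_in S (f + g).
Proof.
move=> sf sg e; rewrite seriesD; have [->|fe _] := eqVneq (f e) 0; last exact: sf.
by rewrite add0r; apply: sg.
Qed.
Lemma suppMz (S : expo -> Prop) f c : supp_in S f -> supp_in S (f *~ c).
Proof.
by move=> sf e; rewrite seriesMz => h; apply: sf; apply: contraNneq h => ->; rewrite mul0r.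
Qed.
Lemma suppN (S : expo -> Prop) f : supp_in S f -> supp_in S (- f).
Proof. by move=> sf e; rewrite seriesN oppr_eq0; apply: sf. Qed.
Lemma suppW (S S' : expo -> Prop) f : (forall e, S e -> S' e) -> supp_in S f -> supp_in S' f.
Proof. by move=> SS sf e /sf/SS. Qed.
Lemma supp_mono (S : expo -> Prop) e : S e -> supp_in S (mono e).
Proof. by move=> Se x; rewrite /mono; case: (x =P e) => [->|]. Qed.

Definition lsupp (S : expo -> Prop) f := laurent f /\ supp_in S f.

(** Subgroups of the group of series. *)
Definition zlin (C : series G -> Prop) :=
  [/\ C 0, forall f g, C f -> C g -> C (f + g) & forall f (c : int), C f -> C (f *~ c)].

Definition img (Phi : series G -> series G) (S : expo -> Prop) f :=
  exists2 Q, lsupp S Q & f = Phi Q.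
Definition sumset (C1 C2 : series G -> Prop) f :=
  exists f1 f2, [/\ C1 f1, C2 f2 & f = f1 + f2].

Lemma zlin_lsupp S : zlin (lsupp S).
Proof.
split=> [|f g [lf sf] [lg sg]|f c [lf sf]].
- by split; [exact: laurent0|exact: supp0].
- by split; [exact: laurentD|exact: suppD].
by split; [exact: laurentMz|exact: suppMz].
Qed.
Lemma zlin_img s S : zlin (img (md s) S).
Proof.
have [z0 zD zM] := zlin_lsupp S; split.
- by exists 0; rewrite ?md0.
- by move=> _ _ [Q sQ ->] [Q' sQ' ->]; exists (Q + Q'); [exact: zD|rewrite mdD].
by move=> _ c [Q sQ ->]; exists (Q *~ c); [exact: zM|rewrite mdMz].
Qed.
Lemma zlin_sumset C1 C2 : zlin C1 -> zlin C2 -> zlin (sumset C1 C2).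
Proof.
move=> [z0 zD zM] [z0' zD' zM']; split.
- by exists 0, 0; rewrite addr0.
- move=> _ _ [f [f' [Cf Cf' ->]]] [g [g' [Cg Cg' ->]]]; exists (f + g), (f' + g').
  by split; [exact: zD|exact: zD'|rewrite addrACA].
by move=> _ c [f [f' [Cf Cf' ->]]]; exists (f *~ c), (f' *~ c); split; [exact: zM|exact: zM'|rewrite mulrzDl].
Qed.
Lemma zlin_md s C : zlin C -> zlin (fun f => C (md s f)).
Proof.
move=> [z0 zD zM]; split=> [|f g Cf Cg|f c Cf]; first by rewrite md0.
  by rewrite mdD; apply: zD.
by rewrite mdMz; apply: zM.
Qed.
Lemma lsupp_ind C S f : zlin C -> lsupp S f -> (forall e, S e -> C (mono e)) -> C f.
Proof.
by move=> [C0 CD CM] [lf sf] h; apply: laurent_ind => // e /sf/h.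
Qed.
Lemma zlin_sum C I (r : seq I) (p : pred I) (F : I -> series G) : zlin C ->
  (forall i, p i -> C (F i)) -> C (\sum_(i <- r | p i) F i).
Proof. by move=> [C0 CD _] h; apply: big_ind. Qed.
Lemma zlinN C f : zlin C -> C f -> C (- f).
Proof. by move=> [_ _ CM] Cf; have := CM f (-1) Cf; rewrite mulrN1z. Qed.
Lemma zlinB C f g : zlin C -> C f -> C g -> C (f - g).
Proof. by move=> zC Cf Cg; have [_ zD _] := zC; apply: zD => //; apply: zlinN. Qed.
Lemma lsupp_mono (S : expo -> Prop) e : S e -> lsupp S (mono e).
Proof. by move=> Se; split; [exact: laurent_mono|exact: supp_mono]. Qed.
Lemma lsuppW (S S' : expo -> Prop) f : (forall e, S e -> S' e) -> lsupp S f -> lsupp S' f.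
Proof. by move=> SS [lf sf]; split=> //; apply: suppW sf. Qed.

(** Additivity, stated with a difference so as to include 0 and opposites. *)
Definition addfun (phi : expo -> rat) := forall a b, phi (a - b) = phi a - phi b.

Section AddFun.
Variables (phi : expo -> rat) (phiB : addfun phi).
Lemma addfun0 : phi 0 = 0. Proof. by rewrite -(subrr 0) phiB subrr. Qed.
Lemma addfunN a : phi (- a) = - phi a. Proof. by rewrite -sub0r phiB addfun0 sub0r. Qed.
Lemma addfunD a b : phi (a + b) = phi a + phi b.
Proof. by rewrite -[in LHS](opprK b) phiB addfunN opprK. Qed.
Lemma addfunMn a k : phi (a *+ k) = phi a *+ k.
Proof. by elim: k => [|k IH]; rewrite ?mulr0n ?addfun0 // !mulrS addfunD IH. Qed.
Lemma addfun_sum I (r : seq I) (p : pred I) (F : I -> expo) :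
  phi (\sum_(i <- r | p i) F i) = \sum_(i <- r | p i) phi (F i).
Proof. by elim/big_rec2: _ => [|i a b _ <-]; rewrite ?addfun0 ?addfunD. Qed.

Lemma sum_subseq t s : (forall n, n \in s -> 0 <= phi (ofint (v n))) -> subseq t s ->
  0 <= \sum_(n <- t) phi (ofint (v n)) <= \sum_(n <- s) phi (ofint (v n)).
Proof.
move=> vs /subseqP[m _ ->]; elim: s m vs => [|n s IH] [|b m] vs; rewrite ?mask0 ?big_nil ?lexx //=.
  by rewrite big_seq sumr_ge0.
have /andP[h1 h2] := IH m (fun n' n's => vs n' (mem_behead (s := n :: s) n's)).
have h3 := vs n (mem_head _ _).
case: b; rewrite ?big_cons /=.
  by rewrite addr_ge0 // lerD2l.
by rewrite h1 ler_wpDl.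
Qed.

Lemma md_supp_bounds s f e : (forall n, n \in s -> 0 <= phi (ofint (v n))) ->
  md s f e != 0 -> exists2 e0, f e0 != 0 &
    phi e0 <= phi e <= phi e0 + \sum_(n <- s) phi (ofint (v n)).
Proof.
move=> vs /md_supp[t [ts fe]]; exists (e - \sum_(n <- t) ofint (v n)) => //.
have /andP[h1 h2] := sum_subseq vs ts.
rewrite phiB addfun_sum gerBl h1 /= -addrA lerDl addrC subr_ge0 //.
Qed.

Lemma laurent_argmax f : laurent f -> f <> 0 ->
  exists2 e, f e != 0 & forall e', f e' != 0 -> phi e' <= phi e.
Proof.
move=> lf f0; have [e1 fe1] : exists e1, f e1 != 0.
  apply: contrapT => h; apply: f0; apply/funext => e; apply/eqP; apply: contrapT => fe.
  by apply: h; exists e; apply/negP.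
have h (r : seq expo) : forall e1, f e1 != 0 -> exists2 e, f e != 0 & (phi e1 <= phi e) /\ forall e', e' \in r -> f e' != 0 -> phi e' <= phi e.
  elim: r => [|x r IH] y fy; first by exists y.
  have [z fz [yz hz]] := IH y fy.
  have [fx|fx] := eqVneq (f x) 0.
    exists z => //; split=> // e'; rewrite inE => /orP[/eqP ->|/hz//]; by rewrite fx eqxx.
  have [xz|zx] := leP (phi x) (phi z).
    by exists z => //; split=> // e'; rewrite inE => /orP[/eqP ->|/hz].
  exists x => //; split; first exact: le_trans yz (ltW zx).
  move=> e'; rewrite inE => /orP[/eqP ->//|/hz h fe']; apply: le_trans (h fe') (ltW zx).
have /finite_seqP[r er] := lf; have [e fe [_ he]] := h r e1 fe1.
by exists e => // e' fe'; apply: he => //; have : [set e | f e != 0]%classic e' by []; rewrite er.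
Qed.

(** The leading term of the product, with respect to [phi], is up to sign that of
    [f] times [t^{sum of the v_n}]. *)
Lemma leading_bound s f : laurent f -> (forall n, n \in s -> 0 < phi (ofint (v n))) ->
  (forall e, md s f e != 0 -> phi e < \sum_(n <- s) phi (ofint (v n))) ->
  forall e, f e != 0 -> phi e < 0.
Proof.
move=> lf vs hb e0 fe0; have [|e fe me] := laurent_argmax lf.
  by move=> f0; rewrite f0 series0 eqxx in fe0.
apply: le_lt_trans (me _ fe0) _.
suff [h _] : md s f (e + \sum_(n <- s) ofint (v n)) != 0 /\
    forall e', md s f e' != 0 -> phi e' <= phi (e + \sum_(n <- s) ofint (v n)).
  by have := hb _ h; rewrite addfunD addfun_sum gtrDr.
elim: s vs {hb} => [|n s IH] vs; first by rewrite big_nil addr0.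
have [|h1 h2] := IH; first by move=> n' n's; apply: vs; rewrite inE n's orbT.
have vn := vs n (mem_head _ _); rewrite big_cons addrCA.
move: h1 h2; set x := e + _ => h1 h2; split=> /=.
  rewrite /den seriesD seriesN /tmul (addrC (ofint _)) addrK.
  have -> : md s f (x + ofint (v n)) = 0.
    apply/eqP; apply: contraT => /h2; rewrite addfunD gerDl => /le_lt_trans/(_ vn).
    by rewrite ltxx.
  by rewrite sub0r oppr_eq0.
move=> e'; rewrite /den seriesD seriesN /tmul; have [->|/h2 h _] := eqVneq (md s f e') 0.
  by rewrite sub0r oppr_eq0 => /h2; rewrite phiB lerBlDr (addfunD (ofint (v n))) [X in _ -> _ <= X]addrC.
by rewrite addfunD ler_wpDl // ltW.
Qed.

End AddFun.

(** Stands for: [e' - e] is an integral combination of the [v_n], [n] in [s]. *)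
Definition inline s e' e := integral_exp (e' - e) /\
  forall psi, addfun psi -> (forall n, n \in s -> psi (ofint (v n)) = 0) -> psi e' = psi e.

Lemma inline_refl s e : inline s e e.
Proof. by split=> // n; rewrite subrr ffunE. Qed.
Lemma inline_trans s e1 e2 e3 : inline s e1 e2 -> inline s e2 e3 -> inline s e1 e3.
Proof.
move=> [i12 p12] [i23 p23]; split=> [n|psi pB ps]; last by rewrite p12 ?p23.
by have := rpredD (i12 n) (i23 n); rewrite !ffunE addrA subrK.
Qed.
Lemma inlineW s s' e' e : {subset s <= s'} -> inline s e' e -> inline s' e' e.
Proof. by move=> ss [i p]; split=> // psi pB ps; apply: p => // n /ss/ps. Qed.
Lemma inline_sum s t e : subseq t s -> inline s e (e - \sum_(n <- t) ofint (v n)).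
Proof.
move=> ts; split=> [n|psi pB ps].
  rewrite opprB addrC subrK sum_ffunE rpred_sum // => m _.
  by rewrite ffunE intr_int.
rewrite pB addfun_sum // big1_seq ?subr0 // => n /andP[_ nt]; apply: ps.
exact: mem_subseq ts _ nt.
Qed.
Lemma inline_mul n e (k : nat) : inline [:: n] (e + ofint (v n) *+ k) e /\
  inline [:: n] (e - ofint (v n) *+ k) e.
Proof.
have h (m : node G) : (ofint (v n) *+ k) m \is a Num.int.
  by rewrite ffunMnE rpredMn // ffunE intr_int.
split; split=> [m|psi pB /(_ n (mem_head _ _)) p0].
- by rewrite addrC addKr h.
- by rewrite addfunD // addfunMn // p0 mul0rn addr0.
- by rewrite addrC addKr ffunE rpredN h.
by rewrite pB addfunMn // p0 mul0rn subr0.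
Qed.

Section Division.
Variables (phi : expo -> rat) (phiB : addfun phi).

(** Division of [t^e] subtracts the [v_n] from [e] as long as the degree is
    nonnegative, or adds them as long as it is negative. *)
Definition quo_supp s e e' := [/\ inline s e' e, 0 <= phi e -> 0 <= phi e'
  & phi e < 0 -> phi e <= phi e' < 0].
Definition rem_supp s e e' := inline s e' e /\
  0 <= phi e' < \sum_(n <- s) phi (ofint (v n)).

(** Telescoping. *)
Lemma den_geometric n e k :
  mono e = den n (- \sum_(i < k) mono (e - ofint (v n) *+ i.+1)) + mono (e - ofint (v n) *+ k).
Proof.
elim: k => [|k IH]; first by rewrite big_ord0 oppr0 -[den n 0]/(md [:: n] 0) md0 add0r mulr0n subr0.
rewrite big_ord_recr opprD denD -addrA.
have -> : den n (- mono (e - ofint (v n) *+ k.+1)) + mono (e - ofint (v n) *+ k.+1) = mono (e - ofint (v n) *+ k).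
  by rewrite denN /den tmul_mono opprB subrK mulrS opprD addrCA addNKr.
exact: IH.
Qed.

(** Translating by multiples of [v_n] brings the degree into [0, phi(v_n)); the
    quotient is a geometric sum, with a sign according to the direction. *)
Lemma divide1 n e : 0 < phi (ofint (v n)) ->
  sumset (img (md [:: n]) (quo_supp [:: n] e)) (lsupp (rem_supp [:: n] e)) (mono e).
Proof.
move=> vn; suff [Q [r [lQ lr eQ]]] : exists Q r,
    [/\ lsupp (quo_supp [:: n] e) Q, lsupp (rem_supp [:: n] e) r & mono e = den n Q + r].
  by exists (den n Q), r; split=> //; exists Q.
set d := phi _ in vn; pose k := Num.floor (phi e / d).
have /andP[k1 k2] : k%:~R * d <= phi e < (k + 1)%:~R * d.
  by rewrite -ler_pdivlMr // -ltr_pdivrMr // floor_itv.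
have psiM i : phi (e - ofint (v n) *+ i) = phi e - i%:R * d by rewrite phiB addfunMn // mulr_natl.
have psiM' i : phi (e + ofint (v n) *+ i) = phi e + i%:R * d by rewrite addfunD // addfunMn // mulr_natl.
have lsum m (F : 'I_m -> expo) S : (forall i, S (F i)) -> lsupp S (\sum_(i < m) mono (F i)).
  by move=> h; apply: zlin_sum => [|i _]; [exact: zlin_lsupp|exact: lsupp_mono].
case: k k1 k2 => k k1 k2.
  have e0 : 0 <= phi e by apply: le_trans k1; rewrite mulr_ge0 ?ler0n // ltW.
  exists (- \sum_(i < k) mono (e - ofint (v n) *+ i.+1)), (mono (e - ofint (v n) *+ k)).
  split; last exact: den_geometric.
    apply: zlinN; first exact: zlin_lsupp.
    apply: lsum => i; split; [by case: (inline_mul n e i.+1)| |by rewrite ltNge e0].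
    move=> _; rewrite psiM subr_ge0; apply: le_trans k1.
    by rewrite ler_pM2r // pmulrn ler_nat.
  apply: lsupp_mono; split; first by case: (inline_mul n e k).
  rewrite big_seq1 psiM -/d pmulrn subr_ge0 k1 /= ltrBlDl.
  by move: k2; rewrite rmorphD /= mulrDl mul1r addrC.
have e0 : phi e < 0.
  apply: lt_le_trans k2 _; apply: mulr_le0_ge0; last exact: ltW.
  rewrite lerz0; lia.
have kE : (Negz k + 1)%:~R = - k%:R :> rat by rewrite NegzE -addn1 PoszD opprD addrK rmorphN.
exists (\sum_(i < k.+1) mono (e + ofint (v n) *+ i)), (mono (e + ofint (v n) *+ k.+1)).
split; last first.
- have := den_geometric n (e + ofint (v n) *+ k.+1) k.+1; rewrite addrK => h.
  have h2 : \sum_(i < k.+1) mono (e + ofint (v n) *+ k.+1 - ofint (v n) *+ i.+1) = \sum_(i < k.+1) mono (e + ofint (v n) *+ i).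
    rewrite (reindex_inj rev_ord_inj); apply: eq_bigr => i _; congr mono.
    by rewrite /= subSS -addrA -mulrnBr ?ltnS ?leq_subr // subSS subKn // -ltnS.
  by rewrite h h2 denN; rewrite addrA subrr add0r.
- apply: lsupp_mono; split; first by case: (inline_mul n e k.+1).
  rewrite big_seq1 psiM' -/d; move: k1 k2; rewrite kE NegzE rmorphN /= -pmulrn -addn1 natrD; lra.
apply: lsum => i; split; [by case: (inline_mul n e i)|by rewrite leNgt e0|].
move=> _; rewrite psiM'; have i1 : (i%:R : rat) <= k%:R by rewrite ler_nat -ltnS.
have i2 : (0 : rat) <= i%:R by rewrite ler0n.
have : i%:R * d <= k%:R * d by rewrite ler_pM2r.
have : 0 <= i%:R * d by rewrite mulr_ge0 // ltW.
move: k2; rewrite kE; lra.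
Qed.

Lemma quo_supp_trans s e1 e2 e3 : quo_supp s e2 e1 -> quo_supp s e3 e2 -> quo_supp s e3 e1.
Proof.
move=> [i12 p12 n12] [i23 p23 n23]; split; first exact: inline_trans i12 i23.
  by move=> /p23/p12.
by move=> h; have /andP[h1 h2] := n23 h; have /andP[h3 ->] := n12 h2; rewrite andbT (le_trans h1).
Qed.

Lemma quo_suppW s s' e e' : {subset s <= s'} -> quo_supp s e e' -> quo_supp s' e e'.
Proof. by move=> ss [i p n]; split=> //; apply: inlineW i. Qed.

Lemma lsupp_md s (S S' : expo -> Prop) f : lsupp S f ->
  (forall e t, S e -> subseq t s -> S' (e + \sum_(n <- t) ofint (v n))) ->
  lsupp S' (md s f).
Proof.
move=> [lf sf] h; split=> [|e /md_supp[t [ts /sf fe]]]; first exact: laurent_md.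
by have := h _ _ fe ts; rewrite subrK.
Qed.

(** One factor at a time: both the quotient and the remainder by the first
    factors are divided by the next one, and the remainders so obtained are multiplied
    by the factors that were used already. *)
Lemma divide s e : (forall n, n \in s -> 0 < phi (ofint (v n))) ->
  sumset (img (md s) (quo_supp s e)) (lsupp (rem_supp s e)) (mono e).
Proof.
elim: s => [|n s IH] vs.
  exists (mono e), 0; split; last by rewrite addr0.
    exists (mono e) => //; apply: lsupp_mono; split; [exact: inline_refl|by []|].
    by move=> ->; rewrite lexx.
  by case: (zlin_lsupp (rem_supp [::] e)).
have [|_ [r [[Q lQ ->] lr eQ]]] := IH; first by move=> m ms; apply: vs; rewrite inE ms orbT.
have vn := vs n (mem_head _ _).
have ss : {subset s <= n :: s} by move=> m ms; rewrite inE ms orbT.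
have sn : {subset [:: n] <= n :: s} by move=> m; rewrite !inE => /eqP ->; rewrite eqxx.
have vs0 m : m \in s -> 0 <= phi (ofint (v m)) by move=> ms; apply/ltW/vs/ss.
have zC := zlin_sumset (zlin_img (n :: s) (quo_supp (n :: s) e)) (zlin_lsupp (rem_supp (n :: s) e)).
have [_ zD _] := zC; rewrite eQ; apply: zD; last first.
  exists 0, r; split; [by case: (zlin_img (n :: s) (quo_supp (n :: s) e))| |by rewrite add0r].
  apply: lsuppW lr => e' [i /andP[h1 h2]]; split; first exact: inlineW i.
  by rewrite h1 big_cons /= ltr_wpDl // ltW.
apply: (lsupp_ind (zlin_md s zC) lQ) => e1 q1.
have [_ [r1 [[Q1 lQ1 ->] lr1 ->]]] := divide1 e1 vn.
exists (md s (md [:: n] Q1)), (md s r1); split; last exact: mdD.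
  exists Q1; last by rewrite mdC.
  apply: lsuppW lQ1 => e2 /(quo_suppW sn) q2; apply: quo_supp_trans q2 _.
  exact: quo_suppW q1.
apply: (lsupp_md lr1) => e2 t [i2 /andP[h1 h2]] ts.
have /andP[t0 t1] := sum_subseq vs0 ts.
split.
  apply: (@inline_trans _ _ e2); last by apply: inline_trans (inlineW sn i2) _; case: q1 => /(inlineW ss).
  have := inline_sum (e2 + \sum_(n <- t) ofint (v n)) ts; rewrite addrK.
  by move=> /(inlineW ss).
rewrite addfunD // addfun_sum // addr_ge0 //= big_cons.
by rewrite big_seq1 in h2; rewrite ltr_leD.
Qed.

End Division.

(** * Division along the two rays of a chain *)

(** Decompositions along a chain. On the vectors [v_n], [n] in [sA], the function
    [g2] vanishes, and on those with [n] in [sB] the function [g1] does; [g1] and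
    [g2] are the coordinates of a point of the plane in the two rays spanned by
    these vectors, [X] and [Y] its usual coordinates. *)
Section Chain.
Variables (X Y g1 g2 : expo -> rat).
Hypotheses (XB : addfun X) (YB : addfun Y) (g1B : addfun g1) (g2B : addfun g2).
Variables (a b c d : rat).
Hypotheses (a0 : 0 < a) (b0 : 0 < b) (c0 : 0 < c) (d0 : 0 < d).
Hypotheses (XE : forall e, X e = a * g1 e + b * g2 e) (YE : forall e, Y e = c * g1 e + d * g2 e).
Variables (sA sB : seq (node G)).
Hypotheses (A1 : forall n, n \in sA -> 0 < g1 (ofint (v n))) (A2 : forall n, n \in sA -> g2 (ofint (v n)) = 0).
Hypotheses (B1 : forall n, n \in sB -> g1 (ofint (v n)) = 0) (B2 : forall n, n \in sB -> 0 < g2 (ofint (v n))).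

Variables (e0 : expo) (y1 y2 : rat).
Hypotheses (y10 : y1 <= 0) (y20 : y2 <= 0).

Let tot phi s : rat := \sum_(n <- s) phi (ofint (v n)).

Definition pol_supp e := (0 <= X e \/ 0 <= Y e) /\ integral_exp (e - e0).
Definition strip1_supp e := [/\ 0 <= Y e < tot Y sA, y2 <= g2 e & integral_exp (e - e0)].
Definition strip2_supp e := [/\ 0 <= X e < tot X sB, y1 <= g1 e & integral_exp (e - e0)].
Definition box_supp e := [/\ 0 <= g1 e < tot g1 sA, 0 <= g2 e < tot g2 sB & integral_exp (e - e0)].

Definition chain_dec := sumset (img (md (sA ++ sB)) pol_supp)
  (sumset (img (md sB) strip1_supp) (sumset (img (md sA) strip2_supp) (lsupp box_supp))).

Lemma zlin_chain_dec : zlin chain_dec.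
Proof. by do 3! [apply: zlin_sumset; first exact: zlin_img]; apply: zlin_lsupp. Qed.

Lemma chain_dec_pol Q : lsupp pol_supp Q -> chain_dec (md (sA ++ sB) Q).
Proof.
move=> lQ; exists (md (sA ++ sB) Q), 0; split; [by exists Q| |by rewrite addr0].
by case: (zlin_sumset (zlin_img sB strip1_supp) (zlin_sumset (zlin_img sA strip2_supp) (zlin_lsupp box_supp))).
Qed.
Lemma chain_dec_strip1 Q : lsupp strip1_supp Q -> chain_dec (md sB Q).
Proof.
move=> lQ; exists 0, (md sB Q); split; [by case: (zlin_img (sA ++ sB) pol_supp)| |by rewrite add0r].
exists (md sB Q), 0; split; [by exists Q| |by rewrite addr0].
by case: (zlin_sumset (zlin_img sA strip2_supp) (zlin_lsupp box_supp)).
Qed.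
Lemma chain_dec_strip2 Q : lsupp strip2_supp Q -> chain_dec (md sA Q).
Proof.
move=> lQ; exists 0, (md sA Q); split; [by case: (zlin_img (sA ++ sB) pol_supp)| |by rewrite add0r].
exists 0, (md sA Q); split; [by case: (zlin_img sB strip1_supp)| |by rewrite add0r].
by exists (md sA Q), 0; split; [by exists Q|by case: (zlin_lsupp box_supp)|by rewrite addr0].
Qed.
Lemma chain_dec_box Q : lsupp box_supp Q -> chain_dec Q.
Proof.
move=> lQ; exists 0, Q; split; [by case: (zlin_img (sA ++ sB) pol_supp)| |by rewrite add0r].
exists 0, Q; split; [by case: (zlin_img sB strip1_supp)| |by rewrite add0r].
by exists 0, Q; split; [by case: (zlin_img sA strip2_supp)|by []|by rewrite add0r].
Qed.

Lemma YA n : n \in sA -> 0 < Y (ofint (v n)).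
Proof. by move=> nA; rewrite YE A2 // mulr0 addr0 mulr_gt0 ?A1. Qed.
Lemma XB' n : n \in sB -> 0 < X (ofint (v n)).
Proof. by move=> nB; rewrite XE B1 // mulr0 add0r mulr_gt0 ?B2. Qed.

Lemma inline_integral s e' e : inline s e' e -> integral_exp (e - e0) -> integral_exp (e' - e0).
Proof. by move=> [i _] j n; have := rpredD (i n) (j n); rewrite !ffunE addrA subrK. Qed.

Lemma chain_dec_mdB e : 0 <= Y e -> y2 <= g2 e -> integral_exp (e - e0) -> chain_dec (md sB (mono e)).
Proof.
move=> Ye ge ie; have [_ [r [[Q lQ ->] lr ->]]] := divide YB e YA.
rewrite mdD (mdC sB sA) -md_cat; have [_ zD _] := zlin_chain_dec; apply: zD.
  apply: chain_dec_pol; apply: lsuppW lQ => e' [i p _]; split; first by right; apply: p.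
  exact: inline_integral i ie.
apply: chain_dec_strip1; apply: lsuppW lr => e' [i h]; split=> //; last exact: inline_integral i ie.
by case: i => _ /(_ g2 g2B A2) ->.
Qed.

Lemma chain_dec_mdA e : 0 <= X e -> y1 <= g1 e -> integral_exp (e - e0) -> chain_dec (md sA (mono e)).
Proof.
move=> Xe ge ie; have [_ [r [[Q lQ ->] lr ->]]] := divide XB e XB'.
rewrite mdD -md_cat; have [_ zD _] := zlin_chain_dec; apply: zD.
  apply: chain_dec_pol; apply: lsuppW lQ => e' [i p _]; split; first by left; apply: p.
  exact: inline_integral i ie.
apply: chain_dec_strip2; apply: lsuppW lr => e' [i h]; split=> //; last exact: inline_integral i ie.
by case: i => _ /(_ g1 g1B B1) ->.
Qed.

(** Inside the cone: divide along both rays. *)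
Lemma chain_dec_cone e : 0 <= g1 e -> 0 <= g2 e -> integral_exp (e - e0) -> chain_dec (mono e).
Proof.
move=> h1 h2 ie; have [_ [r [[Q lQ ->] lr ->]]] := divide g1B e A1.
have [_ zD _] := zlin_chain_dec; apply: (zD).
  apply: (lsupp_ind (zlin_md sA zlin_chain_dec) lQ) => e' [i p _].
  have g2e : g2 e' = g2 e by case: i => _; apply.
  apply: chain_dec_mdA; last exact: inline_integral i ie.
    by rewrite XE g2e addr_ge0 // mulr_ge0 ?p // ltW.
  by apply: le_trans y10 _; apply: p.
apply: (lsupp_ind zlin_chain_dec lr) => e' [i /andP[p p']].
have g2e : g2 e' = g2 e by case: i => _; apply.
have ie' := inline_integral i ie.
have [_ [r' [[Q' lQ' ->] lr' ->]]] := divide g2B e' B2.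
apply: zD.
  apply: (lsupp_ind (zlin_md sB zlin_chain_dec) lQ') => e'' [i' q _].
  have g1e : g1 e'' = g1 e' by case: i' => _; apply.
  have q' : 0 <= g2 e'' by apply: q; rewrite g2e.
  apply: chain_dec_mdB; last exact: inline_integral i' ie'.
    by rewrite YE g1e addr_ge0 // mulr_ge0 // ltW.
  exact: le_trans y20 q'.
apply: chain_dec_box; apply: lsuppW lr' => e'' [i' q].
have g1e : g1 e'' = g1 e' by case: i' => _; apply.
by split=> //; [rewrite g1e p|exact: inline_integral i' ie'].
Qed.

(** Slightly outside of the cone, but still in the quadrant, a division along the
    nearer ray leads back into it; its quotient stays in the strip of this ray. *)
Lemma chain_dec_quadrant e : 0 <= X e -> 0 <= Y e -> y1 <= g1 e -> y2 <= g2 e ->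
  integral_exp (e - e0) -> chain_dec (mono e).
Proof.
move=> Xe Ye h1 h2 ie; have [_ zD _] := zlin_chain_dec.
have [g1e|g1e] := leP 0 (g1 e); have [g2e|g2e] := leP 0 (g2 e).
- exact: chain_dec_cone.
- have [_ [r [[Q lQ ->] lr ->]]] := divide g2B e B2; apply: zD.
    apply: (lsupp_ind (zlin_md sB zlin_chain_dec) lQ) => e' [i _ /(_ g2e)/andP[p _]].
    have ge : g1 e' = g1 e by case: i => _; apply.
    apply: chain_dec_mdB; last exact: inline_integral i ie.
      by apply: le_trans Ye _; rewrite !YE ge lerD2l ler_pM2l.
    exact: le_trans p.
  apply: (lsupp_ind zlin_chain_dec lr) => e' [i /andP[p _]].
  have ge : g1 e' = g1 e by case: i => _; apply.
  by apply: chain_dec_cone; rewrite ?ge //; apply: inline_integral i ie.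
- have [_ [r [[Q lQ ->] lr ->]]] := divide g1B e A1; apply: zD.
    apply: (lsupp_ind (zlin_md sA zlin_chain_dec) lQ) => e' [i _ /(_ g1e)/andP[p _]].
    have ge : g2 e' = g2 e by case: i => _; apply.
    apply: chain_dec_mdA; last exact: inline_integral i ie.
      by apply: le_trans Xe _; rewrite !XE ge lerD2r ler_pM2l.
    exact: le_trans p.
  apply: (lsupp_ind zlin_chain_dec lr) => e' [i /andP[p _]].
  have ge : g2 e' = g2 e by case: i => _; apply.
  by apply: chain_dec_cone; rewrite ?ge //; apply: inline_integral i ie.
have h3 : a * g1 e < 0 by rewrite pmulr_rlt0.
have h4 : b * g2 e < 0 by rewrite pmulr_rlt0.
by move: Xe; rewrite XE; lra.
Qed.

End Chain.

(** Uniqueness of polynomial parts: the leading terms, for each of the two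
    coordinates, of the remainders are too small to be cancelled. *)
Lemma chain_dec_unique (X Y : expo -> rat) (sA sB : seq (node G)) P R1 R2 R0 :
  addfun X -> addfun Y ->
  (forall n, 0 < X (ofint (v n))) -> (forall n, 0 < Y (ofint (v n))) ->
  lsupp (fun e => 0 <= X e \/ 0 <= Y e) P ->
  let tot phi s := \sum_(n <- s) phi (ofint (v n)) in
  supp_in (fun e => X e < tot X sA /\ Y e < tot Y sA) R1 ->
  supp_in (fun e => X e < tot X sB /\ Y e < tot Y sB) R2 ->
  supp_in (fun e => X e < tot X (sA ++ sB) /\ Y e < tot Y (sA ++ sB)) R0 ->
  md (sA ++ sB) P + md sB R1 + md sA R2 + R0 = 0 -> P = 0.
Proof.
move=> XB YB vX vY [lP sP] tot s1 s2 s0 e.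
have eP : md (sA ++ sB) P = - (md sB R1 + md sA R2 + R0) by apply/eqP; rewrite -addr_eq0 !addrA e.
have key (phi : expo -> rat) : addfun phi -> (forall n, 0 < phi (ofint (v n))) ->
    supp_in (fun e => phi e < tot phi sA) R1 -> supp_in (fun e => phi e < tot phi sB) R2 ->
    supp_in (fun e => phi e < tot phi (sA ++ sB)) R0 -> forall e, P e != 0 -> phi e < 0.
  move=> pB vp t1 t2 t0; apply: (leading_bound pB lP (s := sA ++ sB)) => // x.
  rewrite eP; apply: (suppN (S := fun x => phi x < tot phi (sA ++ sB))).
  have vp' s n : n \in s -> 0 <= phi (ofint (v n)) by move=> _; apply: ltW.
  apply: suppD => //; apply: suppD => y.
    move=> /(md_supp_bounds pB (@vp' sB))[z /t1 z1 /andP[_ yz]].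
    by apply: le_lt_trans yz _; rewrite /tot big_cat /= ltrD2r.
  move=> /(md_supp_bounds pB (@vp' sA))[z /t2 z1 /andP[_ yz]].
  by apply: le_lt_trans yz _; rewrite /tot big_cat /= [X in _ < X]addrC ltrD2r.
apply/funext => x; apply/eqP; apply: contraT => Px; rewrite series0 in Px.
have hX : X x < 0 by apply: (key X) => //; [move=> y /s1[]|move=> y /s2[]|move=> y /s0[]].
have hY : Y x < 0 by apply: (key Y) => //; [move=> y /s1[]|move=> y /s2[]|move=> y /s0[]].
by case: (sP _ Px); rewrite leNgt ?hX ?hY.
Qed.

Lemma node_dec_unique (X : expo -> rat) (s : seq (node G)) P R :
  addfun X -> (forall n, 0 < X (ofint (v n))) -> laurent P ->
  supp_in (fun e => 0 <= X e < \sum_(n <- s) X (ofint (v n))) R ->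
  md s P + R = 0 -> P = 0.
Proof.
move=> XB vX lP sR e; have eP : md s P = - R by apply/eqP; rewrite -addr_eq0 e.
have up := leading_bound XB lP (fun n _ => vX n) (s := s).
have {}up x : P x != 0 -> X x < 0.
  by apply: up => y; rewrite eP seriesN oppr_eq0 => /sR /andP[].
apply: contrapT => P0; have [x Px hx] := laurent_argmax (fun x => - X x) lP P0.
have {}hx y : P y != 0 -> X x <= X y by move=> /hx; rewrite lerN2.
have [h _] : md s P x != 0 /\ forall y, md s P y != 0 -> X x <= X y.
  elim: s {sR e eP up} => [|n s [h1 h2]] //=; rewrite /den; split=> [|y]; rewrite seriesD seriesN /tmul.
    have -> : md s P (x - ofint (v n)) = 0; last by rewrite subr0.
    apply/eqP; apply: contraT => /h2; rewrite XB => h; have := vX n; lra.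
  have [->|/h2 //] := eqVneq (md s P y) 0.
  rewrite sub0r oppr_eq0 => /h2; rewrite XB => h; have := vX n; lra.
move: h; rewrite eP seriesN oppr_eq0 => /sR /andP[+ _].
by rewrite leNgt up.
Qed.

End Series.

(** * Admissible vectors *)

Section Admissible.
Variables (R : realType) (G : plumbing) (ord : rel (node G)) (a : redlift G).
Variable v : node G -> {ffun node G -> int}.
Hypothesis treeG : is_tree G.
Hypothesis negG : negative_definite G.
Hypothesis ordG : orientation ord.
Variable n0 : node G.
Hypothesis adm : forall k, krange G k -> admissible R ord v (lift_sub a k) 1.
Implicit Types (n m : node G) (l : {ffun node G -> int}) (k : {ffun node G -> nat}).
Implicit Types (I J : {set node G}).

Lemma ofintD l l' : ofint (l + l') = ofint l + ofint l' :> {ffun node G -> rat}.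
Proof. by apply/ffunP => n; rewrite !ffunE rmorphD. Qed.
Lemma ofintB l l' : ofint (l - l') = ofint l - ofint l' :> {ffun node G -> rat}.
Proof. by apply/ffunP => n; rewrite !ffunE rmorphB. Qed.
Lemma ofint_inj : injective (@ofint G).
Proof. by move=> l l' /ffunP e; apply/ffunP => n; have := e n; rewrite !ffunE => /intr_inj. Qed.

Lemma orbB (y1 y2 : {ffun node G -> rat}) n : orb (y1 - y2) n = orb y1 n - orb y2 n.
Proof. by apply: (addIr (orb y2 n)); rewrite -orbD !subrK. Qed.

Lemma orb_sum (T : Type) (r : seq T) (P : pred T) (F : T -> {ffun node G -> rat}) n :
  orb (\sum_(i <- r | P i) F i) n = \sum_(i <- r | P i) orb (F i) n.
Proof.
have o0 : orb (0 : {ffun node G -> rat}) n = 0 by rewrite -(subrr 0) orbB subrr.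
by elim/big_rec2: _ => [|i x y _ <-] //; rewrite orbD.
Qed.

Lemma orb_lin (y : {ffun node G -> rat}) n :
  orb y n = \sum_m y m * orb [ffun p => (p == m)%:R] n.
Proof.
rewrite {1}(_ : y = \sum_m [ffun p => y m * [ffun p => (p == m)%:R : rat] p]); last first.
  apply/ffunP => p; rewrite sum_ffunE (bigD1 p) //= !ffunE eqxx mulr1.
  by rewrite big1 ?addr0 // => m mp; rewrite !ffunE eq_sym (negPf mp) mulr0.
by rewrite orb_sum; apply: eq_bigr => m _; rewrite orb_scale.
Qed.

Lemma Nval_sub k l n : Nval ord (lift_sub a k) l n = Nval ord a l n - (k n)%:R.
Proof. by rewrite /Nval /lift_sub /= ffunE rmorphB /legquot /= -pmulrn; ring. Qed.

Lemma Nbar_sub k l n : Nbar ord (lift_sub a k) l n = Nbar ord a l n - (k n)%:R.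
Proof. by rewrite /Nbar Nval_sub /legquot /=; ring. Qed.

Lemma ZN_sub k l : ZN ord (lift_sub a k) l = ZN ord a l. Proof. by []. Qed.

Lemma NbarD b l l' n : Nbar ord b (l + l') n = Nbar ord b l n + orb (ofint l') n.
Proof. by rewrite !Nbar_orb // ofintD !orbD; ring. Qed.

Lemma ZND b l l' : ZN ord b l -> ZN ord (redlift0 G) l' -> ZN ord b (l + l').
Proof.
move=> lZ lZ' n m nm; have /eqP := lZ n m nm; have /eqP := lZ' n m nm.
rewrite !eqz_mod_dvd /= subr0 => h h'; apply/eqP; rewrite eqz_mod_dvd.
rewrite (_ : _ - _ = (l n + omega m n * l m - cC b n m) + (l' n + omega m n * l' m)).
  exact: rpredD.
by rewrite !ffunE; ring.
Qed.

Lemma ZNB b l l' : ZN ord b l -> ZN ord (redlift0 G) l' -> ZN ord b (l - l').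
Proof.
move=> lZ lZ' n m nm; have /eqP := lZ n m nm; have /eqP := lZ' n m nm.
rewrite !eqz_mod_dvd /= subr0 => h h'; apply/eqP; rewrite eqz_mod_dvd.
rewrite (_ : _ - _ = (l n + omega m n * l m - cC b n m) - (l' n + omega m n * l' m)).
  exact: rpredB.
by rewrite !ffunE; ring.
Qed.

Lemma Nval_le_Nbar b l n : Nval ord b l n <= Nbar ord b l n.
Proof. by rewrite lerDl sumr_ge0 // => u _; rewrite subr_ge0 floor_le. Qed.

Lemma Nbar_le_Nval b l n : Nbar ord b l n <= Nval ord b l n + #|[pred u | leg n u]|%:R.
Proof.
rewrite lerD2l -sum1_card natr_sum; apply: ler_sum => u _.
by have := floorD1_gt (legquot b l n u); rewrite intrD; lra.
Qed.

Let k0 : {ffun node G -> nat} := [ffun=> 0%N].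
Lemma krange0 : krange G k0.
Proof. by move=> n; rewrite ffunE. Qed.

Lemma v_ZN n : ZN ord (redlift0 G) (v n).
Proof. by have [/(_ n)[]] := adm krange0. Qed.

Lemma orb_v_ge0 n m : 0 <= orb (ofint (v n)) m.
Proof.
have [/(_ n)[_ /(_ m) h] _ _] := adm krange0; apply: le_trans h _.
apply: le_trans (Nval_le_Nbar _ _ _) _; rewrite Nbar_orb // orbD orb_cvec //=.
rewrite !big1 => [|u _|p _|p _]; rewrite ?ffunE ?mulr0 ?mul0r //.
by rewrite !addr0.
Qed.

Lemma orb_real_comb (c : node G -> R) (y : {ffun node G -> rat}) n :
  (forall m, ratr (y m) = \sum_p c p * (v p m)%:~R) ->
  ratr (orb y n) = \sum_p c p * ratr (orb (ofint (v p)) n).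
Proof.
move=> e; rewrite orb_lin rmorph_sum /=.
under [RHS]eq_bigr do rewrite orb_lin rmorph_sum mulr_sumr /=.
rewrite exchange_big /=; apply: eq_bigr => m _.
rewrite [in LHS]rmorphM /= e mulr_suml; apply: eq_bigr => p _.
by rewrite /ofint [X in X * orb _ _]ffunE [in RHS]rmorphM /= ratr_int -mulrA.
Qed.

(** The restriction of [E_n^*] to the nodes lies in the cone of the [v_m]. *)
Lemma orb_v_cone n : exists2 c : node G -> R, (forall m, 0 <= c m) &
  \sum_m c m * ratr (orb (ofint (v m)) n) = 1.
Proof.
have [_ cE _] := adm krange0.
have : @Corb R G [ffun m : node G => ratr (Estar (val n) (val m))].
  exists [ffun t => ratr (Estar (val n) t)]; last by apply/ffunP => m; rewrite !ffunE.
  move=> w; have -> : pairing [ffun t => ratr (Estar (val n) t)] (E_ R w) =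
      ratr (pairing (Estar (val n)) (E_ rat w)).
    rewrite !pairingE // rmorphD rmorphM rmorph_int rmorph_sum /= ffunE; congr (_ + _).
    by apply: eq_bigr => t _; rewrite ffunE.
  have := dcoef_Estar treeG negG (val n) w; rewrite /dcoef => /eqP; rewrite eqr_oppLR => /eqP ->.
  by rewrite lerq0 oppr_le0 ler0n.
rewrite -cE => -[c c0 e]; exists c => //.
have -> : 1 = ratr (orb (resN (Estar (val n))) n) :> R by rewrite (orb_Estar treeG negG ordG) eqxx rmorph1.
apply/esym/orb_real_comb => m; have := e m; rewrite ffunE => <-.
by rewrite ffunE.
Qed.

Lemma orb_v_pos_ex n : exists m, 0 < orb (ofint (v m)) n.
Proof.
have [c c0 e] := orb_v_cone n; apply: contrapT => h.
have : (1 : R) <> 0 by apply/eqP; apply: oner_neq0.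
apply; rewrite -e big1 // => m _; rewrite (_ : orb _ _ = 0) ?rmorph0 ?mulr0 //.
apply/eqP; apply: contraT => hm; case: h; exists m.
by rewrite lt_neqAle eq_sym hm orb_v_ge0.
Qed.

Lemma ofintMn l (t : nat) : ofint (l *+ t) = ofint l *+ t :> {ffun node G -> rat}.
Proof. by apply/ffunP => n; rewrite ffunMnE !ffunE ffunMnE rmorphMn. Qed.

Lemma orbMn (y : {ffun node G -> rat}) t n : orb (y *+ t) n = orb y n *+ t.
Proof.
elim: t => [|t IH]; last by rewrite !mulrS orbD IH.
by rewrite !mulr0n -(subrr 0) orbB subrr.
Qed.

(** Some positive combination of the [v_m] is positive under [orb], and adding
    large multiples of it to a point of [ZN ord a] reaches [inMbar]. *)
Lemma Mbar_nonempty : exists l, inMbar ord (lift_sub a k0) l.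
Proof.
have [l0 lZ] := ZN_nonempty treeG negG ordG n0 a.
pose z := \sum_m v m.
have zZ : ZN ord (redlift0 G) z.
  apply: big_ind => [n m _|x y|m _]; last exact: v_ZN.
    by rewrite !ffunE mulr0 addr0.
  exact: ZND.
have z0 n : 0 < orb (ofint z) n.
  have -> : ofint z = \sum_m ofint (v m).
    by apply/ffunP => p; rewrite ffunE sum_ffunE rmorph_sum sum_ffunE; apply: eq_bigr => m _; rewrite ffunE.
  rewrite orb_sum; have [m hm] := orb_v_pos_ex n.
  by rewrite (bigD1 m) //= ltr_pwDl // sumr_ge0 // => p _; apply: orb_v_ge0.
pose t n := (Num.truncn (- Nbar ord a l0 n / orb (ofint z) n)).+1.
exists (l0 + z *+ (\sum_n t n)); split.
  rewrite ZN_sub; apply: ZND => //.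
  elim: (\sum_n _) => [|s IH]; last by rewrite mulrS; apply: ZND.
  by move=> n m _; rewrite mulr0n !ffunE mulr0 addr0.
move=> n; rewrite Nbar_sub ffunE subr0 NbarD ofintMn orbMn.
have h : - Nbar ord a l0 n / orb (ofint z) n <= (\sum_n t n)%:R.
  apply: (@le_trans _ _ (t n)%:R); last by rewrite ler_nat (bigD1 n) //= leq_addr.
  exact/ltW/truncnS_gt.
by move: h; rewrite ler_pdivrMr // mulr_natl; lra.
Qed.

Lemma Mbar_v k l n : inMbar ord (lift_sub a k) l -> inMbar ord (lift_sub a k) (l + v n).
Proof.
move=> [lZ lN]; split; first by apply: ZND => //; apply: v_ZN.
by move=> m; rewrite NbarD addr_ge0 // orb_v_ge0.
Qed.

(** Adding multiples of [v_n] does not change [N] at the other nodes, whereas it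
    adds multiples of [orb v_n] to [Nbar], which differs from [N] by a bounded
    amount. Hence [v_n] is on the ray of [E_n^*]. *)
Lemma orb_v_off n m : m != n -> orb (ofint (v n)) m = 0.
Proof.
move=> mn; have [l lM] := Mbar_nonempty; set b := lift_sub a k0 in lM.
have [_ _ sh] := adm krange0.
have lt (t : nat) : inMbar ord b (l + v n *+ t) /\ Nval ord b (l + v n *+ t) m = Nval ord b l m.
  elim: t => [|t [IM IN]]; first by rewrite mulr0n addr0.
  rewrite mulrSr addrA; split; first exact: Mbar_v.
  by have [sh1 _] := sh _ n IM; rewrite sh1.
apply/eqP; apply: contraT => o0.
have o1 : 0 < orb (ofint (v n)) m by rewrite lt_neqAle eq_sym o0 orb_v_ge0.
pose B : rat := #|[pred u | leg m u]|%:R.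
(* After [t] translations the growth of [Nbar] exceeds its distance from [N]. *)
pose t := (Num.truncn (B / orb (ofint (v n)) m)).+1.
have h1 : B < t%:R * orb (ofint (v n)) m by rewrite -ltr_pdivrMr // truncnS_gt.
have [_ e] := lt t; have := Nbar_le_Nval b (l + v n *+ t) m.
rewrite e NbarD ofintMn orbMn -mulr_natl -/B => h2.
have := Nval_le_Nbar b l m; lra.
Qed.

Definition vpos n : rat := orb (ofint (v n)) n.

Lemma vpos_gt0 n : 0 < vpos n.
Proof.
have [m hm] := orb_v_pos_ex n; have [e|mn] := eqVneq m n; first by rewrite /vpos -e in hm *.
by rewrite orb_v_off 1?eq_sym // in hm.
Qed.

Lemma orb_v n m : orb (ofint (v n)) m = if m == n then vpos n else 0.
Proof. by case: eqVneq => [->//|mn]; apply: orb_v_off. Qed.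

(** The projection to the nodes is determined by its image under [orb]. *)
Lemma v_Estar n m : (v n m)%:Q = vpos n * Estar (val n) (val m).
Proof.
have := orb_expansion treeG negG ordG (ofint (v n)) m; rewrite ffunE => ->.
rewrite (bigD1 n) //= big1 ?addr0 // => p pn.
by rewrite orb_v_off // mul0r.
Qed.

(** * The cells of the reduced lattice *)

Definition cell k I l := [/\ inMbar ord (lift_sub a k) l,
  forall n, n \in hatN G -> Nval ord a l n = (k n)%:R &
  forall n, n \in (I :\: hatN G)%SET -> Nval ord a l n < 0].

Definition cell_box k I (s : seq (node G)) l :=
  cell k I l /\ forall n, n \in s -> Nbar ord (lift_sub a k) l n < vpos n.

Definition indic (C : {ffun node G -> int} -> Prop) : series G :=
  fun e => (`[< exists2 l, e = ofint l & C l >])%:R.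

Lemma indicE C l : indic C (ofint l) = (`[< C l >])%:R.
Proof.
congr (nat_of_bool _)%:R; apply/asboolP/asboolP => [[l' /ofint_inj -> //]|Cl].
by exists l.
Qed.

Lemma indic0 C e : (forall l, e <> ofint l) -> indic C e = 0.
Proof. by move=> h; rewrite /indic (_ : asbool _ = false) //; apply/asboolPn => -[l /h]. Qed.

Lemma Mbar_sub_v k l n : krange G k -> inMbar ord (lift_sub a k) l ->
  vpos n <= Nbar ord (lift_sub a k) l n -> inMbar ord (lift_sub a k) (l - v n).
Proof.
move=> kr [lZ lN] nl; split; first by apply: ZNB => //; apply: v_ZN.
move=> m; have := NbarD (lift_sub a k) (l - v n) (v n) m; rewrite subrK orb_v => e.
have := lN m; case: eqVneq e => [-> e _|_ e]; last by rewrite e addr0.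
by move: nl; rewrite e; lra.
Qed.

Lemma Nval_shift k l n m : krange G k -> inMbar ord (lift_sub a k) l -> m != n ->
  Nval ord a (l + v n) m = Nval ord a l m.
Proof.
move=> kr lM mn; have [_ _ /(_ _ n lM)[/(_ m mn) + _]] := adm kr.
by rewrite !Nval_sub => /addIr.
Qed.

(** As [n] is not in [I], the translation by [v_n] leaves all the conditions on
    [N] alone; the only obstruction to translating back is the boundary of the cone. *)
Lemma cell_box_shift k I s l n : krange G k -> hatN G \subset I -> n \notin I -> n \notin s ->
  cell_box k I s (l - v n) <->
  cell_box k I s l /\ vpos n <= Nbar ord (lift_sub a k) l n.
Proof.
move=> kr hI nI ns; have nhat m : m \in hatN G -> m != n.
  by move=> mh; apply: contraNneq nI => <-; apply: (fintype.subsetP hI).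
have nI' m : m \in (I :\: hatN G)%SET -> m != n.
  by rewrite finset.inE => /andP[_ mI]; apply: contraNneq nI => <-.
have ns' m : m \in s -> m != n by apply: contraTneq => ->.
have sh l' m : Nbar ord (lift_sub a k) (l' + v n) m = Nbar ord (lift_sub a k) l' m + (if m == n then vpos n else 0).
  by rewrite NbarD orb_v.
split=> [[[lM hh hI'] hs]|[[[lM hh hI'] hs] hn]].
  have e : l = l - v n + v n by rewrite subrK.
  split; last first.
    by have := sh (l - v n) n; rewrite subrK eqxx => ->; rewrite lerDr; case: lM.
  split; last by move=> m ms; rewrite e sh (negPf (ns' m ms)) addr0 hs.
  split; first by rewrite e; apply: Mbar_v.
    by move=> m mh; rewrite e (Nval_shift kr lM) ?hh ?nhat.
  by move=> m mI; rewrite e (Nval_shift kr lM) ?hI' ?nI'.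
have lM' := Mbar_sub_v kr lM hn.
have eN m : m != n -> Nval ord a (l - v n) m = Nval ord a l m.
  by move=> mn; rewrite -(Nval_shift kr lM' mn) subrK.
split; last first.
  by move=> m ms; have := hs m ms; rewrite -{1}(subrK (v n) l) sh (negPf (ns' m ms)) addr0.
by split=> // m mm; rewrite eN; [exact: hh|exact: nhat|exact: hI'|exact: nI'].
Qed.

(** Each factor [1 - t^{v_n}] cuts the cell down to the part where the
    coordinate along [v_n] is less than 1. *)
Lemma md_indic k I s : krange G k -> hatN G \subset I -> uniq s ->
  (forall n, n \in s -> n \notin I) ->
  md v s (indic (cell k I)) = indic (cell_box k I s).
Proof.
move=> kr hI; elim: s => [|n s IH] /= us sI.
  by congr indic; apply/predeqP => l; split=> [?|[]] //.
case/andP: us => ns us; rewrite IH // => [|m ms]; last by apply: sI; rewrite inE ms orbT.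
have nI := sI n (mem_head _ _).
apply/funext => e; rewrite /den seriesD seriesN /tmul.
have [[l ->]|h] := pselect (exists l, e = ofint l); last first.
  rewrite [X in _ - X]indic0 ?subr0 => [|l el]; last first.
    by apply: h; exists (l + v n); rewrite ofintD -el subrK.
  by rewrite !indic0 // => l el; apply: h; exists l.
rewrite -ofintB !indicE.
have := cell_box_shift l kr hI nI ns.
have b1 : cell_box k I (n :: s) l <-> cell_box k I s l /\ Nbar ord (lift_sub a k) l n < vpos n.
  split=> [[c h]|[[c h] hn]].
    by split; [split=> // m ms; apply: h; rewrite inE ms orbT|apply: h; rewrite mem_head].
  by split=> // m; rewrite inE => /orP[/eqP ->|/h].
move=> b2; case: (asboolP (cell_box k I s l)) => c1.
  have [hn|hn] := ltP (Nbar ord (lift_sub a k) l n) (vpos n).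
    rewrite (asboolT (_ : cell_box k I (n :: s) l)); last by apply/b1.
    rewrite (asboolF (_ : ~ cell_box k I s (l - v n))) ?subr0 // => /b2[_].
    by rewrite leNgt hn.
  rewrite (asboolT (_ : cell_box k I s (l - v n))); last by apply/b2.
  rewrite (asboolF (_ : ~ cell_box k I (n :: s) l)) ?subrr // => /b1[_].
  by rewrite ltNge hn.
rewrite (asboolF (_ : ~ cell_box k I (n :: s) l)); last by move=> /b1[].
by rewrite (asboolF (_ : ~ cell_box k I s (l - v n))) ?subr0 // => /b2[].
Qed.

Lemma real_orb (c : node G -> R) (y : {ffun node G -> rat}) n :
  (forall m, ratr (y m) = \sum_p c p * (v p m)%:~R) -> ratr (orb y n) = c n * ratr (vpos n).
Proof.
move=> e; rewrite (orb_real_comb n e).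
rewrite (bigD1 n) //= big1 ?addr0 // => p pn.
by rewrite orb_v_off 1?eq_sym // rmorph0 mulr0.
Qed.

(** A point of the cell with coordinates less than 1 along the [v_n], [n]
    outside of [I], has such coordinates along all of them: for [n] in [I], admissibility
    with bound 1 gives [N >= 1] after a translation by [v_n] inside the cone, whereas
    [N - k_n] is 0 or negative on the cell. *)
Lemma cell_box_gr k I l : krange G k -> hatN G \subset I ->
  cell_box k I (enum (~: I)%SET) l <-> gr R ord v a k I l.
Proof.
move=> kr hI; pose y := ofint l + cvec ord (lift_sub a k).
have yN n : orb y n = Nbar ord (lift_sub a k) l n by rewrite Nbar_orb.
split=> [[[lM hh hI'] hs]|[[_ [c c01 e]] lZ hI' hh]].
  split=> //; last by case: lM.
  have small n : Nbar ord (lift_sub a k) l n < vpos n.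
    have [nI|nI] := boolP (n \in I); last by apply: hs; rewrite mem_enum finset.inE.
    rewrite ltNge; apply/negP => hn; have lM' := Mbar_sub_v kr lM hn.
    have [_ _ /(_ _ n lM')[_ +]] := adm kr; rewrite subrK Nval_sub.
    have [nh|nh] := boolP (n \in hatN G); first by rewrite hh // subrr ler10.
    have := hI' n; rewrite finset.inE nh nI => /(_ isT) h1 h2.
    by have := lt_le_trans h1 (ler0n _ (k n)); lra.
  split; first by exists n0; rewrite finset.inE.
  exists [ffun n => ratr (Nbar ord (lift_sub a k) l n / vpos n)].
    move=> n _; rewrite ffunE ler0q divr_ge0 ?(ltW (vpos_gt0 n)) //; last by case: lM.
    by rewrite /= -[X in _ < X](rmorph1 (@ratr R)) ltr_rat ltr_pdivrMr ?vpos_gt0 // mul1r.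
  move=> m _; rewrite ffunE -/y (orb_expansion treeG negG ordG y m) rmorph_sum /=.
  rewrite [RHS](eq_bigl xpredT) => [|n]; last by rewrite finset.inE.
  apply: eq_bigr => n _; rewrite ffunE -ratr_int v_Estar -rmorphM /= yN; congr ratr.
  by rewrite mulrA divfK // gt_eqF ?vpos_gt0.
have yc n : ratr (Nbar ord (lift_sub a k) l n) = c n * ratr (vpos n) :> R.
  rewrite -yN; apply: real_orb => m; have := e m; rewrite finset.inE ffunE => /(_ isT) ->.
  by apply: eq_bigl => p; rewrite finset.inE.
have cn n : 0 <= c n < 1 by apply: c01; rewrite finset.inE.
have vp n : (0 : R) < ratr (vpos n) by rewrite ltr0q vpos_gt0.
split; last first.
  move=> n _; rewrite -(ltr_rat R) yc -[X in _ < X]mul1r ltr_pM2r //.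
  by case/andP: (cn n).
split=> //; split=> // n; rewrite -(ler0q R) yc mulr_ge0 ?(ltW (vp n)) //.
by case/andP: (cn n).
Qed.

End Admissible.

(** * The series as a sum over cells *)

(** A finite set as a duplicate-free list. *)
Definition elems (T : choiceType) (A : set T) : seq T :=
  xget [::] [set s | uniq s /\ A = [set` s]]%classic.

Lemma elemsP (T : choiceType) (A : set T) : finite_set A ->
  uniq (elems A) /\ forall x, (x \in elems A) <-> A x.
Proof.
move=> /finite_seqP[s sA]; rewrite /elems; case: xgetP => [t _ [ut tA]|/(_ (undup s))[]].
  by split=> // x; rewrite tA.
by split; rewrite ?undup_uniq // sA; apply/seteqP; split=> x /=; rewrite mem_undup.
Qed.

Lemma fsbig_elems (V : nmodType) (T : choiceType) (A : set T) (F : T -> V) : finite_set A ->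
  \sum_(x \in A) F x = \sum_(x <- elems A) F x.
Proof.
move=> /elemsP[ue eA]; have {1}-> : A = [set` elems A]%classic by apply/seteqP; split=> x /=; rewrite eA.
by rewrite -fsbig_seq.
Qed.

(** Expansion of the product of the [1 - p n] over the complement of [H]. *)
Lemma signed_supersets (T : finType) (H : {set T}) (p : pred T) :
  \sum_(I : {set T} | H \subset I) ([forall n in (I :\: H)%SET, p n])%:R * (-1) ^+ #|(I :\: H)%SET|
  = ([forall n in (~: H)%SET, ~~ p n])%:R :> int.
Proof.
have h (q : pred T) (A : {set T}) (x : int) :
    \prod_(n in A) (if q n then x else 0) = ([forall n in A, q n])%:R * x ^+ #|A|.
  have [/forall_inP qA|/forall_inPn[n nA qn]] := boolP [forall n in A, q n].
    by rewrite mul1r -prodr_const; apply: eq_bigr => n /qA ->.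
  by rewrite mul0r (bigD1 n) //= (negPf qn) mul0r.
(* Distributing the product, [I] is the set where the first term is taken; on [H]
   the second term is 0. *)
transitivity (\prod_n ((if n \in H then 1 else if p n then -1 else 0) + (if n \in H then 0 else 1) : int)).
  rewrite bigA_distr [RHS](bigID (fun I : {set T} => H \subset I)) /= [X in _ = _ + X]big1 ?addr0; last first.
    by move=> I /fintype.subsetPn[n nH nI]; rewrite (bigD1 n) //= (negPf nI) nH mul0r.
  apply: eq_bigr => I /fintype.subsetP HI; rewrite -h; apply/esym.
  rewrite (bigID (mem (I :\: H)%SET)) /= [X in _ * X]big1 ?mulr1 => [|n].
    by apply: eq_bigr => n; rewrite finset.inE => /andP[/negPf -> ->].
  rewrite finset.inE negb_and negbK => /orP[nH|/negPf nI].
    by rewrite (HI _ nH) nH.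
  by rewrite nI; case: ifP => // /HI; rewrite nI.
transitivity (\prod_(n in (~: H)%SET) (if ~~ p n then 1 else 0 : int)); last by rewrite (h (fun n => ~~ p n)) expr1n mulr1.
rewrite (bigID (mem H)) /= big1 ?mul1r => [|n ->]; last by rewrite addr0.
apply: eq_big => [n|n /negPf ->]; first by rewrite finset.inE.
by case: (p n).
Qed.

Section Cells.
Variables (R : realType) (G : plumbing) (ord : rel (node G)) (a : redlift G).
Variable v : node G -> {ffun node G -> int}.
Hypothesis treeG : is_tree G.
Hypothesis negG : negative_definite G.
Hypothesis ordG : orientation ord.
Variable n0 : node G.
Hypothesis adm : forall k, krange G k -> admissible R ord v (lift_sub a k) 1.
Implicit Types (n m : node G) (l : {ffun node G -> int}) (k : {ffun node G -> nat}).
Implicit Types (I J : {set node G}).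

Lemma finite_krange : finite_set (krange G).
Proof.
pose B := (\max_(n : node G) degN n).+1.
pose f (g : {ffun node G -> 'I_B}) : {ffun node G -> nat} := [ffun n => val (g n)].
apply: (@sub_finite_set _ _ (f @` [set` predT])%classic); last first.
  exact/finite_image/finite_finpred.
move=> k kr; have kB n : (k n < B)%N.
  rewrite ltnS (leq_trans _ (leq_bigmax n)) //; have [h1 h2] := kr n.
  have [/h1|/h2 ->//] := boolP (n \in hatN G); lia.
exists [ffun n => Ordinal (kB n)] => //.
by apply/ffunP => n; rewrite /f !ffunE.
Qed.

Lemma toR_ofint l y m : toR R (ofint l + y) m = (l m)%:~R + ratr (y m).
Proof. by rewrite !ffunE rmorphD /= ratr_int. Qed.

Lemma finite_gr k I : finite_set (gr R ord v a k I).
Proof.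
pose b : R := \sum_m (`|ratr (cvec ord (lift_sub a k) m)| + \sum_n `|(v n m)%:~R|).
pose B := (Num.truncn b).+1.
pose f (g : {ffun node G -> 'I_(B + B)}) : {ffun node G -> int} := [ffun n => (val (g n))%:Z - B%:Z].
apply: (@sub_finite_set _ _ (f @` [set` predT])%classic); last first.
  exact/finite_image/finite_finpred.
move=> l [[_ [c c01 lE]] _ _ _].
have bl m : `|(l m)%:~R| < B%:R :> R.
  apply: (@le_lt_trans _ _ b); last exact: truncnS_gt.
  rewrite /b (bigD1 m) //= ler_wpDr //.
    by rewrite sumr_ge0 // => p _; rewrite addr_ge0 // sumr_ge0.
  have /eqP := lE m (finset.in_setT m); rewrite toR_ofint eq_sym -subr_eq addrC => /eqP <-.
  apply: le_trans (ler_normD _ _) _; rewrite normrN lerD2l.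
  apply: le_trans (ler_norm_sum _ _ _) _; rewrite [leLHS](eq_bigl xpredT); last by move=> n; rewrite finset.inE.
  apply: ler_sum => n _; rewrite normrM; apply: ler_piMl => //.
  by have /andP[h1 h2] := c01 n (finset.in_setT n); rewrite ger0_norm // ltW.
have {}bl m : (`|l m| < B)%N.
  by have := bl m; rewrite -intr_norm pmulrn ltr_int; lia.
have lb m : (`|(l m + B%:Z)%R| < B + B)%N by move: (bl m); clear; clearbody B; lia.
exists [ffun m => Ordinal (lb m)] => //.
by apply/ffunP => m; rewrite /f !ffunE /=; move: (bl m); clear; clearbody B; lia.
Qed.

Definition kseq := elems (krange G).
Definition grseq k I := elems (gr R ord v a k I).

Lemma mem_kseq k : k \in kseq <-> krange G k.
Proof. by have [_] := elemsP finite_krange; apply. Qed.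
Lemma mem_grseq k I l : l \in grseq k I <-> gr R ord v a k I l.
Proof. by have [_] := elemsP (finite_gr k I); apply. Qed.

(** What the factors outside of [I] leave of the cell is the finite set [gr]. *)
Lemma mulden_cell k I : krange G k -> hatN G \subset I ->
  mulden v (~: I)%SET (indic (cell ord a k I)) = \sum_(l <- grseq k I) mono (ofint l).
Proof.
move=> kr hI; have [ug mg] := elemsP (finite_gr k I).
rewrite mulden_md (md_indic treeG negG ordG n0 adm) ?enum_uniq // => [|n]; last first.
  by rewrite mem_enum finset.inE.
apply/funext => e; rewrite series_sum.
have cb l : cell_box ord a v k I (enum (~: I)%SET) l <-> l \in grseq k I.
  by rewrite mg; exact: (cell_box_gr treeG negG ordG n0 adm).
have [[l ->]|h] := pselect (exists l, e = ofint l); last first.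
  rewrite indic0 => [|l el]; last by apply: h; exists l.
  rewrite big1 // => l _; rewrite /mono; case: (e =P _) => // el.
  by case: h; exists l.
rewrite indicE; case: asboolP => [/cb lg|nl].
  rewrite (bigD1_seq l) //= {1}/mono eqxx big1 ?addr0 // => l' ll'.
  by rewrite /mono (inj_eq (@ofint_inj G)) eq_sym (negPf ll').
rewrite big1_seq // => l' /andP[_ lg]; rewrite /mono (inj_eq (@ofint_inj G)).
by case: eqP => // ll'; case: nl; apply/cb; rewrite ll'.
Qed.

Variable h : {ffun G -> rat}.
Hypothesis ah : same_class (lift_elt ord a) h.
Hypothesis deg1 : forall n : node G, (1 <= degN n)%N.

Definition signI I : int := (-1) ^+ #|(I :\: hatN G)%SET|.

(** The factor of a node in [hatN G] is a binomial coefficient, nonzero for one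
    [k] only; the factor of another node, whose [degN] is 1, is 1 if [N >= 0] and 0
    otherwise, and [signed_supersets] expands the product of these. *)
Lemma Zh_cells : Zh h = tmul (cvec ord a)
  (\sum_(I : {set node G} | hatN G \subset I)
    (\sum_(k <- kseq) indic (cell ord a k I) *~ kcoef k) *~ signI I).
Proof.
apply/funext => e; rewrite /tmul series_sum.
under eq_bigr do rewrite seriesMz series_sum.
under eq_bigr do under eq_bigr do rewrite seriesMz.
have [uk mk] := elemsP finite_krange; rewrite -/kseq in uk mk.
have [[l lZ eE]|nl] := pselect (exists2 l, ZN ord a l & e = ofint l + cvec ord a); last first.
  rewrite (Zh_off treeG negG ordG ah) => [|l lZ el]; last by apply: nl; exists l.
  rewrite big1 // => I _; rewrite big1 ?mul0r // => k _.
  rewrite /indic asboolF ?mul0r // => -[l el [[lZ _] _ _]]; apply: nl; exists l => //.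
  by rewrite -el subrK.
rewrite {}eE addrK (Zh_on treeG negG ordG n0 ah lZ).
under [RHS]eq_bigr do under eq_bigr do rewrite indicE.
pose N := Nint ord a l; have NE n : Nval ord a l n = (N n)%:~R by rewrite (NintE treeG negG ordG n0).
have deg n : n \notin hatN G -> degN n = 1%N.
  by rewrite finset.inE -leqNgt => d2; apply/eqP; rewrite eqn_leq d2 deg1.
have Nbar0 n : 0 <= N n -> 0 <= Nbar ord a l n.
  by move=> N0; apply: le_trans (Nval_le_Nbar ord a l n); rewrite NE ler0z.
pose good := [forall n in hatN G, (0 <= N n) && (N n <= (degN n - 2)%N%:Z)] &&
  [forall n in (~: hatN G)%SET, 0 <= Nbar ord a l n].
(* The only [k] for which a cell can contain [l]. *)
pose ks : {ffun node G -> nat} := [ffun n => if n \in hatN G then `|N n|%N else 0%N].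
have cellE k I : krange G k -> `[< cell ord a k I l >] =
    [&& good, k == ks & [forall n in (I :\: hatN G)%SET, N n < 0]].
  move=> kr; apply/asboolP/idP => [[[_ lN] lh lI]|/and3P[/andP[/forall_inP g1 /forall_inP g2] /eqP -> /forall_inP g3]].
    have Nk n : n \in hatN G -> N n = (k n)%:Z.
      by move=> nh; have := lh n nh; rewrite NE pmulrn => /intr_inj.
    apply/and3P; split.
    - apply/andP; split; apply/forall_inP => n nh.
        by rewrite Nk // lez_nat; have [/(_ nh)] := kr n.
      have := lN n; rewrite Nbar_sub; have [_ ->] := kr n; first by rewrite subr0.
      by rewrite finset.inE in nh.
    - apply/eqP/ffunP => n; rewrite ffunE; case: ifPn => nh; first by rewrite Nk.
      by have [_ ->] := kr n.
    by apply/forall_inP => n /lI; rewrite NE ltrz0.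
  have Nk n : n \in hatN G -> N n = (ks n)%:Z.
    by move=> nh; rewrite ffunE nh; have /andP[] := g1 n nh; lia.
  split; last by move=> n /g3; rewrite NE ltrz0.
    split=> // n; rewrite Nbar_sub subr_ge0; have [nh|nh] := boolP (n \in hatN G).
      by rewrite pmulrn -Nk // -NE Nval_le_Nbar.
    by rewrite ffunE (negPf nh) g2 // finset.inE.
  by move=> n nh; rewrite NE Nk.
transitivity (if good then kcoef ks * ([forall n in (~: hatN G)%SET, ~~ (N n < 0)])%:R else 0).
  have offE n : n \notin hatN G -> zbin ((degN n)%:Z - 2) (N n) = (~~ (N n < 0))%:R.
    move=> /deg ->; rewrite -leNgt; case: (N n) => j //=.
    by rewrite binn.
  rewrite (bigID (mem (hatN G))) /=.
  have [/andP[/forall_inP g1 _]|] := boolP good; rewrite ?negb_and; last first.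
    case/orP => /forall_inPn[n nh]; last first.
      rewrite finset.inE in nh; rewrite -ltNge => Nn.
      rewrite [X in _ * X](bigD1 n) //= offE // (_ : N n < 0) ?mul0r ?mulr0 //.
      by rewrite ltNge; apply/negP => /Nbar0; rewrite leNgt Nn.
    move=> Nn; rewrite (bigD1 n) //= (_ : zbin _ _ = 0) ?mul0r //.
    have d2 : (2 <= degN n)%N by rewrite finset.inE in nh.
    rewrite /N in Nn *; case: (Nint ord a l n) Nn => j //=; rewrite lez_nat -ltnNge => jd.
    by rewrite (_ : (degN n)%:Z - 2 = Posz (degN n - 2)) /= ?bin_small ?mulr0 //; lia.
  congr (_ * _).
    apply: eq_bigr => n nh; have d2 : (2 <= degN n)%N by rewrite finset.inE in nh.
    rewrite ffunE nh (_ : (degN n)%:Z - 2 = Posz (degN n - 2)); last by lia.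
    by have /andP[+ _] := g1 n nh; rewrite /N; case: (Nint ord a l n).
  rewrite (eq_bigr _ offE).
  have [/forall_inP h1|/forall_inPn[n nh h1]] := boolP [forall n in (~: hatN G)%SET, ~~ (N n < 0)].
    by rewrite big1 // => n nh; rewrite h1 // finset.inE.
  by rewrite finset.inE in nh; rewrite (bigD1 n) //= (negPf h1) mul0r.
have [g|g] := ifP; last first.
  rewrite big1 // => I _; rewrite big1_seq ?mul0r // => k /andP[_ /mk kr].
  by rewrite cellE // g mul0r.
have kr : krange G ks.
  move: g => /andP[/forall_inP g1 _] n; rewrite ffunE; split=> [nh|/negPf -> //].
  by rewrite nh; have := g1 n nh; lia.
rewrite -signed_supersets mulr_sumr; apply: eq_bigr => I _.
rewrite (bigD1_seq ks) /= ?uk //; last by apply/mk.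
rewrite big1_seq ?addr0 => [|k /andP[kks /mk krk]]; last by rewrite cellE // (negPf kks) andbF mul0r.
by rewrite cellE // g eqxx /= /signI; ring.
Qed.

End Cells.

(** * The two rays of a chain *)

Section Pieces.
Variables (R : realType) (G : plumbing).
Variable v : node G -> {ffun node G -> int}.
Variable w : node G -> rat.
Hypothesis treeG : is_tree G.
Hypothesis negG : negative_definite G.
Hypothesis w0 : forall x, 0 < w x.
Hypothesis vE : forall x y, (v x y)%:Q = w x * Estar (val x) (val y).
Notation expo := {ffun node G -> rat}.
Implicit Types (n m x p : node G) (l : {ffun node G -> int}) (e : expo).
Implicit Types (I J K : {set node G}) (f g P Q : series G).

Lemma v_pos x p : 0 < ofint (v x) p.
Proof. by rewrite ffunE vE mulr_gt0 // Estar_gt0. Qed.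

Lemma coordB n : addfun (fun e : expo => e n).
Proof. by move=> a b; rewrite !ffunE. Qed.

(** The coordinate along [E_n^*] of the projection to the nodes [n] and [m], in
    the basis of the projections of [E_n^*] and [E_m^*], up to a positive factor. *)
Definition ray n m e : rat :=
  e n * Estar (val m) (val m) - e m * Estar (val m) (val n).

Lemma rayB n m : addfun (ray n m).
Proof. by move=> a b; rewrite /ray !ffunE; ring. Qed.

Definition minor n m : rat :=
  Estar (val n) (val n) * Estar (val m) (val m) - Estar (val n) (val m) * Estar (val m) (val n).

Lemma coord_ray n m e : n != m ->
  e n = Estar (val n) (val n) / minor n m * ray n m e + Estar (val m) (val n) / minor n m * ray m n e.
Proof.
move=> nm; have D0 : minor n m != 0.
  by rewrite gt_eqF // subr_gt0 Estar_minor // (inj_eq val_inj).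
by rewrite /ray; move: D0; rewrite /minor => D0; field.
Qed.

Lemma minor_gt0 n m : n != m -> 0 < minor n m.
Proof. by move=> nm; rewrite subr_gt0 Estar_minor // (inj_eq val_inj). Qed.

(** At [n] and [m] the vectors [E_x^*], [x] on one side, are proportional. *)
Lemma ray_off n m x : nbr n m -> x \in side n m -> ray m n (ofint (v x)) = 0.
Proof.
move=> nm xn; have := Estar_ratio treeG negG nm xn (side_refl n m).
rewrite /ray !ffunE !vE => h; rewrite -!mulrA -mulrBr [X in _ * (_ - X)]h.
by rewrite [X in _ * (_ - X)]mulrC subrr mulr0.
Qed.

Lemma nbr_node_neq n m : nbr n m -> n != m.
Proof. by case/andP; rewrite eq_sym. Qed.

(** The coordinate at [n] is positive and comes from this ray alone. *)
Lemma ray_on n m x : nbr n m -> x \in side n m -> 0 < ray n m (ofint (v x)).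
Proof.
move=> nm xn; have := v_pos x n; rewrite (coord_ray _ (nbr_node_neq nm)) (ray_off nm xn) mulr0 addr0.
by rewrite pmulr_rgt0 // divr_gt0 ?minor_gt0 ?nbr_node_neq // Estar_gt0.
Qed.

(** * Supports of remainders *)

Definition tot (phi : expo -> rat) I : rat := \sum_(x in I) phi (ofint (v x)).

Lemma totE phi I : \sum_(x <- enum I) phi (ofint (v x)) = tot phi I.
Proof. by rewrite big_enum. Qed.

Lemma tot_nonempty phi I (t : rat) : 0 <= t < tot phi I -> exists x, x \in I.
Proof.
move=> /andP[t0 tI]; apply: contrapT => h; move: tI; rewrite /tot big_pred0 ?ltNge ?t0 // => x.
by apply/negP => xI; apply: h; exists x.
Qed.

Lemma tot_gt0 phi I (t : rat) : 0 <= t < tot phi I -> 0 < tot phi I.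
Proof. by move=> /andP[]; apply: le_lt_trans. Qed.

Lemma unit_ratio (t T : rat) : 0 <= t < T -> 0 <= (ratr (t / T) : R) < 1.
Proof.
move=> tT; have T0 : 0 < T by case/andP: tT => ?; apply: le_lt_trans.
case/andP: tT => t0 tT; rewrite ler0q divr_ge0 ?(ltW T0) //=.
by rewrite -(rmorph1 (@ratr R)) ltr_rat ltr_pdivrMr // mul1r.
Qed.

Lemma hbox_of I J (t : node G -> rat) e :
  (exists x, x \in I) -> (forall x, x \in I -> 0 <= (ratr (t x) : R) < 1) ->
  (forall p, p \in J -> e p = \sum_(x in I) t x * ofint (v x) p) ->
  hbox v I J (toR R e).
Proof.
move=> In t01 eE; split=> //; exists [ffun x => ratr (t x)] => [x xI|p pJ].
  by rewrite ffunE t01.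
rewrite ffunE eE // rmorph_sum /=; apply: eq_bigr => x _.
by rewrite rmorphM /= !ffunE ratr_int.
Qed.

Lemma hbox_lt I J e p : hbox v I J (toR R e) -> p \in J -> 0 <= e p < tot (fun e => e p) I.
Proof.
move=> [[x0 x0I] [c c01 eE]] pJ; have /esym := eE p pJ; rewrite ffunE => ep.
rewrite -(ler0q R) -(ltr_rat R) -ep rmorph_sum /=; apply/andP; split.
  apply: sumr_ge0 => x xI; have /andP[h _] := c01 x xI; rewrite mulr_ge0 //.
  by have := v_pos x p; rewrite ffunE ltr0z ler0z => /ltW.
apply: ltr_sum => [|x xI]; first by apply/hasP; exists x0; rewrite ?mem_index_enum.
rewrite ffunE /= ratr_int -[ltRHS]mul1r ltr_pM2r; first by case/andP: (c01 x xI).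
by have := v_pos x p; rewrite ffunE !ltr0z.
Qed.

Lemma hstrip_lt I n m e (s : {ffun node G -> R}) p : n != m -> p \in [set n; m]%SET ->
  (forall q, 0 <= s q) -> hstrip v I n m (toR R e + s) -> e p < tot (fun e => e p) I.
Proof.
move=> nm pnm s0 [r r0 [[x0 x0I] [c c01 eE]]].
have := eE p pnm; rewrite !ffunE => ep; rewrite -(ltr_rat R) rmorph_sum /=.
have le : ratr (e p) <= ratr (e p) + s p + r * (p == n)%:R :> R.
  by rewrite -addrA lerDl addr_ge0 // mulr_ge0.
apply: le_lt_trans le _; rewrite ep.
apply: ltr_sum => [|x xI]; first by apply/hasP; exists x0; rewrite ?mem_index_enum.
rewrite ffunE /= ratr_int -[ltRHS]mul1r ltr_pM2r; first by case/andP: (c01 x xI).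
by have := v_pos x p; rewrite ffunE !ltr0z.
Qed.

Variable c : expo.
Hypothesis c01 : forall p, 0 <= c p < 1.

Lemma tmul_lsupp (S S' : expo -> Prop) e f :
  (forall e', S e' -> S' (e' + e)) -> lsupp S f -> lsupp S' (tmul e f).
Proof.
move=> h [lf sf]; split=> [|e']; first exact: laurent_tmul.
by rewrite /tmul => /sf/h; rewrite subrK.
Qed.

Lemma lsuppI (S S' : expo -> Prop) f :
  lsupp (fun e => S e /\ S' e) f <-> (laurent f /\ supp_in S f) /\ supp_in S' f.
Proof.
split=> [[lf sf]|[[lf s1] s2]]; last by split=> // e fe; split; [exact: s1|exact: s2].
by do 2?split=> //; apply: suppW sf => e [].
Qed.

Lemma toR_shift (p : node G) e (x : rat) : toR R e + toR R [ffun q => if q == p then x else 0] =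
  toR R [ffun q => if q == p then e q + x else e q].
Proof.
by apply/ffunP => q; rewrite !ffunE; case: ifP => _; rewrite ?rmorphD ?rmorph0 ?addr0.
Qed.

Lemma int_gtN1 (x : rat) : x \is a Num.int -> -1 < x -> 0 <= x.
Proof.
by move=> /intrP[z ->]; rewrite -(rmorphN1 (intr : int -> rat)) ltr_int ler0z; lia.
Qed.

Lemma tot_int p J : tot (fun e => e p) J \is a Num.int.
Proof. by apply: rpred_sum => x _; rewrite ffunE intr_int. Qed.

(** Rounding: adding [c_p] does not take an integer below a bound over it. *)
Lemma int_shift_lt p e J : integral_exp e -> 0 <= e p < tot (fun e => e p) J ->
  0 <= e p + c p < tot (fun e => e p) J.
Proof.
have /andP[c0 c1] := c01 p; move=> ie /andP[h0 h1]; rewrite addr_ge0 //=.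
have /intrP[z ez] := ie p; have /intrP[t et] := tot_int p J; move: h1; rewrite ez et.
rewrite ltr_int => zt; apply: (@lt_le_trans _ _ (z + 1)%:~R); last by rewrite ler_int; lia.
by rewrite rmorphD /= ltrD2l.
Qed.

Lemma grow phi I t e (T : rat) : addfun phi -> (forall x, x \in I -> 0 <= phi (ofint (v x))) ->
  subseq t (enum I) -> 0 <= phi e < T -> 0 <= phi (e + \sum_(x <- t) ofint (v x)) < T + tot phi I.
Proof.
move=> phiB h ts /andP[e0 eT].
have [|t0 tI] := andP (sum_subseq (phi := phi) (v := v) _ ts); first by move=> x; rewrite mem_enum; apply: h.
rewrite addfunD // addfun_sum // addr_ge0 //=.
by move: tI; rewrite totE => tI; apply: ltr_leD.
Qed.

Lemma grow0 phi I t e : addfun phi -> (forall x, x \in I -> phi (ofint (v x)) = 0) ->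
  subseq t (enum I) -> phi (e + \sum_(x <- t) ofint (v x)) = phi e.
Proof.
move=> phiB h ts; rewrite addfunD // addfun_sum // big1_seq ?addr0 // => x /andP[_ /(mem_subseq ts)].
by rewrite mem_enum; apply: h.
Qed.

Lemma grow_int (t : seq (node G)) e e0 : integral_exp (e - e0) -> integral_exp (e + \sum_(x <- t) ofint (v x) - e0).
Proof.
move=> i p; rewrite addrAC; have := i p; move: (e - e0) => d dp; rewrite ffunE rpredD // sum_ffunE rpred_sum // => x _.
by rewrite ffunE intr_int.
Qed.

Lemma mulden_diff J K f : J \subset K -> mulden v K f = mulden v (K :\: J) (mulden v J f).
Proof.
move=> JK; apply: mulden_split.
  apply/setP => x; rewrite !finset.inE; case: (boolP (x \in J)) => xJ; rewrite ?orbF //=.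
  by rewrite (fintype.subsetP JK).
by apply/pred0P => x /=; rewrite !finset.inE; case: (x \in J); rewrite ?andbF.
Qed.

Lemma int_shift_ge0 e l p : integral_exp (e - (ofint l + c)) -> 0 <= e p -> 0 <= (e - c) p.
Proof.
move=> i ep; have := rpredD (i p) (_ : (l p)%:Q \is a Num.int); rewrite !ffunE => /(_ (intr_int _ _)).
rewrite (_ : _ + (l p)%:~R = e p - c p); last by ring.
by move=> /int_gtN1; apply; case/andP: (c01 p) => _; lra.
Qed.

Section OneSide.
Variables (n m : node G).
Hypothesis nm : nbr n m.
Let nDm : n != m := nbr_node_neq nm.
Let mn : nbr m n. Proof. by rewrite nbr_sym. Qed.

Lemma sides J : (J :&: side n m) :|: (J :&: side m n) = J.
Proof.
apply/setP => x; rewrite finset.inE !finset.in_setI -andb_orr.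
by rewrite side_cover ?andbT.
Qed.

Lemma sides_disjoint J K : [disjoint J :&: side n m & K :&: side m n].
Proof.
apply/pred0P => x /=; rewrite !finset.in_setI; apply/negbTE/negP => /andP[/andP[_ xn] /andP[_]].
by apply/negP/side_disjoint.
Qed.

Lemma mulden_sides J f :
  mulden v J f = md v (enum (J :&: side n m) ++ enum (J :&: side m n)) f.
Proof. by rewrite md_cat -!mulden_md; apply: mulden_split; [exact: sides|exact: sides_disjoint]. Qed.

Lemma big_sides J (F : node G -> rat) :
  \sum_(x in J) F x = \sum_(x in J :&: side n m) F x + \sum_(x in J :&: side m n) F x.
Proof.
rewrite (bigID (mem (side n m))) /=; congr (_ + _); apply: eq_bigl => x; rewrite finset.in_setI //.
by have := side_cover treeG x nm; case: (boolP (x \in side n m)) => //= [/(side_disjoint treeG nm)/negPf ->|_ ->].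
Qed.

(** The combination has constant coefficients on each of the two sides. *)
Lemma box_hbox J e : 0 <= ray n m e < tot (ray n m) (J :&: side n m) ->
  0 <= ray m n e < tot (ray m n) (J :&: side m n) -> hbox v J [set n; m]%SET (toR R e).
Proof.
move=> h1 h2; have T1 := tot_gt0 h1; have T2 := tot_gt0 h2.
pose t x := if x \in side n m then ray n m e / tot (ray n m) (J :&: side n m)
            else ray m n e / tot (ray m n) (J :&: side m n).
apply: (@hbox_of _ _ t) => [|x _|p pnm].
- by have [x xJ] := tot_nonempty h1; exists x; move: xJ; rewrite finset.in_setI => /andP[].
- by rewrite /t; case: ifP => _; apply: unit_ratio.
have [al [be pE]] : exists al be, forall e', e' p = al * ray n m e' + be * ray m n e'.
  move: pnm; rewrite !finset.inE => /orP[]/eqP ->.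
    by exists (Estar (val n) (val n) / minor n m), (Estar (val m) (val n) / minor n m) => e'; apply: coord_ray.
  exists (Estar (val n) (val m) / minor m n), (Estar (val m) (val m) / minor m n) => e'.
  by rewrite (coord_ray e' (_ : m != n)) 1?eq_sym // addrC.
rewrite big_sides pE; congr (_ + _).
  rewrite (eq_bigr (fun x => ray n m e / tot (ray n m) (J :&: side n m) * al * ray n m (ofint (v x)))).
    by rewrite -mulr_sumr -/(tot _ _); field; rewrite gt_eqF.
  move=> x; rewrite finset.in_setI /t => /andP[_ xs]; rewrite xs pE (ray_off nm xs).
  by ring.
rewrite (eq_bigr (fun x => ray m n e / tot (ray m n) (J :&: side m n) * be * ray m n (ofint (v x)))).
  by rewrite -mulr_sumr -/(tot _ _); field; rewrite gt_eqF.
move=> x; rewrite finset.in_setI /t => /andP[_ xs]; rewrite (negPf (side_disjoint _ mn xs)) //.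
by rewrite pE (ray_off mn xs); ring.
Qed.

(** Moving the point by a nonnegative multiple of [E_n] to the ray of the [v_x]
    keeps its coordinate at [m], which determines the coefficient. *)
Lemma strip_hstrip J e : 0 <= e m < tot (fun e => e m) (J :&: side n m) -> 0 <= ray m n e ->
  hstrip v (J :&: side n m) n m (toR R e).
Proof.
move=> h1 h2; have T1 := tot_gt0 h1; set I := J :&: _ in h1 T1 *.
have p0 : 0 < Estar (val n) (val m) by apply: Estar_gt0.
pose r : rat := ray m n e / Estar (val n) (val m).
have r0 : 0 <= r by rewrite divr_ge0 // ltW.
exists (ratr r); first by rewrite ler0q.
have -> : [ffun p => toR R e p + ratr r * (p == n)%:R] = toR R [ffun p => e p + r * (p == n)%:R].
  by apply/ffunP => p; rewrite !ffunE rmorphD rmorphM /= rmorph_nat.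
apply: (@hbox_of _ _ (fun=> e m / tot (fun e => e m) I)) => [|x _|p].
- exact: tot_nonempty h1.
- exact: unit_ratio.
rewrite -mulr_sumr ffunE -/(tot (fun e => e p) I) !finset.inE => /orP[]/eqP ->; last first.
  by rewrite eq_sym (negPf nDm) mulr0 addr0 divfK // gt_eqF.
have -> : tot (fun e => e n) I = Estar (val n) (val n) / Estar (val n) (val m) * tot (fun e => e m) I.
  rewrite /tot mulr_sumr; apply: eq_bigr => x; rewrite finset.in_setI => /andP[_ /(ray_off nm)].
  rewrite /ray => /eqP; rewrite subr_eq0 => /eqP h3.
  by rewrite mulrAC (mulrC (Estar _ _)) h3 mulfK // gt_eqF.
by rewrite eqxx mulr1 /r /ray; field; rewrite !gt_eqF.
Qed.

(** The shift by [c_m] at [m] moves the point back into the cone. *)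
Lemma strip_hstripZ J e : integral_exp e -> 0 <= e m < tot (fun e => e m) (J :&: side n m) ->
  - (c m * Estar (val n) (val n)) <= ray m n e -> hstripZ R v (J :&: side n m) n m e.
Proof.
move=> i h3 h4; have /andP[cm0 cm1] := c01 m.
exists (toR R [ffun q => if q == m then c m else 0]).
  move=> p; rewrite !ffunE; case: ifP => _; last by rewrite rmorph0 lexx ltr01.
  by rewrite ler0q cm0 -(rmorph1 (@ratr R)) ltr_rat.
rewrite toR_shift; apply: strip_hstrip; first by rewrite ffunE eqxx int_shift_lt.
by move: h4; rewrite /ray !ffunE eqxx (negPf nDm); lra.
Qed.

End OneSide.

Section OneChain.
Variables (n m : node G).
Hypothesis nm : nbr n m.
Let nDm : n != m := nbr_node_neq nm.
Let mn : nbr m n. Proof. by rewrite nbr_sym. Qed.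

(** * Decompositions along a chain *)

(** [mulden _ _ R1 + mulden _ _ R2 + R0] with supports in [S1], [S2], [S0]: a
    subgroup of the group of series, which makes polynomial parts additive. *)
Definition rdec J (S1 S2 S0 : expo -> Prop) : series G -> Prop :=
  sumset (img (md v (enum (J :&: side m n))) S1)
    (sumset (img (md v (enum (J :&: side n m))) S2) (lsupp S0)).

Lemma zlin_rdec J S1 S2 S0 : zlin (rdec J S1 S2 S0).
Proof. by do 2! [apply: zlin_sumset; first exact: zlin_img]; apply: zlin_lsupp. Qed.

Lemma rdecP J S1 S2 S0 f : rdec J S1 S2 S0 f <->
  exists R1 R2 R0, [/\ lsupp S1 R1, lsupp S2 R2, lsupp S0 R0 &
    f = mulden v (J :&: side m n) R1 + mulden v (J :&: side n m) R2 + R0].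
Proof.
split=> [[_ [_ [[R1 l1 ->] [_ [R0 [[R2 l2 ->] l0 ->]]] ->]]]|[R1 [R2 [R0 [l1 l2 l0 ->]]]]].
  by exists R1, R2, R0; split=> //; rewrite addrA.
exists (mulden v (J :&: side m n) R1), (mulden v (J :&: side n m) R2 + R0).
split; [by exists R1| |by rewrite addrA].
by exists (mulden v (J :&: side n m) R2), R0; split=> //; exists R2.
Qed.

Lemma rdec_map J K (Phi : series G -> series G) (S1 S2 S0 S1' S2' S0' : expo -> Prop) f :
  (forall f g, Phi (f + g) = Phi f + Phi g) ->
  (forall f, lsupp S1 f -> img (md v (enum (K :&: side m n))) S1' (Phi (mulden v (J :&: side m n) f))) ->
  (forall f, lsupp S2 f -> img (md v (enum (K :&: side n m))) S2' (Phi (mulden v (J :&: side n m) f))) ->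
  (forall f, lsupp S0 f -> lsupp S0' (Phi f)) ->
  rdec J S1 S2 S0 f -> rdec K S1' S2' S0' (Phi f).
Proof.
move=> PD h1 h2 h0 /rdecP[R1 [R2 [R0 [l1 l2 l0 ->]]]]; rewrite !PD.
exists (Phi (mulden v (J :&: side m n) R1)), (Phi (mulden v (J :&: side n m) R2) + Phi R0).
split; [exact: h1| |by rewrite addrA].
by exists (Phi (mulden v (J :&: side n m) R2)), (Phi R0); split; [exact: h2|exact: h0|].
Qed.

Lemma rdecW J (S1 S2 S0 S1' S2' S0' : expo -> Prop) f :
  (forall e, S1 e -> S1' e) -> (forall e, S2 e -> S2' e) -> (forall e, S0 e -> S0' e) ->
  rdec J S1 S2 S0 f -> rdec J S1' S2' S0' f.
Proof.
move=> h1 h2 h0; apply: (rdec_map (Phi := id)) => // g; last exact: lsuppW.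
  by move=> lg; exists g; first exact: lsuppW lg.
by move=> lg; exists g; first exact: lsuppW lg.
Qed.

Definition quad e := ~ (e n < 0 /\ e m < 0).

Lemma quadE e : quad e <-> 0 <= e n \/ 0 <= e m.
Proof.
split=> [h|[h|h] [h1 h2]]; last 2 first.
- by rewrite ltNge h in h1.
- by rewrite ltNge h in h2.
by case: (leP 0 (e n)) => hn; [left|right; rewrite leNgt; apply/negP => hm; apply: h].
Qed.

(** What the remainders of all the decompositions considered have in common, and
    enough for the uniqueness of the polynomial part. *)
Definition low I e := forall p, p \in [set n; m]%SET -> e p < tot (fun e => e p) I.

Definition lowdec J := rdec J (low (J :&: side n m)) (low (J :&: side m n)) (low J).

Lemma nin : n \in [set n; m]%SET. Proof. by rewrite !finset.inE eqxx. Qed.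
Lemma min : m \in [set n; m]%SET. Proof. by rewrite !finset.inE eqxx orbT. Qed.

Lemma lowdec_unique J P : lsupp quad P -> lowdec J (mulden v J P) -> P = 0.
Proof.
move=> lP /rdecP[R1 [R2 [R0 [[l1 s1] [l2 s2] [l0 s0] e]]]].
apply: (@chain_dec_unique _ v (fun e => e n) (fun e => e m) (enum (J :&: side n m))
  (enum (J :&: side m n)) P (- R1) (- R2) (- R0)).
- exact: coordB.
- exact: coordB.
- by move=> x; apply: v_pos.
- by move=> x; apply: v_pos.
- by apply: lsuppW lP => e' /quadE.
- apply: suppN; apply: suppW s1 => e' h; rewrite !big_enum /=.
  by split; [exact: (h n nin)|exact: (h m min)].
- apply: suppN; apply: suppW s2 => e' h; rewrite !big_enum /=.
  by split; [exact: (h n nin)|exact: (h m min)].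
- apply: suppN; apply: suppW s0 => e' h; rewrite !big_cat /= !big_enum /= -!(big_sides nm).
  by split; [exact: (h n nin)|exact: (h m min)].
by rewrite -(mulden_sides nm) e !mdN; apply/funext => z; rewrite !seriesD !seriesN !mulden_md; ring.
Qed.

Definition hdec J := rdec J (fun e => hstrip v (J :&: side n m) n m (toR R e))
  (fun e => hstrip v (J :&: side m n) m n (toR R e)) (fun e => hbox v J [set n; m]%SET (toR R e)).
Definition zdec J :=
  rdec J (fun e => integral_exp e /\ hstripZ R v (J :&: side n m) n m e)
  (fun e => integral_exp e /\ hstripZ R v (J :&: side m n) m n e)
  (fun e => integral_exp e /\ hbox v J [set n; m]%SET (toR R e)).

Lemma is_Ph_chainE h P : is_Ph_chain R v h n m P <->
  lsupp quad P /\ hdec (~: hatN G)%SET (mulden v (~: hatN G)%SET (Zh h - P)).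
Proof.
split=> [[R1 [R2 [R0 [lP l1 l2 l0 e]]]]|[lP /rdecP[R1 [R2 [R0 [l1 l2 l0 e]]]]]].
  by split=> //; apply/rdecP; exists R1, R2, R0.
by exists R1, R2, R0.
Qed.

Lemma is_Pol_chainE l J P : is_Pol_chain R v l J n m P <->
  lsupp (fun e => integral_exp e /\ quad e) P /\ zdec J (mono (ofint l) - mulden v J P).
Proof.
split=> [[R1 [R2 [R0 [lP l1 l2 l0 e]]]]|[/lsuppI lP /rdecP[R1 [R2 [R0 [/lsuppI l1 /lsuppI l2 /lsuppI l0 e]]]]]].
  split; first exact/lsuppI.
  apply/rdecP; exists R1, R2, R0; split; [exact/lsuppI|exact/lsuppI|exact/lsuppI|].
  by rewrite e; apply/funext => z; rewrite !seriesD !seriesN; ring.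
exists R1, R2, R0; split=> //; rewrite -(subrK (mulden v J P) (mono _)) e.
by apply/funext => z; rewrite !seriesD; ring.
Qed.

Lemma zdec_low J f : zdec J f -> lowdec J f.
Proof.
apply: rdecW => e [_].
- by move=> [s s01 hs] p pnm; apply: (hstrip_lt nDm pnm _ hs) => q; case/andP: (s01 q).
- move=> [s s01 hs] p pnm; apply: (hstrip_lt _ _ _ hs); rewrite 1?eq_sym // 1?finset.setUC //.
  by move=> q; case/andP: (s01 q).
by move=> hb p pnm; case/andP: (hbox_lt hb pnm).
Qed.

Lemma hdec_low J f : hdec J f -> lowdec J f.
Proof.
apply: rdecW => e.
- by rewrite -[toR R e]addr0 => hs p pnm; apply: (hstrip_lt nDm pnm _ hs) => q; rewrite ffunE.
- rewrite -[toR R e]addr0 => hs p pnm; apply: (hstrip_lt _ _ _ hs); rewrite 1?eq_sym // 1?finset.setUC //.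
  by move=> q; rewrite ffunE.
by move=> hb p pnm; case/andP: (hbox_lt hb pnm).
Qed.

Lemma lowdec_unique2 J (F : series G) P P' : lsupp quad P -> lsupp quad P' ->
  lowdec J (F - mulden v J P) -> lowdec J (F - mulden v J P') -> P = P'.
Proof.
move=> lP lP' hP hP'; apply/eqP; rewrite -subr_eq0; apply/eqP; apply: (@lowdec_unique J).
  by apply: zlinB => //; apply: zlin_lsupp.
have -> : mulden v J (P - P') = (F - mulden v J P') - (F - mulden v J P).
  by rewrite mulden_md mdB opprB [RHS]addrC addrA subrK.
by apply: zlinB => //; apply: zlin_rdec.
Qed.

Lemma is_Ph_chain_unique h P P' : is_Ph_chain R v h n m P -> is_Ph_chain R v h n m P' -> P = P'.
Proof.
move=> /is_Ph_chainE[lP /hdec_low]; rewrite mulden_md mdB => hP.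
move=> /is_Ph_chainE[lP' /hdec_low]; rewrite mulden_md mdB => hP'.
exact: (lowdec_unique2 lP lP' hP hP').
Qed.

Lemma is_Pol_chain_low l J P P' : is_Pol_chain R v l J n m P -> lsupp quad P' ->
  lowdec J (mono (ofint l) - mulden v J P') -> P = P'.
Proof.
move=> /is_Pol_chainE[lP /zdec_low hP] lP' hP'; apply: (lowdec_unique2 _ lP' hP hP').
by apply: lsuppW lP => e [].
Qed.

Lemma Pol_chainP l J P : is_Pol_chain R v l J n m P -> is_Pol_chain R v l J n m (Pol_chain R v l J n m).
Proof. by move=> h; rewrite /Pol_chain; case: xgetP => [x _ //|/(_ P)]. Qed.

Let XE e := coord_ray e nDm.
Let YE e : e m = Estar (val n) (val m) / minor n m * ray n m e + Estar (val m) (val m) / minor n m * ray m n e.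
Proof.
have e1 : minor m n = minor n m by rewrite /minor [X in _ - X]mulrC (mulrC (Estar (val m) (val m))).
by have := coord_ray e (_ : m != n); rewrite e1 addrC; apply; rewrite eq_sym.
Qed.

Let pos (x y : node G) : 0 < Estar (val x) (val y) / minor n m.
Proof. by rewrite divr_gt0 ?minor_gt0 // Estar_gt0. Qed.

Let A1 J x : x \in enum (J :&: side n m) -> 0 < ray n m (ofint (v x)).
Proof. by rewrite mem_enum finset.in_setI => /andP[_]; apply: ray_on. Qed.
Let A2 J x : x \in enum (J :&: side n m) -> ray m n (ofint (v x)) = 0.
Proof. by rewrite mem_enum finset.in_setI => /andP[_]; apply: ray_off. Qed.
Let B1 J x : x \in enum (J :&: side m n) -> ray n m (ofint (v x)) = 0.
Proof. by rewrite mem_enum finset.in_setI => /andP[_]; apply: ray_off. Qed.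
Let B2 J x : x \in enum (J :&: side m n) -> 0 < ray m n (ofint (v x)).
Proof. by rewrite mem_enum finset.in_setI => /andP[_]; apply: ray_on. Qed.

(** As [l + c] lies in the cone, [l] is in the quadrant and at a distance from the
    cone that is bounded in terms of [c]. *)
Lemma Pol_chain_exists l J : 0 <= (l n)%:Q -> 0 <= (l m)%:Q ->
  0 <= ray n m (ofint l + c) -> 0 <= ray m n (ofint l + c) ->
  is_Pol_chain R v l J n m (Pol_chain R v l J n m).
Proof.
move=> ln lm h1 h2.
have p1 := Estar_gt0 treeG negG (val m) (val n).
have p2 := Estar_gt0 treeG negG (val n) (val m).
have q1 := Estar_gt0 treeG negG (val m) (val m).
have q2 := Estar_gt0 treeG negG (val n) (val n).
have /andP[cn0 cn1] := c01 n; have /andP[cm0 cm1] := c01 m.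
(* How far [l] can be outside of the cone in the two directions. *)
have y1 : - (c n * Estar (val m) (val m)) <= 0 by rewrite oppr_le0 mulr_ge0 // ltW.
have y2 : - (c m * Estar (val n) (val n)) <= 0 by rewrite oppr_le0 mulr_ge0 // ltW.
have g1 : - (c n * Estar (val m) (val m)) <= ray n m (ofint l).
  move: h1; rewrite /ray !ffunE; have : 0 <= c m * Estar (val m) (val n) by rewrite mulr_ge0 // ltW.
  by move: (c n) (c m) => x y; lra.
have g2 : - (c m * Estar (val n) (val n)) <= ray m n (ofint l).
  move: h2; rewrite /ray !ffunE; have : 0 <= c n * Estar (val n) (val m) by rewrite mulr_ge0 // ltW.
  by move: (c n) (c m) => x y; lra.
have := chain_dec_quadrant (coordB n) (coordB m) (rayB n m) (rayB m n) (pos n n) (pos m n) (pos n m)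
  (pos m m) XE YE (@A1 J) (@A2 J) (@B1 J) (@B2 J) (e0 := 0) y1 y2 (e := ofint l).
rewrite !(ffunE _ n) !(ffunE _ m) => /(_ ln lm g1 g2).
case=> [p|_ [f [[P lP ->] df e]]]; first by rewrite subr0 ffunE intr_int.
apply: (@Pol_chainP _ _ P); apply/is_Pol_chainE; split.
  apply: lsuppW lP => e' [q i]; split; last exact/quadE.
  by rewrite subr0 in i.
rewrite e (mulden_sides nm) addrC addKr.
move: df; apply: rdecW => e' [].
- by rewrite subr0 big_enum => h3 h4 i; split=> //; apply: strip_hstripZ.
- by rewrite subr0 big_enum => h3 h4 i; split=> //; apply: strip_hstripZ.
by rewrite subr0 !big_enum => h3 h4 i; split=> //; apply: box_hbox.
Qed.

(** The remainders of a decomposition of a point of the cone, with the supports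
    that [chain_dec_cone] gives, at exponents in the class of [e0]. *)
Definition exact J e0 := rdec J
  (fun e => [/\ 0 <= e m < tot (fun e => e m) (J :&: side n m), 0 <= ray m n e & integral_exp (e - e0)])
  (fun e => [/\ 0 <= e n < tot (fun e => e n) (J :&: side m n), 0 <= ray n m e & integral_exp (e - e0)])
  (fun e => [/\ 0 <= ray n m e < tot (ray n m) (J :&: side n m),
     0 <= ray m n e < tot (ray m n) (J :&: side m n) & integral_exp (e - e0)]).

Lemma exact_hdec J e0 f : exact J e0 f -> hdec J f.
Proof.
apply: rdecW => e [h1 h2 _]; [exact: strip_hstrip|exact: strip_hstrip|exact: box_hbox].
Qed.

Lemma exact_exists l J : 0 <= ray n m (ofint l + c) -> 0 <= ray m n (ofint l + c) ->
  exists2 P, lsupp (fun e => quad e /\ integral_exp (e - (ofint l + c))) P &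
    exact J (ofint l + c) (mono (ofint l + c) - mulden v J P).
Proof.
move=> h1 h2.
have := chain_dec_cone (coordB n) (coordB m) (rayB n m) (rayB m n) (pos n n) (pos m n) (pos n m)
  (pos m m) XE YE (@A1 J) (@A2 J) (@B1 J) (@B2 J) (e0 := ofint l + c) (lexx 0) (lexx 0) h1 h2.
case=> [p|_ [f [[P lP ->] df e]]]; first by rewrite subrr ffunE.
exists P; first by apply: lsuppW lP => e' [/quadE q i].
rewrite e (mulden_sides nm) [X in exact _ _ X]addrC addKr; move: df; apply: rdecW => e' []; rewrite ?big_enum //.
Qed.

(** Both decompositions have the same polynomial part: after a translation by
    [- c] the exact one still satisfies the bounds on the degrees. *)
Lemma exact_Pol l J P : 0 <= (l n)%:Q -> 0 <= (l m)%:Q ->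
  0 <= ray n m (ofint l + c) -> 0 <= ray m n (ofint l + c) ->
  lsupp (fun e => quad e /\ integral_exp (e - (ofint l + c))) P ->
  exact J (ofint l + c) (mono (ofint l + c) - mulden v J P) ->
  P = tmul c (Pol_chain R v l J n m).
Proof.
move=> ln lm h1 h2 lP eP.
have -> : Pol_chain R v l J n m = tmul (- c) P.
  apply: (@is_Pol_chain_low l J); first exact: Pol_chain_exists.
    apply: tmul_lsupp lP => e [/quadE q i]; apply/quadE.
    have key p := int_shift_ge0 (p := p) i.
    by case: q => /key q; [left|right].
  have -> : mono (ofint l) - mulden v J (tmul (- c) P) = tmul (- c) (mono (ofint l + c) - mulden v J P).
    by rewrite tmulD tmulN tmul_mono [- c + _]addrC addrK !mulden_md md_tmul.
  have low_shift (S : expo -> Prop) J' f : (forall e, S e -> low J' e) -> lsupp S f -> lsupp (low J') (tmul (- c) f).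
    move=> SJ; apply: tmul_lsupp => e /SJ he p /he; rewrite !ffunE; apply: le_lt_trans.
    by case/andP: (c01 p) => c0 _; rewrite gerDl oppr_le0.
  move/hdec_low: (exact_hdec eP); apply: rdec_map.
  - by move=> f g; rewrite tmulD.
  - by move=> f lf; exists (tmul (- c) f); [exact: low_shift lf|rewrite mulden_md md_tmul].
  - by move=> f lf; exists (tmul (- c) f); [exact: low_shift lf|rewrite mulden_md md_tmul].
  by move=> f lf; exact: low_shift lf.
by rewrite tmul_comp subrr tmul_0.
Qed.

(** Of the missing factors, those of one side complete the product in front of a
    remainder in a strip; those of the other side are multiplied into the remainder,
    which widens the strip, and [ray m n], resp. [ray n m], vanishes on them. *)
Lemma exact_mulden J K e0 f : J \subset K -> exact J e0 f -> exact K e0 (mulden v (K :\: J) f).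
Proof.
move=> JK; set D := (K :\: J)%SET.
have split_mul A g : mulden v (K :&: A) g = mulden v (D :&: A) (mulden v (J :&: A) g).
  apply: mulden_split; first apply/setP => x.
    rewrite !finset.inE; case: (boolP (x \in J)) => xJ; rewrite ?orbF //=.
    by rewrite (fintype.subsetP JK).
  apply/pred0P => x /=; rewrite !finset.inE.
  by case: (x \in J); rewrite ?andbF.
have split_tot phi A : tot phi (K :&: A) = tot phi (J :&: A) + tot phi (D :&: A).
  rewrite /tot [LHS](bigID (mem J)) /=; congr (_ + _); apply: eq_bigl => x; rewrite !finset.inE.
    by case: (boolP (x \in J)) => xJ; rewrite ?andbF // (fintype.subsetP JK) // andbT.
  by rewrite andbC andbA.
have DE g : mulden v D g = mulden v (D :&: side n m) (mulden v (D :&: side m n) g).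
  by rewrite (mulden_sides nm) md_cat.
have r1 x : x \in D :&: side n m -> 0 < ray n m (ofint (v x)) /\ ray m n (ofint (v x)) = 0.
  by rewrite finset.in_setI => /andP[_ xs]; rewrite (ray_on nm) // (ray_off nm).
have r2 x : x \in D :&: side m n -> 0 < ray m n (ofint (v x)) /\ ray n m (ofint (v x)) = 0.
  by rewrite finset.in_setI => /andP[_ xs]; rewrite (ray_on mn) // (ray_off mn).
apply: rdec_map => [f1 f2|f1 l1|f1 l1|f1 l1]; first exact: mdD.
- exists (mulden v (D :&: side n m) f1).
    apply: (lsupp_md l1) => e t [h1 h2 i] ts; split; last exact: grow_int i.
      rewrite split_tot; apply: (grow (coordB m)) => // x _; exact/ltW/v_pos.
    by rewrite (@grow0 (ray m n) (D :&: side n m)) ?rayB // => [|x /r1[]]; first exact: rayB.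
  by rewrite DE [RHS]mdC -!mulden_md split_mul.
- exists (mulden v (D :&: side m n) f1).
    apply: (lsupp_md l1) => e t [h1 h2 i] ts; split; last exact: grow_int i.
      rewrite split_tot; apply: (grow (coordB n)) => // x _; exact/ltW/v_pos.
    by rewrite (@grow0 (ray n m) (D :&: side m n)) ?rayB // => [|x /r2[]]; first exact: rayB.
  by rewrite DE -!mulden_md split_mul; congr (mulden _ _ _); apply: mdC.
rewrite DE; apply: (lsupp_md (S := fun e => [/\ 0 <= ray n m e < tot (ray n m) (J :&: side n m),
     0 <= ray m n e < tot (ray m n) (K :&: side m n) & integral_exp (e - e0)])) => [|e t [h1 h2 i] ts].
  apply: (lsupp_md l1) => e t [h1 h2 i] ts; split; last exact: grow_int i.
    by rewrite (@grow0 (ray n m) (D :&: side m n)) ?rayB // => [|x /r2[]]; first exact: rayB.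
  by rewrite split_tot; apply: (grow (rayB m n)) => // x /r2[/ltW].
split; last exact: grow_int i.
  by rewrite split_tot; apply: (grow (rayB n m)) => // x /r1[/ltW].
by rewrite (@grow0 (ray m n) (D :&: side n m)) ?rayB // => [|x /r1[]]; first exact: rayB.

Qed.

(** Multiplied by the factors that are missing to the common denominator, the
    decomposition of a monomial is again a decomposition, with the supports that the
    common denominator requires. *)
Lemma chain_piece l J K : J \subset K -> 0 <= (l n)%:Q -> 0 <= (l m)%:Q ->
  0 <= ray n m (ofint l + c) -> 0 <= ray m n (ofint l + c) ->
  lsupp quad (tmul c (Pol_chain R v l J n m)) /\
  hdec K (mulden v (K :\: J) (mono (ofint l + c)) - mulden v K (tmul c (Pol_chain R v l J n m))).
Proof.
move=> JK ln lm h1 h2; have [P lP eP] := exact_exists J h1 h2.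
rewrite -(exact_Pol ln lm h1 h2 lP eP); split; first by apply: lsuppW lP => e [].
have -> : mulden v K P = mulden v (K :\: J) (mulden v J P).
  exact: mulden_diff.
by rewrite !mulden_md -mdB; apply: (exact_hdec (e0 := ofint l + c)); apply: (exact_mulden JK eP).
Qed.

End OneChain.
Section OneNode.
Variable n : node G.

Definition lown J e := 0 <= e n < tot (fun e => e n) J.

Lemma lown_hbox J e : lown J e <-> hbox v J [set n]%SET (toR R e).
Proof.
split=> [h|h]; last by apply: hbox_lt h _; rewrite finset.set11.
apply: (@hbox_of _ _ (fun=> e n / tot (fun e => e n) J)) => [|x _|p]; [exact: tot_nonempty h|exact: unit_ratio|].
rewrite finset.in_set1 => /eqP ->; rewrite -mulr_sumr -/(tot (fun e => e n) J) divfK //.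
by rewrite gt_eqF // (tot_gt0 h).
Qed.

Lemma is_Ph_nodeE h P : is_Ph_node R v h n P <->
  lsupp (fun e => 0 <= e n) P /\ lsupp (lown (~: hatN G)%SET) (mulden v (~: hatN G)%SET (Zh h - P)).
Proof.
split=> [[Rn [lP lR e]]|[lP lR]].
  by split=> //; rewrite e; apply: lsuppW lR => e' /lown_hbox.
by eexists; split=> //; apply: lsuppW lR => e' /lown_hbox.
Qed.

Lemma is_Pol_nodeE l J P : is_Pol_node R v l J n P <->
  lsupp (@integral_exp G) P /\
  lsupp (fun e => integral_exp e /\ lown J e) (mono (ofint l) - mulden v J P).
Proof.
split=> [[Rn [lP /lsuppI lR e]]|[lP lR]].
  split=> //; rewrite e addrC addKr; apply: lsuppW lR => e' [i hb]; split=> //; exact/lown_hbox.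
exists (mono (ofint l) - mulden v J P); split=> //; last by rewrite addrC subrK.
by apply/lsuppI; apply: lsuppW lR => e' [i hb]; split=> //; exact/lown_hbox.
Qed.

Lemma lown_unique J (F : series G) P P' : laurent P -> laurent P' ->
  lsupp (lown J) (F - mulden v J P) -> lsupp (lown J) (F - mulden v J P') -> P = P'.
Proof.
move=> lP lP' hP hP'; apply/eqP; rewrite -subr_eq0; apply/eqP.
have [_ sR] := zlinB (zlin_lsupp (lown J)) hP hP'.
apply: (node_dec_unique (coordB n) (fun x => v_pos x n) (laurentB lP lP') (s := enum J)).
  by apply: suppW sR => e; rewrite /lown -totE.
rewrite mdB -!mulden_md.
have zz (A B C : series G) : A - B + (C - A - (C - B)) = 0.
  by apply/funext => z; rewrite !seriesD !seriesN !seriesD !seriesN series0; ring.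
exact: zz.
Qed.

Lemma is_Ph_node_unique h P P' : is_Ph_node R v h n P -> is_Ph_node R v h n P' -> P = P'.
Proof.
move=> /is_Ph_nodeE[[lP _]]; rewrite mulden_md mdB => hP.
move=> /is_Ph_nodeE[[lP' _]]; rewrite mulden_md mdB => hP'.
exact: (lown_unique lP lP' hP hP').
Qed.

Lemma is_Pol_node_low l J P P' : is_Pol_node R v l J n P -> laurent P' ->
  lsupp (lown J) (mono (ofint l) - mulden v J P') -> P = P'.
Proof.
move=> /is_Pol_nodeE[[lP _] hP] lP'; apply: lown_unique => //.
by apply: lsuppW hP => e [].
Qed.

Lemma node_divide J e : exists2 P,
  lsupp (fun e' => integral_exp (e' - e) /\ (0 <= e n -> 0 <= e' n)) P &
  lsupp (fun e' => integral_exp (e' - e) /\ lown J e') (mono e - mulden v J P).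
Proof.
have [|_ [r [[Q lQ ->] lr ->]]] := divide (v := v) (coordB n) (s := enum J) e.
  by move=> x _; apply: v_pos.
exists Q; first by apply: lsuppW lQ => e' [[i _] p _].
rewrite addrC addKr; apply: lsuppW lr => e' [[i _]]; rewrite big_enum.
by split.
Qed.

Lemma Pol_node_exists l J : is_Pol_node R v l J n (Pol_node R v l J n).
Proof.
have [P lP lR] := node_divide J (ofint l).
have ii e : integral_exp (e - ofint l) -> integral_exp e.
  by move=> i p; rewrite -(subrK (ofint l) e) ffunE rpredD // ffunE intr_int.
rewrite /Pol_node; case: xgetP => [x _ //|/(_ P)[]]; apply/is_Pol_nodeE; split.
  by apply: lsuppW lP => e [/ii].
by apply: lsuppW lR => e [/ii].
Qed.

Lemma node_piece l J K : J \subset K -> 0 <= (l n)%:Q ->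
  lsupp (fun e => 0 <= e n) (tmul c (Pol_node R v l J n)) /\
  lsupp (lown K) (mulden v (K :\: J) (mono (ofint l + c)) - mulden v K (tmul c (Pol_node R v l J n))).
Proof.
move=> JK ln; have [P lP lR] := node_divide J (ofint l + c).
have -> : tmul c (Pol_node R v l J n) = P.
  have -> : Pol_node R v l J n = tmul (- c) P; last by rewrite tmul_comp subrr tmul_0.
  apply: (is_Pol_node_low (Pol_node_exists l J)); first by apply: laurent_tmul; case: lP.
  have -> : mono (ofint l) - mulden v J (tmul (- c) P) = tmul (- c) (mono (ofint l + c) - mulden v J P).
    by rewrite tmulD tmulN tmul_mono [- c + _]addrC addrK !mulden_md md_tmul.
  apply: tmul_lsupp lR => e [i /andP[e0 eT]]; rewrite /lown (int_shift_ge0 i) //= !ffunE.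
  by apply: le_lt_trans eT; case/andP: (c01 n) => c0 _; rewrite gerDl oppr_le0.
split.
  apply: lsuppW lP => e [_]; apply; rewrite ffunE ffunE addr_ge0 //.
  by case/andP: (c01 n).
rewrite (mulden_diff _ JK) !mulden_md -mdB -!mulden_md; apply: (lsupp_md lR) => e t [_ el] ts.
rewrite /lown.
have -> : tot (fun e => e n) K = tot (fun e => e n) J + tot (fun e => e n) (K :\: J).
  rewrite /tot [LHS](bigID (mem J)) /=; congr (_ + _); apply: eq_bigl => x.
    by case: (boolP (x \in J)) => xJ; rewrite ?andbF // (fintype.subsetP JK).
  by rewrite finset.inE andbC.
by apply: (grow (coordB n)) => // x _; apply/ltW/v_pos.
Qed.

End OneNode.
End Pieces.

(** * Polynomial parts *)

Section Final.
Variables (R : realType) (G : plumbing) (ord : rel (node G)) (a : redlift G).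
Variable v : node G -> {ffun node G -> int}.
Hypothesis treeG : is_tree G.
Hypothesis negG : negative_definite G.
Hypothesis ordG : orientation ord.
Variable n0 : node G.
Hypothesis adm : forall k, krange G k -> admissible R ord v (lift_sub a k) 1.
Variable h : {ffun G -> rat}.
Hypothesis ah : same_class (lift_elt ord a) h.
Hypothesis deg1 : forall n : node G, (1 <= degN n)%N.
Hypothesis c01 : forall n, 0 <= cvec ord a n < 1.
Implicit Types (n m p : node G) (l : {ffun node G -> int}) (k : {ffun node G -> nat}).
Implicit Types (I J : {set node G}).

Let c := cvec ord a.
Let w0 : forall x, 0 < vpos v x := vpos_gt0 treeG negG ordG n0 adm.
Let vE := v_Estar treeG negG ordG n0 adm.

Lemma gr_orb_ge0 k I l p : krange G k -> hatN G \subset I -> gr R ord v a k I l ->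
  0 <= orb (ofint l + c) p.
Proof.
move=> kr hI /(cell_box_gr treeG negG ordG n0 adm _ kr hI)[[[_ lN] _ _] _].
by have := lN p; rewrite Nbar_sub subr_ge0 -Nbar_orb //; apply: le_trans; apply: ler0n.
Qed.

Lemma ray_orb n m (y : {ffun node G -> rat}) :
  ray n m y = \sum_p orb y p / vpos v p * ray n m (ofint (v p)).
Proof.
rewrite /ray (orb_expansion treeG negG ordG y n) (orb_expansion treeG negG ordG y m).
rewrite !mulr_suml -sumrB; apply: eq_bigr => p _.
by rewrite !ffunE !vE; field; rewrite gt_eqF.
Qed.

(** In terms of the [v_p] the coefficients are nonnegative, and each [v_p] is on
    one of the two rays. *)
Lemma ray_ge0 n m (y : {ffun node G -> rat}) : nbr n m -> (forall p, 0 <= orb y p) -> 0 <= ray n m y.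
Proof.
move=> nm y0; rewrite ray_orb sumr_ge0 // => p _; rewrite mulr_ge0 ?divr_ge0 ?(ltW (w0 _)) //.
case/orP: (side_cover treeG p nm) => ps.
  exact/ltW/(ray_on treeG negG w0 vE nm).
by rewrite (ray_off treeG negG vE (_ : nbr m n)) // nbr_sym.
Qed.

(** The coordinates of [l + c] are nonnegative, those of [c] less than 1. *)
Lemma gr_ge0 k I l p : krange G k -> hatN G \subset I -> gr R ord v a k I l -> 0 <= (l p)%:Q.
Proof.
move=> kr hI lgr; apply: int_gtN1; first exact: intr_int.
have /andP[_ c1] := c01 p.
have := orb_expansion treeG negG ordG (ofint l + c) p.
have : 0 <= \sum_n orb (ofint l + c) n * Estar (val n) (val p).
  by rewrite sumr_ge0 // => n _; rewrite mulr_ge0 ?(gr_orb_ge0 _ kr hI lgr) // ltW // Estar_gt0.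
by move=> + e; rewrite -e [X in 0 <= X]ffunE [ofint l p]ffunE /c; lra.
Qed.

(** The combination of monomials that makes up the series, applied to an
    arbitrary function of the exponent and of the factors of the denominator. *)
Definition lin (F : {ffun node G -> int} -> {set node G} -> series G) : series G :=
  \sum_(I : {set node G} | hatN G \subset I) \sum_(k <- kseq G) \sum_(l <- grseq R ord a v k I)
    F l (~: I)%SET *~ (kcoef k * signI I).

Lemma lin_in (C : series G -> Prop) F : zlin C ->
  (forall k I l, krange G k -> hatN G \subset I -> gr R ord v a k I l -> C (F l (~: I)%SET)) -> C (lin F).
Proof.
move=> zC h'; apply: zlin_sum => // I hI; rewrite big_seq; apply: zlin_sum => // k.
rewrite mem_kseq => kr; rewrite big_seq; apply: zlin_sum => // l /mem_grseq lgr.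
by case: zC => _ _; apply; apply: h' lgr.
Qed.

Lemma eq_lin F F' :
  (forall k I l, krange G k -> hatN G \subset I -> gr R ord v a k I l -> F l (~: I)%SET = F' l (~: I)%SET) ->
  lin F = lin F'.
Proof.
move=> e; apply: eq_bigr => I hI; apply: eq_big_seq => k /mem_kseq kr.
by apply: eq_big_seq => l /mem_grseq lgr; rewrite (e _ _ _ kr hI lgr).
Qed.

Lemma lin_morph (Phi : series G -> series G) F : Phi 0 = 0 ->
  (forall f g, Phi (f + g) = Phi f + Phi g) -> (forall f (z : int), Phi (f *~ z) = Phi f *~ z) ->
  Phi (lin F) = lin (fun l J => Phi (F l J)).
Proof.
move=> P0 PD PM; rewrite /lin (big_morph Phi PD P0); apply: eq_bigr => I _.
rewrite (big_morph Phi PD P0); apply: eq_bigr => k _.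
by rewrite (big_morph Phi PD P0); apply: eq_bigr => l _.
Qed.

Lemma lin_sum T (r : seq T) (q : pred T) (F : T -> {ffun node G -> int} -> {set node G} -> series G) :
  lin (fun l J => \sum_(i <- r | q i) F i l J) = \sum_(i <- r | q i) lin (F i).
Proof.
rewrite /lin [RHS]exchange_big; apply: eq_bigr => I _.
rewrite [RHS]exchange_big; apply: eq_bigr => k _.
by rewrite [RHS]exchange_big; apply: eq_bigr => l _; rewrite mulrz_suml.
Qed.

Lemma linMz (z : int) F : lin (fun l J => F l J *~ z) = lin F *~ z.
Proof.
rewrite /lin mulrz_suml; apply: eq_bigr => I _.
rewrite mulrz_suml; apply: eq_bigr => k _.
by rewrite mulrz_suml; apply: eq_bigr => l _; rewrite mulrzAC.
Qed.

Lemma linB F F' : lin F - lin F' = lin (fun l J => F l J - F' l J).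
Proof.
rewrite /lin -sumrB; apply: eq_bigr => I _.
rewrite -sumrB; apply: eq_bigr => k _.
by rewrite -sumrB; apply: eq_bigr => l _; rewrite mulrzBl.
Qed.

Lemma tmulMz e f (z : int) : tmul e (f *~ z) = tmul e f *~ z :> series G.
Proof. by apply/funext => x; rewrite /tmul !seriesMz. Qed.

Lemma lin_tmul F : tmul c (lin F) = lin (fun l J => tmul c (F l J)).
Proof. by apply: lin_morph => // f z; rewrite tmulMz. Qed.

Lemma lin_mulden K F : mulden v K (lin F) = lin (fun l J => mulden v K (F l J)).
Proof. by apply: lin_morph => *; rewrite !mulden_md ?md0 ?mdD ?mdMz. Qed.

Let K := (~: hatN G)%SET.

Lemma compl_sub I : hatN G \subset I -> ~: I \subset K.
Proof. by rewrite finset.setCS. Qed.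

(** Of the factors indexed by [K], those outside of [I] turn the cell into [gr],
    and the others remain. *)
Lemma mulden_Zh : mulden v K (Zh h) = lin (fun l J => mulden v (K :\: J) (mono (ofint l + c))).
Proof.
rewrite (Zh_cells treeG negG ordG n0 ah deg1) mulden_md md_tmul -mulden_md.
transitivity (tmul c (lin (fun l J => mulden v (K :\: J) (mono (ofint l))))); last first.
  rewrite lin_tmul; apply: eq_lin => k I l _ _ _.
  by rewrite !mulden_md -md_tmul tmul_mono addrC.
congr (tmul c _); rewrite mulden_md md_sum /lin; apply: eq_bigr => I hI.
rewrite mdMz md_sum mulrz_suml; apply: eq_big_seq => k /mem_kseq kr.
rewrite mdMz -mulrzA -mulden_md (mulden_diff _ _ (compl_sub hI)).
by rewrite (mulden_cell treeG negG ordG n0 adm kr hI) mulden_md md_sum mulrz_suml.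
Qed.

(** The remainders of the monomials add up, and polynomial parts are unique. *)
Lemma Ph_chainE n m : nbr n m ->
  Ph_chain R v h n m = tmul c (lin (fun l J => Pol_chain R v l J n m)).
Proof.
move=> nm; set P := tmul c _.
have PP : is_Ph_chain R v h n m P.
  have piece k I l (kr : krange G k) (hI : hatN G \subset I) (lgr : gr R ord v a k I l) :=
    chain_piece R treeG negG w0 vE c01 nm (compl_sub hI) (gr_ge0 n kr hI lgr) (gr_ge0 m kr hI lgr)
      (ray_ge0 nm (fun p => gr_orb_ge0 p kr hI lgr))
      (ray_ge0 (etrans (nbr_sym treeG _ _) nm) (fun p => gr_orb_ge0 p kr hI lgr)).
  apply/is_Ph_chainE; rewrite /P lin_tmul; split.
    by apply: lin_in => [|k I l kr hI lgr]; [exact: zlin_lsupp|case: (piece _ _ _ kr hI lgr)].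
  rewrite mulden_md mdB -!mulden_md mulden_Zh lin_mulden linB.
  by apply: lin_in => [|k I l kr hI lgr]; [exact: zlin_rdec|case: (piece _ _ _ kr hI lgr)].
rewrite /Ph_chain; case: xgetP => [Q _ QP|/(_ P)//].
exact: (is_Ph_chain_unique treeG negG w0 vE nm QP PP).
Qed.

Lemma Ph_nodeE n : Ph_node R v h n = tmul c (lin (fun l J => Pol_node R v l J n)).
Proof.
set P := tmul c _.
have PP : is_Ph_node R v h n P.
  have piece k I l (kr : krange G k) (hI : hatN G \subset I) (lgr : gr R ord v a k I l) :=
    node_piece R treeG negG w0 vE c01 (compl_sub hI) (gr_ge0 n kr hI lgr).
  apply/(is_Ph_nodeE R treeG negG w0 vE); rewrite /P lin_tmul; split.
    by apply: lin_in => [|k I l kr hI lgr]; [exact: zlin_lsupp|case: (piece _ _ _ kr hI lgr)].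
  rewrite mulden_md mdB -!mulden_md mulden_Zh lin_mulden linB.
  by apply: lin_in => [|k I l kr hI lgr]; [exact: zlin_lsupp|case: (piece _ _ _ kr hI lgr)].
rewrite /Ph_node; case: xgetP => [Q _ QP|/(_ P)//].
exact: (is_Ph_node_unique treeG negG w0 vE QP PP).
Qed.

End Final.

Theorem corollary6p3p1 (R : realType) (G : plumbing) (ord : rel (node G))
    (h : {ffun G -> rat}) (a : redlift G)
    (v : node G -> {ffun node G -> int}) :
  minimal_good_graph G ->
  (exists n0 : node G, True) ->
  orientation ord ->
  (forall n : node G, (1 <= degN n)%N) ->
  inL' h ->
  same_class (lift_elt ord a) h ->
  (forall n : node G, 0 <= cvec ord a n < 1) ->
  (forall k, krange G k -> admissible R ord v (lift_sub a k) 1) ->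
  Ph R ord v h =
  tmul (cvec ord a)
    (\sum_(I : {set node G} | hatN G \subset I)
      (\sum_(k \in krange G)
        (\sum_(l \in gr R ord v a k I) Pol R ord v l (~: I)%SET) *~ kcoef k)
      *~ ((-1) ^+ #|(I :\: hatN G)%SET|)).
Proof.
move=> [treeG negG _] [n0 _] ordG deg1 _ ah c01 adm.
transitivity (tmul (cvec ord a) (lin R ord a v (Pol R ord v))); last first.
  congr (tmul _ _); apply: eq_bigr => I _; rewrite (fsbig_elems _ (finite_krange G)) mulrz_suml.
  apply: eq_bigr => k _; rewrite (fsbig_elems _ (finite_gr R ord a v k I)) -mulrzA mulrz_suml.
  by [].
pose c := cvec ord a.
have e1 : lin R ord a v (Pol R ord v) =
    \sum_n \sum_(m | below ord n m) lin R ord a v (fun l J => Pol_chain R v l J n m)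
    - \sum_n lin R ord a v (fun l J => Pol_node R v l J n) *~ ((degN n)%:Z - 1).
  rewrite /Pol -linB !lin_sum; congr (_ - _).
    by apply: eq_bigr => n _; rewrite lin_sum.
  by apply: eq_bigr => n _; rewrite linMz.
have tsum T (r : seq T) (q : pred T) F : tmul c (\sum_(i <- r | q i) F i) = \sum_(i <- r | q i) tmul c (F i).
  by apply: (big_morph (tmul c)).
rewrite e1 tmulD tmulN !tsum /Ph; congr (_ - _).
  apply: eq_bigr => n _; rewrite tsum; apply: eq_bigr => m /andP[nm _].
  exact: (Ph_chainE treeG negG ordG n0 adm ah deg1 c01).
apply: eq_bigr => n _; rewrite tmulMz; congr (_ *~ _).
exact: (Ph_nodeE treeG negG ordG n0 adm ah deg1 c01).
Qed.
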